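(* Let $n\ge 2$. For all $N\in\mathbb N$ there exists a family $\{\Omega_{\varepsilon,N}\}_{\varepsilon\in(0,\varepsilon_0)}$ (for some $\varepsilon_0>0$) of bounded Lipschitz domains of the Euclidean space $\mathbb R^n$ such that $$\lim_{\varepsilon\to0^+}\frac{\mu_j}{m_j^2}=0$$ for all $N+2\le j\le (N+1)(n+1)$, where $\mu_j=\mu_j(\Omega_{\varepsilon,N})$ and $m_j=m_j(\Omega_{\varepsilon,N})$ denote respectively the biharmonic Neumann eigenvalues and the Neumann eigenvalues of the Laplacian on $\Omega_{\varepsilon,N}$.
   Context: $\mathbb N$ is the set of positive integers; a domain is a connected open set. For a bounded Lipschitz domain $\Omega\subset\mathbb R^n$, the biharmonic Neumann eigenvalues $\mu_1\le\mu_2\le\cdots$ (repeated according to multiplicity) are the eigenvalues of the problem $\int_\Omega\langle D^2u,D^2\phi\rangle dv=\mu\int_\Omega u\phi\,dv$ for all $\phi\in H^2(\Omega)$, with $u\in H^2(\Omega)$, $\mu\in\mathbb R$; equivalently $$\mu_j=\min_{\substack{U\subset H^2(\Omega)\\ \dim U=j}}\max_{0\ne u\in U}\frac{\int_\Omega|D^2u|^2dv}{\int_\Omega u^2dv}.$$ The Neumann eigenvalues of the Laplacian are $$m_j=\min_{\substack{U\subset H^1(\Omega)\\ \dim U=j}}\max_{0\ne u\in U}\frac{\int_\Omega|\nabla u|^2dv}{\int_\Omega u^2dv}.$$ Here $H^1(\Omega),H^2(\Omega)$ are the standard Sobolev spaces. *)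

(* Defs.v *)
From HB Require Import structures.
From mathcomp Require Import all_boot all_order all_algebra.
From mathcomp Require Import all_classical all_reals all_analysis.

Set Implicit Arguments.
Unset Strict Implicit.
Unset Printing Implicit Defensive.

Import Order.TTheory GRing.Theory Num.Theory.
Import numFieldNormedType.Exports.

Local Open Scope classical_set_scope.
Local Open Scope ring_scope.

(* R^n is 'rV[R]_n with its library (product) topology; [rV_n] is equipped with
   the sigma-algebra generated by the coordinates, which is the Borel one. *)

Definition rV_display : measure_display.
Proof. exact: default_measure_display. Qed.

Section measurable_rV.
Context {R : realType} {n : nat}.

Definition rV_coord (i : 'I_n) (v : 'rV[R]_n) : R := v ord0 i.

Let rV_set0 : g_sigma_preimage rV_coord set0.
Proof. exact: sigma_algebra0. Qed.

Let rV_setC A : g_sigma_preimage rV_coord A -> g_sigma_preimage rV_coord (~` A).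
Proof. exact: sigma_algebraC. Qed.

Let rV_bigcup (F : (set 'rV[R]_n)^nat) :
  (forall i, g_sigma_preimage rV_coord (F i)) ->
  g_sigma_preimage rV_coord (\bigcup_i (F i)).
Proof. exact: sigma_algebra_bigcup. Qed.

HB.instance Definition _ := @isMeasurable.Build rV_display
  'rV[R]_n (g_sigma_preimage rV_coord) rV_set0 rV_setC rV_bigcup.

Lemma measurable_rV_coord (i : 'I_n) : measurable_fun [set: 'rV[R]_n] (rV_coord i).
Proof.
move=> _ Y mY; rewrite setTI; apply: sub_sigma_algebra => /=.
rewrite -bigcup_seq/=; exists i => /=; first by rewrite mem_index_enum.
by exists Y => //; rewrite setTI.
Qed.

Lemma measurable_fun_rVP d (T : measurableType d) (f : T -> 'rV[R]_n) :
  measurable_fun [set: T] f <->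
  forall i, measurable_fun [set: T] (rV_coord i \o f).
Proof.
split=> [mf i|mf].
  exact: measurableT_comp (measurable_rV_coord i) mf.
suff sub : g_sigma_preimage (fun i => rV_coord i \o f) `<=` measurable.
  by move=> _ A mA; apply: sub; rewrite g_sigma_preimage_comp; exists A.
apply: smallest_sub; first exact: sigma_algebra_measurable.
move=> A; rewrite -bigcup_seq => -[i _ [B mB <-]]; exact: mf.
Qed.

End measurable_rV.

Section lebesgue_rV.
Context {R : realType}.

Definition rV_cons {n} (p : measurableTypeR R * 'rV[R]_n) : 'rV[R]_n.+1 :=
  row_mx (const_mx (p.1 : R) : 'rV[R]_1) p.2.

Lemma rV_cons_lshift n (p : measurableTypeR R * 'rV[R]_n) (j : 'I_1) :
  rV_coord (lshift n j) (rV_cons p) = p.1.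
Proof. by rewrite /rV_coord /rV_cons (row_mxEl (const_mx _)) mxE. Qed.

Lemma rV_cons_rshift n (p : measurableTypeR R * 'rV[R]_n) (j : 'I_n) :
  rV_coord (rshift 1 j) (rV_cons p) = rV_coord j p.2.
Proof. by rewrite /rV_coord /rV_cons (row_mxEr (const_mx _)). Qed.

Lemma measurable_rV_cons n : measurable_fun setT (@rV_cons n).
Proof.
apply/measurable_fun_rVP => i.
case: (@splitP 1 n i) => j ij.
  have -> : i = lshift n j by exact/val_inj.
  rewrite (_ : _ \o _ = fst); first exact: measurable_fst.
  by apply/funext => p /=; rewrite rV_cons_lshift.
have -> : i = rshift 1 j by exact/val_inj.
rewrite (_ : _ \o _ = rV_coord j \o snd).
  exact: measurableT_comp (measurable_rV_coord j) measurable_snd.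
by apply/funext => p /=; rewrite rV_cons_rshift.
Qed.

Definition rV_uncons {n} (v : 'rV[R]_n.+1) : measurableTypeR R * 'rV[R]_n :=
  (v ord0 ord0, \row_j v ord0 (lift ord0 j)).

Lemma measurable_rV_uncons n : measurable_fun setT (@rV_uncons n).
Proof.
apply/measurable_fun_pairP; split.
  exact: (@measurable_rV_coord R n.+1 ord0).
apply/measurable_fun_rVP => i.
rewrite (_ : _ \o _ = rV_coord (lift ord0 i)); first exact: measurable_rV_coord.
by apply/funext => v /=; rewrite /rV_coord /rV_uncons mxE.
Qed.

Lemma rV_consK n : cancel (@rV_cons n) rV_uncons.
Proof.
move=> [x v]; rewrite /rV_uncons; congr pair.
  have -> : ord0 = lshift n (ord0 : 'I_1) by exact/val_inj.
  exact: (rV_cons_lshift (x, v)).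
apply/rowP => j; rewrite mxE.
have -> : lift ord0 j = rshift 1 j by exact/val_inj.
exact: (rV_cons_rshift (x, v)).
Qed.

Section step.
Variables (n : nat) (mu : {sigma_finite_measure set 'rV[R]_n -> \bar R}).

Definition lebesgue_rV_step : set 'rV[R]_n.+1 -> \bar R :=
  pushforward ((@lebesgue_measure R) \x mu)%E (@rV_cons n).

Let step0 : lebesgue_rV_step set0 = 0%E.
Proof. by rewrite /lebesgue_rV_step /pushforward preimage_set0 measure0. Qed.

Let step_ge0 A : (0 <= lebesgue_rV_step A)%E.
Proof. by rewrite /lebesgue_rV_step /pushforward measure_ge0. Qed.

Let step_sigma_additive : semi_sigma_additive lebesgue_rV_step.
Proof.
move=> F mF tF mUF; rewrite /lebesgue_rV_step /pushforward preimage_bigcup.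
apply: measure_semi_sigma_additive.
- by move=> k; rewrite -[X in measurable X]setTI; exact: measurable_rV_cons.
- apply/trivIsetP => /= i j _ _ ij; rewrite -preimage_setI.
  by move/trivIsetP : tF => /(_ _ _ _ _ ij) ->//; rewrite preimage_set0.
- by rewrite -preimage_bigcup -[X in measurable X]setTI; exact: measurable_rV_cons.
Qed.

HB.instance Definition _ := isMeasure.Build _ _ _ lebesgue_rV_step
  step0 step_ge0 step_sigma_additive.

Let step_sigma_finite : sigma_finite setT lebesgue_rV_step.
Proof.
have /sigma_finiteP[F [TF ndF Foo]] := sigma_finiteT (@lebesgue_measure R).
have /sigma_finiteP[G [TG ndG Goo]] := sigma_finiteT mu.
exists (fun k => rV_uncons @^-1` (F k `*` G k)).
  rewrite -preimage_bigcup (_ : \bigcup_k _ = setT) ?preimage_setT//.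
  rewrite -setXTT TF TG predeqE => -[x y]; split.
    by move=> [k _ []/= ? ?]; split; exists k.
  move=> [/= [k _ Fkx] [l _ Gly]]; exists (maxn k l) => //; split.
  - by move: x Fkx; exact/subsetPset/ndF/leq_maxl.
  - by move: y Gly; exact/subsetPset/ndG/leq_maxr.
move=> k; have [mF Fkoo] := Foo k; have [mG Gkoo] := Goo k; split.
  rewrite -[X in measurable X]setTI; apply: measurable_rV_uncons => //.
  exact: measurableX.
rewrite /lebesgue_rV_step /pushforward (_ : _ @^-1` _ = F k `*` G k).
  by rewrite product_measure1E// lte_mul_pinfty// ge0_fin_numE.
by apply/funext => p; rewrite /preimage /= /mkset /= -[in RHS](rV_consK p).
Qed.

HB.instance Definition _ := Measure_isSigmaFinite.Build _ _ _ lebesgue_rV_step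
  step_sigma_finite.

End step.

Fixpoint lebesgue_rV (n : nat) : {sigma_finite_measure set 'rV[R]_n -> \bar R} :=
  match n with
  | 0 => [the {sigma_finite_measure set 'rV[R]_0 -> \bar R} of \d_(0 : 'rV[R]_0)]
  | m.+1 => [the {sigma_finite_measure set 'rV[R]_m.+1 -> \bar R}
             of lebesgue_rV_step (lebesgue_rV m)]
  end.

End lebesgue_rV.

Section sobolev.
Context {R : realType} {n : nat}.
Implicit Types (Omega : set 'rV[R]_n) (u g phi : 'rV[R]_n -> R) (i j : 'I_n).

Definition dotrv (x y : 'rV[R]_n) : R := \sum_i x ord0 i * y ord0 i.

(* Near each boundary point the open set is the strict epigraph, in some
   direction e, of a Lipschitz function of the component orthogonal to e. *)
Definition lipschitz_boundary Omega : Prop :=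
  forall p, closure Omega p -> ~ Omega p ->
    exists (e : 'rV[R]_n) (gamma : 'rV[R]_n -> R),
      [/\ dotrv e e = 1, lipschitz gamma &
        \forall y \near p,
          Omega y <-> gamma (y - dotrv y e *: e) < dotrv y e].

Definition bounded_lipschitz_domain Omega : Prop :=
  [/\ Omega !=set0, open Omega, connected Omega, bounded_set Omega &
      lipschitz_boundary Omega].

Definition partial i u : 'rV[R]_n -> R := 'D_(delta_mx ord0 i) u.

Fixpoint Ck (k : nat) u : Prop :=
  match k with
  | 0 => continuous u
  | l.+1 => continuous u /\
      forall i, (forall x, derivable u x (delta_mx ord0 i)) /\ Ck l (partial i u)
  end.

Definition test_function Omega phi : Prop :=
  let supp := closure [set x | phi x != 0] in
  [/\ forall k, Ck k phi, compact supp & supp `<=` Omega].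

Definition L2 Omega u : Prop :=
  measurable_fun Omega u /\
  (\int[lebesgue_rV n]_(x in Omega) ((u x) ^+ 2)%:E < +oo)%E.

Definition is_weak_partial Omega i u g : Prop :=
  forall phi, test_function Omega phi ->
    \int[lebesgue_rV n]_(x in Omega) (u x * partial i phi x) =
    - \int[lebesgue_rV n]_(x in Omega) (g x * phi x).

(* A choice of representative, unique up to a.e. equality on Omega. *)
Definition weak_partial Omega i u : 'rV[R]_n -> R :=
  xget (cst 0) [set g | L2 Omega g /\ is_weak_partial Omega i u g].

Definition H1 Omega u : Prop :=
  L2 Omega u /\ forall i, exists g, L2 Omega g /\ is_weak_partial Omega i u g.

Definition H2 Omega u : Prop :=
  H1 Omega u /\ forall i, H1 Omega (weak_partial Omega i u).

Definition grad_energy Omega u : R :=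
  \int[lebesgue_rV n]_(x in Omega) \sum_i weak_partial Omega i u x ^+ 2.

Definition hessian_energy Omega u : R :=
  \int[lebesgue_rV n]_(x in Omega)
    \sum_i \sum_j weak_partial Omega j (weak_partial Omega i u) x ^+ 2.

Definition L2_sqnorm Omega u : R := \int[lebesgue_rV n]_(x in Omega) u x ^+ 2.

Section minmax.
Variable k : nat.

Definition lincomb (w : 'I_k -> 'rV[R]_n -> R) (c : 'rV[R]_k) : 'rV[R]_n -> R :=
  fun x => \sum_l c ord0 l * w l x.

(* Linear independence in L^2(Omega), i.e. modulo a.e. equality on Omega. *)
Definition lin_indep Omega (w : 'I_k -> 'rV[R]_n -> R) : Prop :=
  forall c : 'rV[R]_k,
    {ae lebesgue_rV n, forall x, Omega x -> lincomb w c x = 0} -> c = 0.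

(* The minimum over the k-dimensional subspaces U of H, each given by a basis w,
   of the maximum over 0 <> u in U of energy u / |u|^2; where the two extrema
   are attained they are these infimum and supremum. *)
Definition minmax Omega (H : ('rV[R]_n -> R) -> Prop)
    (energy : ('rV[R]_n -> R) -> R) : \bar R :=
  ereal_inf
    [set ereal_sup [set (energy (lincomb w c) / L2_sqnorm Omega (lincomb w c))%:E
                   | c in [set c : 'rV[R]_k | c != 0]]
    | w in [set w : 'I_k -> 'rV[R]_n -> R | (forall l, H (w l)) /\ lin_indep Omega w]].

End minmax.

(* Eigenvalues are numbered from 1. On a nonempty bounded Lipschitz domain and
   for 1 <= k the extended-real value is finite, so [fine] loses nothing. *)
Definition biharmonic_neumann_eigenvalue Omega (k : nat) : R :=
  fine (minmax k Omega (H2 Omega) (hessian_energy Omega)).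

Definition laplace_neumann_eigenvalue Omega (k : nat) : R :=
  fine (minmax k Omega (H1 Omega) (grad_energy Omega)).

End sobolev.

(* Main.v *)
From HB Require Import structures.
Require Import Defs.
From mathcomp Require Import all_boot all_order all_algebra.
From mathcomp Require Import all_classical all_reals all_analysis.
From mathcomp Require Import measurable_realfun ring lra.
Import Order.TTheory GRing.Theory Num.Theory.
Import numFieldNormedType.Exports.
Local Open Scope classical_set_scope.
Local Open Scope ring_scope.

Set Implicit Arguments.
Unset Strict Implicit.
Unset Printing Implicit Defensive.

(** The domain is a row of N + 1 boxes of fixed size, neighbours being joined
    by a channel whose height in one transversal direction is eps.

    A function that is affine on each box has no Hessian energy there, and the
    functions that are affine on each box form a space of dimension
    (N + 1)(n + 1).  Cutting from one affine function to the next inside the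
    channels costs an energy O(eps), because the cutoffs have bounded second
    derivatives and the channels have volume O(eps).  Hence the biharmonic
    eigenvalue of index j is O(eps) for j <= (N + 1)(n + 1)
    ([biharmonic_upper_bound]).  The gradient, on the contrary, vanishes on the
    boxes only for functions that are constant on each box, and these form a
    space of dimension N + 1: a function of mean zero on every box satisfies a
    Poincare inequality whose constant does not depend on eps
    ([dumbbell_poincare]), and so the Laplace eigenvalues of index j >= N + 2
    stay above a positive constant ([laplace_lower_bound]).  The quotient is therefore O(eps).

    The uniform Poincare inequality rests on one fact about Sobolev functions:
    if every segment from x to x + t e_i with x in D lies in Omega, then the
    integral over D of (u(x + t e_i) - u(x))^2 is at most t^2 times the integral
    over Omega of (d_i u)^2 ([translation_estimate], [shift_estimate]).  Averaged
    over all pairs of points of a box it gives the Poincare inequality on a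
    box ([box_poincare]).  Applied to the translation along the row that
    carries one half of a channel into the neighbouring box, it bounds the L2
    norm on the channel by the L2 norm on the box plus the energy, uniformly in
    the height of the channel, since the walls only recede along the way
    ([bridge_path], [shifted_piece]).  The translation estimate follows from the
    definition of weak derivatives alone: the average of a product test function
    over the translations by s e_i, 0 <= s <= t, is a test function whose i-th
    derivative is, up to a factor, the difference of the function and of its
    translate by t e_i ([translation_test_identity]), and product test functions
    separate integrable functions ([fundamental_lemma]).

    For the upper bound one needs to know that the chosen representatives of the
    weak derivatives agree almost everywhere with the classical derivatives of
    the trial functions ([classical_weak_partial], [weak_partial_unique]).

    The boundary is Lipschitz because, near each point, the domain is described
    by finitely many Lipschitz inequalities f_a < 0 whose left-hand sides all
    decrease at least at unit rate in one common direction; their maximum then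
    vanishes exactly once on each line of that direction, along a Lipschitz
    graph ([epigraph_of_family]). *)

(** * Smooth functions of one variable *)

Section smooth1.
Context {R : realType}.
Implicit Types (f g : R -> R) (k : nat).

Fixpoint Ck1 k f : Prop :=
  match k with
  | 0 => continuous f
  | l.+1 => (forall x, derivable f x 1) /\ Ck1 l (derive1 f)
  end.

Definition smooth f := forall k, Ck1 k f.

Lemma derive1_fun f g : (forall x, is_derive x (1 : R) f (g x)) -> (derive1 f) = g.
Proof. by move=> fg; apply/funext => x; rewrite derive1E derive_val. Qed.

Lemma continuous_of_derive f g :
  (forall x, is_derive x (1 : R) f (g x)) -> continuous f.
Proof.
by move=> fg x; apply: differentiable_continuous; apply/derivable1_diffP; case: (fg x).
Qed.

Lemma is_derive1P f x : derivable f x 1 -> is_derive x (1 : R) f (derive1 f x).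
Proof. by move=> df; rewrite derive1E; exact: derivableP. Qed.

Lemma Ck1_cont k f : Ck1 k f -> continuous f.
Proof.
case: k => //= k [df _] x; apply: differentiable_continuous.
exact/derivable1_diffP.
Qed.

Lemma Ck1S k f : Ck1 k.+1 f -> Ck1 k f.
Proof.
elim: k f => [f|k IH f [df Ck]]; first exact: Ck1_cont.
by split => //; exact: IH.
Qed.

(** With this lemma smoothness is proved by exhibiting a family of functions
    that is closed under derivation. *)
Lemma smooth_of_derive f g :
  (forall x, is_derive x (1 : R) f (g x)) -> smooth g -> smooth f.
Proof.
move=> fg sg [|k]; first exact: continuous_of_derive fg.
split; first by move=> x; case: (fg x).
by rewrite (derive1_fun fg).
Qed.

Lemma smooth_is_derive f x : smooth f -> is_derive x (1 : R) f (derive1 f x).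
Proof. by move=> /(_ 1%N)[df _]; exact: is_derive1P. Qed.

Lemma smooth_derive1 f : smooth f -> smooth (derive1 f).
Proof. by move=> sf k; have [] := sf k.+1. Qed.

Lemma smooth_cont f : smooth f -> continuous f.
Proof. exact: (fun h => h 0%N). Qed.

Lemma smooth_cst c : smooth (cst c).
Proof.
move=> k; elim: k c => [|k IH] c; first by move=> x; exact: cvg_cst.
split => //; rewrite (@derive1_fun _ (cst 0)) // => x.
Qed.

Lemma Ck1_add k f g : Ck1 k f -> Ck1 k g -> Ck1 k (f \+ g).
Proof.
elim: k f g => [f g cf cg x|k IH f g [df Cf] [dg Cg]].
  by apply: continuousD; [exact: cf|exact: cg].
have h x : is_derive x (1 : R) (f \+ g) ((derive1 f) x + (derive1 g) x).
  by apply: is_deriveD; exact: is_derive1P.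
split; first by move=> x; case: (h x).
by rewrite (derive1_fun h); exact: IH.
Qed.

Lemma smooth_add f g : smooth f -> smooth g -> smooth (f \+ g).
Proof. by move=> sf sg k; exact: Ck1_add. Qed.

Lemma Ck1_mul k f g : Ck1 k f -> Ck1 k g -> Ck1 k (f \* g).
Proof.
elim: k f g => [f g cf cg x|k IH f g Cf Cg].
  by apply: continuousM; [exact: cf|exact: cg].
have [df Cf'] := Cf; have [dg Cg'] := Cg.
have h x : is_derive x (1 : R) (f \* g) (f x * (derive1 g) x + (derive1 f) x * g x).
  apply: is_derive_eq; first by apply: is_deriveM; exact: is_derive1P.
  by rewrite /GRing.scale /=; ring.
split; first by move=> x; case: (h x).
rewrite (derive1_fun h); apply: (@Ck1_add k (f \* (derive1 g)) ((derive1 f) \* g)).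
  by apply: IH => //; exact: Ck1S.
by apply: IH => //; exact: Ck1S.
Qed.

Lemma smooth_mul f g : smooth f -> smooth g -> smooth (f \* g).
Proof. by move=> sf sg k; exact: Ck1_mul. Qed.

Lemma smooth_scale c f : smooth f -> smooth (fun x => c * f x).
Proof. by move=> sf; apply: (@smooth_mul (cst c) f) => //; exact: smooth_cst. Qed.

Lemma smooth_sub f g : smooth f -> smooth g -> smooth (fun x => f x - g x).
Proof.
move=> sf sg; have -> : (fun x => f x - g x) = f \+ (fun x => -1 * g x).
  by apply/funext => x /=; rewrite mulN1r.
by apply: smooth_add => //; exact: smooth_scale.
Qed.

Lemma smooth_exp f m : smooth f -> smooth (fun x => f x ^+ m).
Proof.
move=> sf; elim: m => [|m IH].
  rewrite (_ : (fun _ => _) = cst 1); first exact: smooth_cst.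
  by apply/funext => x; rewrite expr0.
rewrite (_ : (fun _ => _) = f \* (fun x => f x ^+ m)); first exact: smooth_mul.
by apply/funext => x; rewrite exprS.
Qed.

Lemma smooth_id : smooth id.
Proof.
apply: (@smooth_of_derive _ (cst 1)); last exact: smooth_cst.
Qed.

Lemma is_derive_affine f (df a b x : R) :
  is_derive (a * x + b) (1 : R) f df -> is_derive x (1 : R) (fun y => f (a * y + b)) (a * df).
Proof.
move=> fdf.
have ha : is_derive x (1 : R) (fun y : R => a * y + b) a.
  have h1 : is_derive x (1 : R) (fun y : R => a *: y) (a *: 1) by exact: is_deriveZ.
  have h2 := is_deriveD h1 (is_derive_cst b x (1 : R)).
  by apply: is_derive_eq; rewrite addr0 /GRing.scale /= mulr1.
have := @is_derive1_comp R f (fun y : R => a * y + b) x _ _ fdf ha.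
by rewrite mulrC.
Qed.

Lemma smooth_affine f (a b : R) : smooth f -> smooth (fun x => f (a * x + b)).
Proof.
move=> sf k; elim: k f sf => [|k IH] f sf.
  apply: continuous_of_derive => x; apply: is_derive_affine; exact: smooth_is_derive.
have h x : is_derive x (1 : R) (fun y => f (a * y + b)) (a * (derive1 f) (a * x + b)).
  by apply: is_derive_affine; exact: smooth_is_derive.
split; first by move=> x; case: (h x).
rewrite (derive1_fun h); apply: (@Ck1_mul k (cst a)); first exact: smooth_cst.
by apply: IH; exact: smooth_derive1.
Qed.

End smooth1.

Section bump1.
Context {R : realType}.
Implicit Types (f g : R -> R) (p : {poly R}).

(** Differentiability of [flat] at the origin, where its formula changes. *)
Lemma is_derive0_quadratic f (C : R) :
  (forall h, `|h| <= 1 -> `|f h| <= C * h ^+ 2) -> is_derive (0 : R) (1 : R) f 0.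
Proof.
move=> fC.
have f0 : f 0 = 0.
  by have := fC 0; rewrite normr0 expr0n/= mulr0 normr_le0 => /(_ ler01)/eqP.
have C0 : 0 <= C.
  by have := fC 1; rewrite normr1 expr1n mulr1 => /(_ (lexx 1)); apply: le_trans.
have cv : h^-1 *: (f (h *: (1 : R) + 0) - f 0) @[h --> (0 : R)^'] --> (0 : R).
  apply/cvgr0Pnorm_le => e e0; near=> h.
  have h0 : h != 0 by near: h; exact: nbhs_dnbhs_neq.
  have h1 : `|h| <= Num.min 1 (e / (C + 1)).
    near: h; apply: dnbhs0_le; rewrite lt_min ltr01 divr_gt0//.
    by rewrite ltr_wpDl.
  rewrite f0 subr0 addr0 [_ *: (1 : R)]mulr1 normrZ normfV.
  rewrite mulrC ler_pdivrMr ?normr_gt0//.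
  have [h11 h12] : `|h| <= 1 /\ `|h| <= e / (C + 1) by move: h1; rewrite le_min => /andP[].
  apply: (le_trans (fC _ h11)).
  rewrite -real_normK ?num_real// expr2 mulrA ler_wpM2r//.
  move: h12; rewrite ler_pdivlMr ?ltr_wpDl// => h12.
  apply: le_trans h12; rewrite mulrC ler_wpM2l//.
  by rewrite lerDl.
by apply: DeriveDef; [apply/cvg_ex; exists 0|apply/cvg_lim].
Unshelve. all: by end_near. Qed.

Lemma poly_le_exp p : exists C d, 0 <= C /\ forall y, 1 <= y -> `|p.[y]| <= C * y ^+ d.
Proof.
elim/poly_ind: p => [|p c [C [d [C0 IH]]]].
  by exists 0, 0%N; split => // y _; rewrite horner0 normr0 mul0r.
exists (C + `|c|), d.+1; split; first by rewrite addr_ge0.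
move=> y y1; rewrite hornerMXaddC (le_trans (ler_normD _ _))//.
have y0 : 0 <= y by rewrite (le_trans _ y1).
rewrite mulrDl lerD//.
  by rewrite normrM (ger0_norm y0) exprSr mulrA ler_wpM2r// IH.
by rewrite ler_peMr// exprn_ege1.
Qed.

(** The functions p(1/x) exp(-1/x), extended by 0 to x <= 0: unlike exp(-1/x)
    alone, they are closed under derivation. *)
Definition flat p (x : R) : R := if 0 < x then p.[x^-1] * expR (- x^-1) else 0.

(** exp(-1/x) beats the polynomial growth of p(1/x): if p has degree at most d,
    the term of degree d + 2 of the exponential series gives the bound. *)
Lemma flat_quadratic p : exists C, forall h, `|h| <= 1 -> `|flat p h| <= C * h ^+ 2.
Proof.
have [C [d [C0 pC]]] := poly_le_exp p.
exists (C * (d.+2)`!%:R) => h h1.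
rewrite /flat; case: ifPn => [h0|_]; last first.
  by rewrite normr0 mulr_ge0 ?sqr_ge0// mulr_ge0.
have hle1 : h <= 1 by rewrite -(ger0_norm (ltW h0)).
have hV : 1 <= h^-1 by rewrite invf_ge1.
have hV0 : 0 < h^-1 by rewrite invr_gt0.
rewrite normrM (ger0_norm (expR_ge0 _)).
have E : expR (- h^-1) <= (d.+2)`!%:R * h ^+ d.+2.
  rewrite expRN -[leRHS]invrK lef_pV2 ?posrE ?expR_gt0 ?invr_gt0//; last first.
    by rewrite mulr_gt0 ?exprn_gt0// ltr0n fact_gt0.
  have := @expR_ge1Dxn R h^-1 d.+1 (ltW hV0).
  rewrite invfM exprVn mulrC; apply: le_trans; rewrite ler_wpDl//.
apply: (@le_trans _ _ ((C * h^-1 ^+ d) * ((d.+2)`!%:R * h ^+ d.+2))).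
  by apply: ler_pM => //; exact: pC.
rewrite le_eqVlt; apply/orP; left; apply/eqP.
rewrite -[d.+2]addn2 exprD exprVn; field.
by rewrite expf_neq0// gt_eqF.
Qed.

(** The chain rule at y = 1/x: the derivative of p(y) exp(-y) in x is
    -y^2 times its derivative in y. *)
Lemma is_derive_flat p x : is_derive x (1 : R) (flat p) (flat ('X^2 * (p - p^`())) x).
Proof.
have [x0|x0|->] := ltgtP x 0.
- rewrite {2}/flat ltNge (ltW x0)/=.
  apply: (@near_eq_is_derive _ _ _ (cst 0)).
    near=> y; rewrite /flat ifF//; apply/negbTE; rewrite -leNgt ltW//.
    by near: y; exact: lt_nbhsl.
- rewrite {2}/flat x0.
  have N : \near x, p.[x^-1] * expR (- x^-1) = flat p x.
    near=> y; rewrite /flat ifT//.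
    by near: y; exact: lt_nbhsr.
  apply: (near_eq_is_derive N).
  have xn0 : x != 0 by rewrite gt_eqF.
  have dV : is_derive x (1 : R) (fun y : R => y^-1) (- x ^- 2 *: (1 : R)).
    exact: (@is_deriveV _ id).
  have dNV := is_deriveN dV.
  have d1 := @is_derive1_comp R (horner p) _ x _ _ (is_derive_poly p x^-1) dV.
  have d2 := @is_derive1_comp R expR _ x _ _ (is_derive_expR (- x^-1)) dNV.
  have d3 := is_deriveM d1 d2.
  apply: is_derive_eq.
  rewrite hornerM !hornerE /GRing.scale /=.
  by field.
- rewrite {2}/flat ltxx; have [C hC] := flat_quadratic p.
  exact: is_derive0_quadratic hC.
Unshelve. all: by end_near. Qed.

Lemma smooth_flat p : smooth (flat p).
Proof.
move=> k; elim: k p => [|k IH] p; first exact: continuous_of_derive (is_derive_flat p).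
split; first by move=> x; case: (is_derive_flat p x).
by rewrite (derive1_fun (is_derive_flat p)).
Qed.

Definition bump (a b x : R) : R := flat 1 (x - a) * flat 1 (b - x).

Lemma flat1_ge0 x : 0 <= flat 1 x.
Proof. by rewrite /flat; case: ifP => // _; rewrite hornerC mul1r expR_ge0. Qed.

Lemma flat1_le1 x : flat 1 x <= 1.
Proof.
rewrite /flat; case: ifP => // x0; rewrite hornerC mul1r -expR0 ler_expR.
by rewrite oppr_le0 invr_ge0 ltW.
Qed.

Lemma flat1_gt0 x : (0 < flat 1 x) = (0 < x).
Proof. by rewrite /flat; case: ifP => //; rewrite ?ltxx// hornerC mul1r expR_gt0. Qed.

Lemma smooth_bump a b : smooth (bump a b).
Proof.
have -> : bump a b = (fun x => flat 1 (1 * x + - a)) \* (fun x => flat 1 (-1 * x + b)).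
  by apply/funext => x; rewrite /bump /= mul1r mulN1r [- x + b]addrC.
by apply: smooth_mul; apply: smooth_affine; exact: smooth_flat.
Qed.

Lemma bump_ge0 a b x : 0 <= bump a b x.
Proof. by rewrite mulr_ge0 ?flat1_ge0. Qed.

Lemma bump_le1 a b x : bump a b x <= 1.
Proof. by rewrite mulr_ile1 ?flat1_ge0 ?flat1_le1. Qed.

Lemma bump_gt0 a b x : (0 < bump a b x) = (a < x < b).
Proof.
rewrite -(subr_gt0 a) -(subr_gt0 x).
have [h1|h1] := boolP (0 < x - a); have [h2|h2] := boolP (0 < b - x) => /=.
- by rewrite mulr_gt0 ?flat1_gt0.
- by rewrite /bump {2}/flat (negbTE h2) mulr0 ltxx.
- by rewrite /bump {1}/flat (negbTE h1) mul0r ltxx.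
- by rewrite /bump {1}/flat (negbTE h1) mul0r ltxx.
Qed.

Lemma bump_eq0 a b x : ~~ (a < x < b) -> bump a b x = 0.
Proof. by rewrite -bump_gt0 lt_neqAle bump_ge0 andbT negbK => /eqP. Qed.

(** A sequence of smooth functions with values in [0, 1] that increases to the
    indicator of ]a, b[. *)
Definition plateau (a b : R) (m : nat) (x : R) : R := 1 - (1 - bump a b x) ^+ m.

Lemma smooth_plateau a b m : smooth (plateau a b m).
Proof.
apply: (@smooth_sub _ (cst 1)); first exact: smooth_cst.
apply: (@smooth_exp _ (fun x => 1 - bump a b x)).
apply: (@smooth_sub _ (cst 1)); first exact: smooth_cst.
exact: smooth_bump.
Qed.

Lemma plateau_ge0 a b m x : 0 <= plateau a b m x.
Proof. by rewrite subr_ge0 exprn_ile1// ?subr_ge0 ?bump_le1// lerBlDr lerDl bump_ge0. Qed.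

Lemma plateau_le1 a b m x : plateau a b m x <= 1.
Proof. by rewrite lerBlDr lerDl exprn_ge0// subr_ge0 bump_le1. Qed.

Lemma plateau_eq0 a b m x : ~~ (a < x < b) -> plateau a b m x = 0.
Proof. by move=> /bump_eq0 h; rewrite /plateau h subr0 expr1n subrr. Qed.

Lemma cvg_plateau a b x :
  (fun m => plateau a b m x) @ \oo --> ((a < x < b)%R%:R : R).
Proof.
have [h|h] := boolP (a < x < b); last first.
  rewrite (_ : (fun _ => _) = cst 0); first exact: cvg_cst.
  by apply/funext => m; rewrite plateau_eq0.
rewrite -[X in _ --> X]subr0; apply: cvgB; first exact: cvg_cst.
apply: cvg_expr; rewrite ger0_norm; last by rewrite subr_ge0 bump_le1.
by rewrite ltrBlDr ltrDl bump_gt0.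
Qed.

End bump1.

Section antiderivative.
Context {R : realType}.
Implicit Types (f g : R -> R).

Lemma MVT1 f g (a b : R) : a <= b ->
  (forall x, is_derive x (1 : R) f (g x)) ->
  exists2 c, a <= c <= b & f b - f a = g c * (b - a).
Proof.
move=> ab fg.
have [//|c cab ->] := @MVT_segment R f g a b ab.
  by apply: continuous_subspaceT; exact: continuous_of_derive fg.
by exists c => //; move: cab; rewrite in_itv.
Qed.

(** The antiderivative vanishing to the left of the support; it is constant to
    the right of it, so the difference of two of its translates has bounded
    support. *)
Lemma antiderivative f (l r : R) : smooth f ->
  (forall x, ~~ (l < x < r) -> f x = 0) ->
  exists F : R -> R, [/\ smooth F, forall x, is_derive x (1 : R) F (f x),
    forall x, x <= l -> F x = 0 & forall x, r <= x -> F x = F r].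
Proof.
move=> sf f0.
(* Starting at l - 1 leaves room to differentiate the integral at x = l. *)
pose F x := (\int[@lebesgue_measure R]_(t in [set` `[l - 1, x]]) (f t))%R.
have F0 x : x <= l -> F x = 0.
  move=> xl; rewrite /F /Rintegral (eq_integral (cst 0%E)) ?integral0//.
  move=> t; rewrite inE/= in_itv/= => /andP[_ tx].
  by rewrite f0// negb_and -!leNgt (le_trans tx xl).
have dF x : is_derive x (1 : R) F (f x).
  have [xl|lx] := ltP x l.
    apply: (@near_eq_is_derive _ _ _ (cst 0)).
      near=> y; rewrite F0// ltW//; near: y; exact: lt_nbhsl.
    rewrite f0; first exact: (is_derive_cst (0 : R) x (1 : R)).
    by rewrite negb_and -leNgt ltW.
  have ix : (lebesgue_measure.-integrable `[l - 1, x + 1] (EFin \o f)).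
    apply: continuous_compact_integrable; first exact: segment_compact.
    by apply: continuous_subspaceT; exact: smooth_cont.
  have lx1 : (l - 1 < x)%R by rewrite (lt_le_trans _ lx)// ltrBlDr ltrDl.
  have [] := @continuous_FTC1_closed R f (l - 1) x (x + 1) _ ix lx1 _.
  - by rewrite ltrDl.
  - exact: smooth_cont.
  - move=> d1 d2; apply: DeriveDef; first exact: d1.
    by rewrite -derive1E; exact: d2.
exists F; split => //; first exact: smooth_of_derive dF sf.
move=> x rx; have [c /andP[rc _]] := MVT1 rx dF.
rewrite f0 ?mul0r; last by rewrite negb_and -!leNgt rc orbT.
by move=> /eqP; rewrite subr_eq0 => /eqP.
Unshelve. all: by end_near. Qed.

Lemma smooth_step : exists S : R -> R, [/\ smooth S,
  forall x, x <= 0 -> S x = 0 & forall x, 1 <= x -> S x = 1].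
Proof.
have [F [sF dF F0 F1]] := @antiderivative (bump 0 1) 0 1 (smooth_bump 0 1) (@bump_eq0 R 0 1).
have [c c01 E] := @MVT1 F (bump 0 1) (1 / 4) (3 / 4) ltac:(lra) dF.
have F34 : F (1 / 4) < F (3 / 4).
  rewrite -subr_gt0 E mulr_gt0//; last by lra.
  by rewrite bump_gt0; lra.
have ndF x y : x <= y -> F x <= F y.
  move=> xy; have [z _] := MVT1 xy dF.
  by rewrite -subr_ge0 => ->; rewrite mulr_ge0 ?bump_ge0// subr_ge0.
have Fp : 0 < F 1.
  rewrite -(F0 0 (lexx 0)); apply: (le_lt_trans (ndF 0 (1 / 4) _)); first lra.
  by apply: (lt_le_trans F34); apply: ndF; lra.
exists (fun x => (F 1)^-1 * F x); split.
- exact: smooth_scale.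
- by move=> x x0; rewrite (F0 _ x0) mulr0.
- by move=> x x1; rewrite F1// mulVf// gt_eqF.
Qed.

End antiderivative.

(** * Lebesgue measure on R^n: translations and boxes *)
Section translation.
Context {R : realType}.

Lemma measurable_preimage d (T : measurableType d) d' (T' : measurableType d')
  (f : T -> T') A : measurable_fun setT f -> measurable A -> measurable (f @^-1` A).
Proof. by move=> mf mA; rewrite -[X in measurable X]setTI; exact: mf. Qed.

Lemma measurable_shiftR (a : R) :
  measurable_fun setT (fun x : measurableTypeR R => x + a : measurableTypeR R).
Proof. exact: measurable_funD. Qed.

(** Lebesgue measure is the only measure that gives intervals their length. *)
Lemma lebesgue_measure_shift (a : R) (A : set (measurableTypeR R)) : measurable A ->
  pushforward (@lebesgue_measure R) (fun x : measurableTypeR R => x + a : measurableTypeR R) A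
  = lebesgue_measure A.
Proof.
pose s : measurableTypeR R -> measurableTypeR R := fun x => x + a.
pose ms := isMeasurableFun.Build _ _ _ _ s (measurable_shiftR a).
pose S : {mfun measurableTypeR R >-> measurableTypeR R} := HB.pack s ms.
move=> mA; apply/esym.
apply: (@lebesgue_measure_unique R (pushforward lebesgue_measure S)) => //= _ [[b c]] _ <-.
rewrite /pushforward [X in _ = lebesgue_measure X](_ : _ = `]b - a, c - a]%classic).
  rewrite !lebesgue_measure_itv/= !lte_fin ltrD2r.
  by case: ifPn => // _; rewrite -!EFinD; congr EFin; ring.
by apply/seteqP; split => x /=; rewrite !in_itv/= ltrBlDr lerBrDr.
Qed.

Lemma ge0_integral_shiftR (a : R) (f : measurableTypeR R -> \bar R) :
  measurable_fun [set: measurableTypeR R] f -> (forall x, 0 <= f x)%E ->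
  (\int[lebesgue_measure]_x f (x + a)%R = \int[lebesgue_measure]_x f x)%E.
Proof.
move=> mf f0.
pose s : measurableTypeR R -> measurableTypeR R := fun x => x + a.
have -> : (\int[lebesgue_measure]_x f (x + a)%R =
   \int[lebesgue_measure]_(x in s @^-1` setT) (f \o s) x)%E by rewrite preimage_setT.
rewrite -ge0_integral_pushforward//; last exact: measurable_shiftR.
pose ms := isMeasurableFun.Build _ _ _ _ s (measurable_shiftR a).
pose S : {mfun measurableTypeR R >-> measurableTypeR R} := HB.pack s ms.
apply: (@eq_measure_integral _ _ R setT lebesgue_measure (pushforward lebesgue_measure S)).
by move=> A mA _; exact: lebesgue_measure_shift.
Qed.

Lemma measurable_shift n (v : 'rV[R]_n) :
  measurable_fun setT (fun x : 'rV[R]_n => x + v).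
Proof.
apply/measurable_fun_rVP => i.
rewrite (_ : _ \o _ = rV_coord i \+ cst (v ord0 i)).
  by apply: measurable_funD => //; exact: measurable_rV_coord.
by apply/funext => x; rewrite /rV_coord /= mxE.
Qed.

Lemma rV_cons0 n (p : measurableTypeR R * 'rV[R]_n) : rV_cons p ord0 ord0 = p.1.
Proof. by rewrite -[in RHS](rV_consK p). Qed.

Lemma rV_consS n (p : measurableTypeR R * 'rV[R]_n) j :
  rV_cons p ord0 (lift ord0 j) = p.2 ord0 j.
Proof. by rewrite -[in RHS](rV_consK p) /= mxE. Qed.

Lemma rV_consD n (p : measurableTypeR R * 'rV[R]_n) (v : 'rV[R]_n.+1) :
  rV_cons p + v = rV_cons (p.1 + (rV_uncons v).1, p.2 + (rV_uncons v).2).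
Proof.
apply/rowP => i; rewrite mxE; case: (unliftP ord0 i) => [j ->|->].
  by rewrite !rV_consS !mxE.
by rewrite !rV_cons0.
Qed.

(** Induction on the dimension: the measure on R^(n+1) integrates the measure
    of the slices, and a translation translates the slices and their position. *)
Lemma lebesgue_rV_shift n (v : 'rV[R]_n) (A : set 'rV[R]_n) : measurable A ->
  lebesgue_rV n ((fun x => x + v) @^-1` A) = lebesgue_rV n A.
Proof.
elim: n v A => [|n IH] v A mA.
  rewrite (_ : _ @^-1` _ = A)//; apply/funext => x.
  by rewrite /preimage /=; congr A; apply/rowP => -[].
rewrite /= /lebesgue_rV_step /pushforward /product_measure1.
have mB : measurable (@rV_cons R n @^-1` A).
  exact: measurable_preimage (@measurable_rV_cons R n) mA.
set a := (rV_uncons v).1; set w := (rV_uncons v).2.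
rewrite -[RHS](@ge0_integral_shiftR a); last 2 first.
- exact: measurable_fun_xsection.
- by move=> x; exact: measure_ge0.
apply: eq_integral => x _ /=.
rewrite -[RHS](IH w); last by apply: measurable_xsection.
congr (lebesgue_rV n _); apply/funext => y.
by rewrite /xsection /preimage /= !inE/= rV_consD.
Qed.

Lemma ge0_integral_shift n (v : 'rV[R]_n) (f : 'rV[R]_n -> \bar R) :
  measurable_fun [set: 'rV[R]_n] f -> (forall x, 0 <= f x)%E ->
  (\int[lebesgue_rV n]_x f (x + v)%R = \int[lebesgue_rV n]_x f x)%E.
Proof.
move=> mf f0.
pose s (x : 'rV[R]_n) := x + v.
have -> : (\int[lebesgue_rV n]_x f (x + v)%R =
   \int[lebesgue_rV n]_(x in s @^-1` setT) (f \o s) x)%E.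
  by rewrite preimage_setT.
rewrite -ge0_integral_pushforward//; last exact: measurable_shift.
pose ms := isMeasurableFun.Build _ _ _ _ s (measurable_shift v).
pose S : {mfun 'rV[R]_n >-> 'rV[R]_n} := HB.pack s ms.
apply: (@eq_measure_integral _ _ R setT (lebesgue_rV n) (pushforward (lebesgue_rV n) S)).
by move=> A mA _; exact: lebesgue_rV_shift.
Qed.

Lemma integral_shift n (v : 'rV[R]_n) (f : 'rV[R]_n -> \bar R) :
  measurable_fun [set: 'rV[R]_n] f ->
  (\int[lebesgue_rV n]_x f (x + v)%R = \int[lebesgue_rV n]_x f x)%E.
Proof.
move=> mf; rewrite [LHS]integralE [RHS]integralE; congr (_ - _)%E.
- rewrite -(@ge0_integral_shift n v (f^\+)%E)//; last exact: measurable_funepos.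
  by apply: eq_integral => x _; rewrite (funepos_comp f (fun x => x + v)).
- rewrite -(@ge0_integral_shift n v (f^\-)%E)//; last exact: measurable_funeneg.
  by apply: eq_integral => x _; rewrite (funeneg_comp f (fun x => x + v)).
Qed.

Lemma integrable_shift n (v : 'rV[R]_n) (f : 'rV[R]_n -> \bar R) :
  (lebesgue_rV n).-integrable setT f ->
  (lebesgue_rV n).-integrable setT (fun x => f (x + v)).
Proof.
move=> /integrableP[mf fi]; apply/integrableP; split.
  exact: (measurableT_comp (f := f) mf (measurable_shift v)).
rewrite (@ge0_integral_shift n v (fun x => `|f x|)%E)//.
exact: measurableT_comp.
Qed.

Lemma Rintegral_shift n (v : 'rV[R]_n) (f : 'rV[R]_n -> R) :
  measurable_fun [set: 'rV[R]_n] f ->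
  \int[lebesgue_rV n]_x f (x + v) = \int[lebesgue_rV n]_x f x.
Proof.
move=> mf; rewrite /Rintegral; congr fine.
by rewrite -[RHS](integral_shift v)//; exact/measurable_EFinP.
Qed.

End translation.

Section boxes.
Context {R : realType}.

Definition obox n (a b : 'rV[R]_n) : set 'rV[R]_n :=
  [set x | forall i, a ord0 i < x ord0 i < b ord0 i].

Lemma measurable_obox n (a b : 'rV[R]_n) : measurable (obox a b).
Proof.
rewrite (_ : obox a b = \bigcap_(i in [set: 'I_n]) (rV_coord i @^-1` `]a ord0 i, b ord0 i[)).
  apply: fin_bigcap_measurable => // i _.
  by apply: measurable_preimage => //; exact: measurable_rV_coord.
apply/seteqP; split => x h i /=; first by move=> _; rewrite in_itv/= h.
by have := h i I; rewrite /= in_itv.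
Qed.

Lemma lebesgue_rV_obox n (a b : 'rV[R]_n) : (forall i, a ord0 i <= b ord0 i) ->
  lebesgue_rV n (obox a b) = (\prod_i (b ord0 i - a ord0 i))%:E.
Proof.
elim: n a b => [|n IH] a b ab.
  rewrite big_ord0 /= diracE mem_set//; by case.
rewrite /= /lebesgue_rV_step /pushforward.
rewrite (_ : _ @^-1` _ = `]a ord0 ord0, b ord0 ord0[%classic `*`
   obox (rV_uncons a).2 (rV_uncons b).2); last first.
  apply/seteqP; split => -[x y] /=.
    move=> h; split => /=; first by have := h ord0; rewrite rV_cons0 in_itv.
    by move=> i; have := h (lift ord0 i); rewrite rV_consS !mxE.
  rewrite in_itv/= => -[h1 h2] i; case: (unliftP ord0 i) => [j ->|->].
    by have := h2 j; rewrite rV_consS !mxE.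
  by rewrite rV_cons0.
rewrite product_measure1E//; last exact: measurable_obox.
rewrite IH; last by move=> i; rewrite !mxE.
rewrite [X in (X * _)%E]lebesgue_measure_itv/= big_ord_recl EFinM; congr (_ * _)%E.
  rewrite lte_fin; case: ltP => // ba.
  by rewrite (_ : b ord0 ord0 = a ord0 ord0) ?subrr//; apply: le_anti; rewrite ba ab.
by congr EFin; apply: eq_bigr => i _; rewrite !mxE.
Qed.

Lemma lebesgue_rV_obox_fin n (a b : 'rV[R]_n) : (lebesgue_rV n (obox a b) < +oo)%E.
Proof.
have [h|/existsNP[i /negP hi]] := pselect (forall i, a ord0 i <= b ord0 i).
  by rewrite lebesgue_rV_obox// ltry.
rewrite (_ : obox a b = set0) ?measure0//.
apply/seteqP; split => // x /(_ i) /andP[h1 h2]; move: hi.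
by rewrite (ltW (lt_trans h1 h2)).
Qed.

Lemma ball_rVE n (x : 'rV[R]_n) e : 0 < e -> ball x e = obox (x - const_mx e) (x + const_mx e).
Proof.
move=> e0; apply/seteqP; split => y.
  by move=> [_ h] i; have := h ord0 i; rewrite !mxE /ball /= ltr_distl ltrBlDr ltrBlDr => /andP[-> ->].
move=> h; split => // i j; have := h j; rewrite !mxE ord1 /ball /= ltr_distl.
by rewrite (ord1 i) => /andP[h1 h2]; apply/andP; split; lra.
Qed.

Lemma open_obox n (a b : 'rV[R]_n) : open (obox a b).
Proof.
rewrite openE => x xab; exists (fun (_ : 'I_1) j => `]a ord0 j, b ord0 j[%classic).
  move=> i j; apply: open_nbhs_nbhs; split; first exact: interval_open.
  by rewrite /= in_itv/= (ord1 i) xab.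
by move=> y h j; have := h ord0 j; rewrite /= in_itv.
Qed.

Lemma coord_le_norm n (x : 'rV[R]_n) i : `|x ord0 i| <= `|x|.
Proof.
rewrite {2}/Num.norm/= mx_normrE.
exact: (le_bigmax _ (fun ij : 'I_1 * 'I_n => `|x ij.1 ij.2|) (ord0, i)).
Qed.

Definition cbox n (l r : 'rV[R]_n) : set 'rV[R]_n :=
  [set x | forall i, l ord0 i <= x ord0 i <= r ord0 i].

Lemma compact_cbox n (l r : 'rV[R]_n) : compact (cbox l r).
Proof.
rewrite (_ : cbox l r = [set v | forall i, `[l ord0 i, r ord0 i]%classic (v ord0 i)]).
  by apply: (@rV_compact _ _ (fun i => `[l ord0 i, r ord0 i]%classic)) => i; exact: segment_compact.
by apply/seteqP; split => x h i; have := h i; rewrite /= in_itv.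
Qed.

Lemma closed_cbox n (l r : 'rV[R]_n) : closed (cbox l r).
Proof. by apply: compact_closed; [exact: norm_hausdorff|exact: compact_cbox]. Qed.

Lemma sub_obox_cbox n (l r : 'rV[R]_n) : obox l r `<=` cbox l r.
Proof. by move=> x h i; have /andP[/ltW -> /ltW ->] := h i. Qed.

(** Boxes with rational centre and radius 1/(k+1), restricted to those whose
    closure lies in U.  The closure is needed because test functions supported in
    the box must have their closed support inside U. *)
Lemma open_bigcup_box n (U : set 'rV[R]_n) : open U ->
  exists (l r : nat -> 'rV[R]_n),
    U = \bigcup_(k in [set k | cbox (l k) (r k) `<=` U]) obox (l k) (r k).
Proof.
move=> oU.
pose q2r (q : 'rV[rat]_n) : 'rV[R]_n := map_mx ratr q.
(* An index that codes no box is sent to an arbitrary one, which is harmless: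
   only the boxes inside U enter the union. *)
pose p k : 'rV[rat]_n * nat := odflt (0, 0%N) (unpickle k).
pose l k := q2r (p k).1 - const_mx (p k).2.+1%:R^-1.
pose r k := q2r (p k).1 + const_mx (p k).2.+1%:R^-1.
exists l, r; apply/seteqP; split => x; last first.
  by case=> k /= h /sub_obox_cbox; exact: h.
move=> Ux; have /nbhs_ballP[e /= e0 eU] := open_nbhs_nbhs (conj oU Ux).
have [k kE] : exists k : nat, k.+1%:R^-1 + k.+1%:R^-1 < e.
  have e2 : 0 < e / 2 by rewrite divr_gt0.
  have [k _ hk] := near_infty_natSinv_lt (PosNum e2).
  by exists k; have : k.+1%:R^-1 < e / 2 := hk k (leqnn k); move: (k.+1%:R^-1) => c; lra.
have k0 : 0 < k.+1%:R^-1 :> R by rewrite invr_gt0.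
have dq (i : 'I_n) : exists q : rat, `|x ord0 i - ratr q| < k.+1%:R^-1.
  move: (k.+1%:R^-1) k0 => c c0.
  have [q] := @rat_in_itvoo R (x ord0 i - c) (x ord0 i + c) ltac:(lra).
  rewrite in_itv/= => h; exists q; rewrite ltr_distl; lra.
have [q hq] := choice dq.
have pE : p (pickle (\row_i q i : 'rV[rat]_n, k)) = (\row_i q i, k) by rewrite /p pickleK.
exists (pickle (\row_i q i : 'rV[rat]_n, k)); rewrite /l /r /= pE/=.
  move=> y yb; apply: eU; rewrite ball_rVE// => i; have := yb i; have := hq i.
  rewrite !mxE ltr_distl; move: (k.+1%:R^-1) kE (ratr _) => c ce z; lra.
by move=> i; have := hq i; rewrite !mxE ltr_distl; move: (k.+1%:R^-1) (ratr _) => c z; lra.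
Qed.

Lemma measurable_open n (U : set 'rV[R]_n) : open U -> measurable U.
Proof.
move=> /open_bigcup_box[l [r ->]].
by apply: bigcup_measurable => k _; exact: measurable_obox.
Qed.

Lemma measurable_continuous n (f : 'rV[R]_n -> R) :
  continuous f -> measurable_fun setT f.
Proof.
move=> cf; apply: (measurability _ (RGenOInfty.measurableE R)).
move=> _ [_ [x ->] <-]; rewrite setTI; apply: measurable_open.
by apply: open_comp; [move=> y _; exact: cf|exact: interval_open].
Qed.

Lemma bounded_sub_obox n (A : set 'rV[R]_n) : bounded_set A ->
  exists M : R, 0 < M /\ A `<=` obox (const_mx (- M)) (const_mx M).
Proof.
move=> /pinfty_ex_gt0[M M0 hM].
exists (M + 1); split; first by rewrite addr_gt0.
move=> x Ax i; rewrite !mxE -ltr_norml.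
apply: le_lt_trans (coord_le_norm x i) _; apply: le_lt_trans (hM x Ax) _.
by rewrite ltrDl.
Qed.

Lemma bounded_measure_fin n (A : set 'rV[R]_n) : measurable A -> bounded_set A ->
  (lebesgue_rV n A < +oo)%E.
Proof.
move=> mA /bounded_sub_obox[M [M0 AM]].
apply: (le_lt_trans _ (lebesgue_rV_obox_fin (const_mx (- M)) (const_mx M))).
by apply: le_measure => //; rewrite inE//; exact: measurable_obox.
Qed.

End boxes.

(** * Product test functions and the fundamental lemma *)
Section product_functions.
Context {R : realType} {n : nat}.
Implicit Types (a b : 'I_n -> R -> R) (x : 'rV[R]_n) (i : 'I_n).

Definition unitv i : 'rV[R]_n := delta_mx ord0 i.

(** A directional derivative only sees the restriction of f to a line. *)
Lemma is_derive_line (f : 'rV[R]_n -> R) (g : R -> R) x (v : 'rV[R]_n) t (d : R) :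
  (forall h : R, f (h *: v + x) = g (h + t)) ->
  is_derive t (1 : R) g d -> is_derive x v f d.
Proof.
move=> fg [dg gd].
have E : (fun h : R => h^-1 *: (f (h *: v + x) - f x)) =
    (fun h : R => h^-1 *: (g (h *: (1 : R) + t) - g t)).
  apply/funext => h; rewrite fg; congr (_ *: (_ - _)).
    by rewrite [_ *: (1 : R)]mulr1.
  by rewrite -[x in LHS]add0r -(scale0r v) fg add0r.
by apply: DeriveDef; [rewrite /derivable E|rewrite /derive E].
Qed.

(** Products of functions of one coordinate: a class that is closed under
    partial derivatives and rich enough to approximate indicators of boxes. *)
Definition prodf a x : R := \prod_i a i (x ord0 i).

Definition dprodf a i : 'I_n -> R -> R :=
  fun j => if j == i then derive1 (a j) else a j.

Lemma is_derive_prodf a x i : (forall j, smooth (a j)) ->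
  is_derive x (unitv i) (prodf a) (prodf (dprodf a i) x).
Proof.
move=> sa; pose C := \prod_(j | j != i) a j (x ord0 j).
apply: (@is_derive_line _ (fun t => C * a i t) _ _ (x ord0 i)).
  move=> h; rewrite /prodf (bigD1 i)//= mulrC; congr (_ * _).
    apply: eq_bigr => j ji; rewrite !mxE eqxx/= (negbTE ji) mulr0 add0r//.
  by rewrite !mxE !eqxx mulr1.
have h := @is_deriveZ _ _ _ (a i) C (x ord0 i) 1 _ (smooth_is_derive (x ord0 i) (sa i)).
apply: is_derive_eq; rewrite /prodf (bigD1 i)//= /dprodf eqxx mulrC; congr (_ * _).
by apply: eq_bigr => j /negbTE ->.
Qed.

Lemma partial_prodf a i : (forall j, smooth (a j)) ->
  partial i (prodf a) = prodf (dprodf a i).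
Proof.
move=> sa; apply/funext => x; have h := is_derive_prodf x i sa.
by rewrite /partial; exact: derive_val.
Qed.

Lemma smooth_dprodf a i : (forall j, smooth (a j)) -> forall j, smooth (dprodf a i j).
Proof. by move=> sa j; rewrite /dprodf; case: ifP => // _; exact: smooth_derive1. Qed.

Lemma continuous_prodf a : (forall j, continuous (a j)) -> continuous (prodf a).
Proof.
move=> ca; rewrite /prodf.
elim: (index_enum 'I_n) => [|i s IH].
  have -> : (fun x : 'rV[R]_n => \prod_(i <- [::]) a i (x ord0 i)) = cst 1; last first.
    exact: cst_continuous.
  by apply/funext => x; rewrite big_nil.
rewrite (_ : (fun _ => _) = (fun x : 'rV[R]_n => a i (x ord0 i)) \*
    (fun x => \prod_(j <- s) a j (x ord0 j))); last first.
  by apply/funext => x; rewrite big_cons.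
move=> x; apply: continuousM; last exact: IH.
apply: (@continuous_comp _ _ _ (fun x : 'rV[R]_n => x ord0 i) (a i)).
  exact: coord_continuous.
exact: ca.
Qed.

Lemma Ck_prodf k a : (forall j, smooth (a j)) -> Ck k (prodf a).
Proof.
elim: k a => [|k IH] a sa /=; first by apply: continuous_prodf => j; exact: smooth_cont.
split; first by apply: continuous_prodf => j; exact: smooth_cont.
move=> i; split; first by move=> x; case: (is_derive_prodf x i sa).
by rewrite partial_prodf//; apply: IH; exact: smooth_dprodf.
Qed.

Definition supported a (l r : 'rV[R]_n) :=
  forall i t, ~~ (l ord0 i < t < r ord0 i) -> a i t = 0.

Lemma prodf_supp a l r x : supported a l r -> ~ obox l r x -> prodf a x = 0.
Proof.
move=> sa /existsNP[i /negP hi]; rewrite /prodf (bigD1 i)//= sa ?mul0r//.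
Qed.

Lemma test_function_of_cbox (D : set 'rV[R]_n) (phi : 'rV[R]_n -> R) l r :
  (forall k, Ck k phi) -> (forall x, ~ obox l r x -> phi x = 0) -> cbox l r `<=` D ->
  test_function D phi.
Proof.
move=> Cphi phi0 lrD.
have sub : closure [set x | phi x != 0] `<=` cbox l r.
  rewrite [X in _ `<=` X](iffLR (closure_id _) (@closed_cbox R n l r)).
  apply: closureS => x /= /eqP hx; apply: contrapT => hN; apply: hx; apply: phi0.
  by move=> /sub_obox_cbox.
split => //; last exact: subset_trans sub lrD.
apply: subclosed_compact sub; [exact: closed_closure|exact: compact_cbox].
Qed.

Lemma test_prodf (D : set 'rV[R]_n) a l r : (forall j, smooth (a j)) ->
  supported a l r -> cbox l r `<=` D -> test_function D (prodf a).
Proof.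
move=> sa supp lrD; apply: test_function_of_cbox lrD; first by move=> k; exact: Ck_prodf.
by move=> x; exact: prodf_supp.
Qed.

End product_functions.

Section fundamental_lemma.
Context {R : realType} {n : nat}.
Notation mu := (@lebesgue_rV R n).

Definition all_boxes : set (set 'rV[R]_n) := [set A | exists l r, A = obox l r].

Lemma oboxI (l r l' r' : 'rV[R]_n) : obox l r `&` obox l' r' =
  obox (\row_i Num.max (l ord0 i) (l' ord0 i)) (\row_i Num.min (r ord0 i) (r' ord0 i)).
Proof.
apply/seteqP; split => x.
  by move=> [h h'] i; have := h i; have := h' i; rewrite !mxE gt_max lt_min
    => /andP[-> ->] /andP[-> ->].
by move=> h; split => i; have := h i; rewrite !mxE gt_max lt_min =>
  /andP[/andP[h1 h2] /andP[h3 h4]]; apply/andP.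
Qed.

(** Boxes are stable under intersection and generate the sigma-algebra, so
    integrals over boxes determine integrals over all measurable sets. *)
Lemma measurable_rVE : @measurable _ 'rV[R]_n = <<s all_boxes >>.
Proof.
apply/seteqP; split; last first.
  apply: smallest_sub; first exact: sigma_algebra_measurable.
  by move=> _ [l [r ->]]; exact: measurable_obox.
apply: smallest_sub; first exact: smallest_sigma_algebra.
move=> A; rewrite -bigcup_seq => -[i _ [B mB <-]].
suff mc : measurable_fun [set: g_sigma_algebraType all_boxes]
    (rV_coord i : g_sigma_algebraType all_boxes -> R) by exact: (mc measurableT B mB).
apply: (measurability _ (RGenOpens.measurableE R)).
move=> _ [_ [a [b ->] <-]]; rewrite setTI.
rewrite (_ : _ @^-1` _ = \bigcup_(k : nat) obox
   (\row_j if j == i then a else - k%:R) (\row_j if j == i then b else k%:R)).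
  by apply: bigcupT_measurable => k; apply: sub_sigma_algebra; exists
   (\row_j if j == i then a else - k%:R), (\row_j if j == i then b else k%:R).
apply/seteqP; split => x /=; rewrite in_itv/=.
  move=> hx; have [M [M0 hM]] : exists M : R, 0 < M /\ forall j, `|x ord0 j| <= M.
    exists (`|x| + 1); split; first by rewrite ltr_wpDl.
    by move=> j; apply: le_trans (coord_le_norm x j) _; rewrite lerDl.
  exists (Num.trunc M).+1 => // j; rewrite !mxE; case: eqP => [->//|_].
  rewrite -ltr_norml (le_lt_trans (hM j))//.
  by rewrite truncnS_gt.
by case=> k _ /(_ i); rewrite !mxE eqxx.
Qed.

(** The measurable sets over which w integrates to zero form a Dynkin class. *)
Lemma ae_eq0_box (w : 'rV[R]_n -> R) (l r : 'rV[R]_n) :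
  mu.-integrable (obox l r) (EFin \o w) ->
  (forall l' r', cbox l' r' `<=` cbox l r ->
     \int[mu]_(x in obox l' r') (w x)%:E = 0)%E ->
  {ae mu, forall x, obox l r x -> w x = 0}.
Proof.
move=> iw w0; set B := obox l r in iw *.
have mB : measurable B by exact: measurable_obox.
suff H A : measurable A -> (\int[mu]_(x in A `&` B) (w x)%:E = 0)%E.
  have : ae_eq mu B (EFin \o w) (cst 0%E).
    apply: integral_ae_eq => // E EB mE.
    by rewrite integral0 -[RHS](H E mE); congr integral; apply/esym/setIidPl.
  apply: filterS => x h Bx; have := h Bx; by case.
rewrite measurable_rVE; move: A.
apply: (@dynkin_induction _ 'rV[R]_n all_boxes
   (fun A => \int[mu]_(x in A `&` B) (w x)%:E = 0)%E) => //.
- exact: measurable_rVE.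
- move=> _ _ [l1 [r1 ->]] [l2 [r2 ->]]; rewrite oboxI.
  by exists (\row_i Num.max (l1 ord0 i) (l2 ord0 i)), (\row_i Num.min (r1 ord0 i) (r2 ord0 i)).
- by rewrite setTI; apply: w0.
- move=> _ [l1 [r1 ->]]; rewrite oboxI; apply: w0 => x hx i.
  by have := hx i; rewrite !mxE ge_max le_min => /andP[/andP[_ ->] /andP[_ ->]].
- move=> S mS hS.
  have := w0 l r (@subset_refl _ _).
  rewrite -/B -[X in integral _ X](setUIDK B S) integral_setU//.
  + by rewrite [X in (integral _ X _ + _)%E]setIC hS add0e setDE setIC.
  + exact: measurableI.
  + exact: measurableD.
  + by rewrite setUIDK; case/integrableP: iw.
  + by apply/disj_set2P; rewrite setDE setIACA setICr setI0.
- move=> F mF tF hF; rewrite setI_bigcupl integral_bigcup.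
  + by rewrite eseries0// => k _ _; exact: hF.
  + by apply: trivIset_setIr.
  + by move=> k; exact: measurableI.
  + apply: integrableS iw => //; last by move=> x [k _ []].
    by apply: bigcupT_measurable => k; exact: measurableI.
Qed.

(** Products of plateaus converge to the indicator of a box, so by dominated
    convergence w integrates to zero over every box whose closure is in D.
    Plateaus have values in [0, 1]; the applications rely on this to bound their
    test functions. *)
Lemma fundamental_lemma (D : set 'rV[R]_n) (w : 'rV[R]_n -> R) : open D ->
  mu.-integrable D (EFin \o w) ->
  (forall a l r, (forall j, smooth (a j)) -> supported a l r -> cbox l r `<=` D ->
    (forall j t, 0 <= a j t <= 1) ->
    (\int[mu]_(x in D) (w x * prodf a x)%:E = 0)%E) ->
  {ae mu, forall x, D x -> w x = 0}.
Proof.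
move=> oD iw w0; have mD := measurable_open oD.
have [mw _] := integrableP _ _ _ iw.
have box0 l r : cbox l r `<=` D -> (\int[mu]_(x in obox l r) (w x)%:E = 0)%E.
  move=> lrD.
  pose a m (j : 'I_n) := plateau (l ord0 j) (r ord0 j) m.
  pose f_ m (x : 'rV[R]_n) := (w x * prodf (a m) x)%:E.
  have sa m j : smooth (a m j) by exact: smooth_plateau.
  have fl x : f_ ^~ x @ \oo --> (w x * \1_(obox l r) x)%:E.
    apply: cvg_EFin; first exact: nearW.
    apply: cvgM; first exact: cvg_cst.
    have -> : \1_(obox l r) x = \prod_j (l ord0 j < x ord0 j < r ord0 j)%R%:R :> R.
      rewrite indicE; have [h|h] := pselect (obox l r x).
        by rewrite mem_set// big1// => j _; rewrite h.
      rewrite memNset//; have /existsNP[j /negP hj] := h.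
      by rewrite (bigD1 j)//= (negbTE hj) mul0r.
    rewrite /prodf; elim: (index_enum 'I_n) => [|j s IH].
      by rewrite big_nil; under eq_fun do rewrite big_nil; exact: cvg_cst.
    rewrite big_cons; under eq_fun do rewrite big_cons.
    by apply: cvgM; [exact: cvg_plateau|exact: IH].
  have mp m : measurable_fun D (prodf (a m)).
    apply: measurable_funTS; apply: measurable_continuous.
    by apply: continuous_prodf => j; exact: smooth_cont.
  have [] := @dominated_convergence _ _ R mu D mD f_
    (fun x => (w x * \1_(obox l r) x)%:E) (fun x => `|(w x)%:E|)%E.
  - move=> m; apply/measurable_EFinP; apply: measurable_funM => //.
    exact/measurable_EFinP.
  - apply/measurable_EFinP; apply: measurable_funM; first exact/measurable_EFinP.
    by apply: measurable_indic; exact: measurable_obox.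
  - by apply: aeW => x _; exact: fl.
  - exact: integrable_abse.
  - apply: aeW => x m _; rewrite /f_ /= lee_fin normrM ler_piMr//.
    rewrite /prodf normr_prod; apply: prodr_ile1 => j _.
    by rewrite normr_ge0/= ger0_norm ?plateau_ge0 ?plateau_le1.
  move=> _ _.
  have -> : (fun m => \int[mu]_(x in D) f_ m x)%E = cst 0%E.
    apply/funext => m; apply: (w0 _ l r) => //.
    - by move=> j t; exact: plateau_eq0.
    - by move=> j t; rewrite plateau_ge0 plateau_le1.
  move=> /cvg_lim; rewrite lim_cst// => ->//.
  rewrite -[in LHS](setIidr (subset_trans (@sub_obox_cbox _ _ l r) lrD)) integral_mkcondr.
  apply: eq_integral => x _; rewrite patchE indicE.
  by case: ifPn => _ /=; rewrite ?mulr1 ?mulr0.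
have [l [r DE]] := open_bigcup_box oD.
have H k : {ae mu, forall x, cbox (l k) (r k) `<=` D -> obox (l k) (r k) x -> w x = 0}.
  have [h|h] := pselect (cbox (l k) (r k) `<=` D); last by apply: aeW => x /h.
  have : {ae mu, forall x, obox (l k) (r k) x -> w x = 0}.
    apply: ae_eq0_box.
      apply: integrableS iw => //; first exact: measurable_obox.
      exact: subset_trans (@sub_obox_cbox _ _ _ _) h.
    by move=> l' r' h'; apply: box0; exact: subset_trans h' h.
  by apply: filterS => x hx _.
have := (ae_foralln H).
apply: filterS => x hx; rewrite DE => -[k /= h1 h2]; exact: hx h2.
Qed.

End fundamental_lemma.

(** * L2 functions and weak partial derivatives *)
Section L2_tools.
Context {R : realType} {n : nat}.
Notation mu := (@lebesgue_rV R n).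
Implicit Types (D : set 'rV[R]_n) (u w g phi : 'rV[R]_n -> R).

Lemma integrable_dominated D u w : measurable D -> measurable_fun D u ->
  (forall x, D x -> `|u x| <= w x) -> mu.-integrable D (EFin \o w) ->
  mu.-integrable D (EFin \o u).
Proof.
move=> mD mU uw iw; apply: le_integrable iw => //; first exact/measurable_EFinP.
by move=> x Dx; rewrite lee_fin (le_trans (uw x Dx))// ler_norm.
Qed.

Lemma L2_sqr_integrable D u : L2 D u -> mu.-integrable D (EFin \o (fun x => u x ^+ 2)).
Proof.
move=> [mU iu]; apply/integrableP; split.
  by apply/measurable_EFinP; exact: measurable_funX.
by under eq_integral do rewrite /= ger0_norm ?sqr_ge0//.
Qed.

Lemma integrable_L2 D u : measurable_fun D u ->
  mu.-integrable D (EFin \o (fun x => u x ^+ 2)) -> L2 D u.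
Proof.
move=> mU /integrableP[_ iu]; split => //; move: iu.
by under eq_integral do rewrite /= ger0_norm ?sqr_ge0//.
Qed.

Lemma L2_mul D u w : measurable D -> L2 D u -> L2 D w ->
  mu.-integrable D (EFin \o (u \* w)).
Proof.
move=> mD Lu Lw; have [mU _] := Lu; have [mw _] := Lw.
apply: (@integrable_dominated _ _ (fun x => u x ^+ 2 + w x ^+ 2)) => //.
- exact: measurable_funM.
- move=> x _; rewrite /= normrM -(real_normK (num_real (u x))) -(real_normK (num_real (w x))).
  have := sqr_ge0 (`|u x| - `|w x|); have := normr_ge0 (u x); have := normr_ge0 (w x).
  by move: `|u x| `|w x| => a b; nra.
- exact: (integrableD mD (L2_sqr_integrable Lu) (L2_sqr_integrable Lw)).
Qed.

Lemma L2_cst D (c : R) : measurable D -> (mu D < +oo)%E -> L2 D (cst c).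
Proof.
move=> mD fD; split => //.
rewrite -[X in (X < _)%E]/(\int[mu]_(x in D) cst (c ^+ 2)%:E x)%E integral_cst//.
by rewrite lte_mul_pinfty// lee_fin sqr_ge0.
Qed.

Lemma L2_integrable D u : measurable D -> (mu D < +oo)%E -> L2 D u ->
  mu.-integrable D (EFin \o u).
Proof.
move=> mD fD Lu.
have := @L2_mul D u (cst 1) mD Lu (L2_cst 1 mD fD).
by congr (_.-integrable _ _); apply/funext => x /=; rewrite mulr1.
Qed.

Lemma integrable_scaled_indic D (c : R) : measurable D -> (mu D < +oo)%E ->
  mu.-integrable setT (EFin \o (fun x => c * \1_D x)).
Proof.
move=> mD fD; have := L2_integrable mD fD (L2_cst c mD fD).
rewrite (integrable_mkcond _ mD); congr (_.-integrable _ _).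
by apply/funext => x; rewrite patchE /= indicE; case: ifP => _; rewrite ?mulr1 ?mulr0.
Qed.

Lemma L2_bounded D u (C : R) : measurable D -> (mu D < +oo)%E -> measurable_fun D u ->
  (forall x, D x -> `|u x| <= C) -> L2 D u.
Proof.
move=> mD fD mU uC; apply: integrable_L2 => //.
apply: (@integrable_dominated _ _ (cst (C ^+ 2))) => //.
- exact: measurable_funX.
- move=> x Dx; rewrite normrX /= lerXn2r ?nnegrE//; last exact: uC.
  exact: (le_trans (normr_ge0 _) (uC x Dx)).
- exact: (L2_sqr_integrable (L2_cst C mD fD)).
Qed.

Lemma L2D D u w : measurable D -> L2 D u -> L2 D w -> L2 D (u \+ w).
Proof.
move=> mD Lu Lw; have [mU _] := Lu; have [mw _] := Lw.
apply: integrable_L2; first exact: measurable_funD.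
have h1 := integrableD mD (L2_sqr_integrable Lu) (L2_sqr_integrable Lw).
have h2 := integrableZl mD 2 (L2_mul mD Lu Lw).
have := integrableD mD h1 h2; congr (_.-integrable _ _).
by apply/funext => x; rewrite /= -!EFinM -!EFinD; congr EFin; ring.
Qed.

Lemma L2Z D u (c : R) : measurable D -> L2 D u -> L2 D (fun x => c * u x).
Proof.
move=> mD Lu; have [mU _] := Lu.
apply: integrable_L2; first exact: measurable_funM.
have := integrableZl mD (c ^+ 2) (L2_sqr_integrable Lu); congr (_.-integrable _ _).
by apply/funext => x; rewrite /= -!EFinM; congr EFin; ring.
Qed.

Lemma L2B D u w : measurable D -> L2 D u -> L2 D w -> L2 D (fun x => u x - w x).
Proof.
move=> mD Lu Lw; have := L2D mD Lu (L2Z (-1) mD Lw).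
by congr (L2 _ _); apply/funext => x /=; rewrite mulN1r.
Qed.

Lemma L2_sum D k (w : 'I_k -> 'rV[R]_n -> R) (c : 'I_k -> R) : measurable D ->
  (mu D < +oo)%E ->
  (forall l, L2 D (w l)) -> L2 D (fun x => \sum_l c l * w l x).
Proof.
move=> mD fD Lw; elim: (index_enum _) => [|i s IH].
  by under eq_fun do rewrite big_nil; exact: L2_cst.
under eq_fun do rewrite big_cons.
by apply: (@L2D D (fun x => c i * w i x)) => //; exact: L2Z.
Qed.

Lemma L2S D D' u : measurable D -> measurable D' -> D' `<=` D -> L2 D u -> L2 D' u.
Proof.
move=> mD mD' DD' Lu; apply: integrable_L2.
  by apply: measurable_funS DD' _ => //; case: Lu.
exact: integrableS (L2_sqr_integrable Lu).
Qed.

Lemma integrable_mul_bounded D u phi (C : R) : measurable D ->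
  mu.-integrable D (EFin \o u) -> measurable_fun D phi ->
  (forall x, D x -> `|phi x| <= C) -> mu.-integrable D (EFin \o (u \* phi)).
Proof.
move=> mD iu mphi phiC; have [mU _] := integrableP _ _ _ iu.
apply: (@integrable_dominated _ _ (fun x => C * `|u x|)) => //.
- by apply: measurable_funM => //; exact/measurable_EFinP.
- by move=> x Dx; rewrite /= normrM mulrC ler_wpM2r// phiC.
- exact: (integrableZl mD C (integrable_abse iu)).
Qed.

Lemma Rintegral_lincomb D k (f : 'I_k -> 'rV[R]_n -> R) (c : 'I_k -> R) : measurable D ->
  (forall l, mu.-integrable D (EFin \o f l)) ->
  \int[mu]_(x in D) (\sum_l c l * f l x) = \sum_l c l * \int[mu]_(x in D) f l x.
Proof.
move=> mD intf; rewrite /Rintegral.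
under eq_integral => x _ do rewrite -sumEFin.
rewrite integral_sum//; last by move=> l; exact: (integrableZl mD (c l) (intf l)).
rewrite (eq_bigr (fun l => (c l * \int[mu]_(x in D) f l x)%:E)).
  by rewrite sumEFin.
move=> l _; under eq_integral do rewrite EFinM.
rewrite (integralZl mD (intf l)) EFinM; congr (_ * _)%E.
by rewrite /Rintegral fineK//; exact: (integrable_fin_num mD (intf l)).
Qed.

Lemma L2_sqr_fin_num D u : L2 D u -> (\int[mu]_(x in D) (u x ^+ 2)%:E)%E \is a fin_num.
Proof.
move=> [_ ioo]; rewrite ge0_fin_numE//.
by apply: integral_ge0 => x _; rewrite lee_fin sqr_ge0.
Qed.

End L2_tools.

Section test_functions.
Context {R : realType} {n : nat}.
Notation mu := (@lebesgue_rV R n).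
Implicit Types (D : set 'rV[R]_n) (u w g phi : 'rV[R]_n -> R).

Lemma near_notin_closure phi x : ~ closure [set x | phi x != 0] x ->
  \near x, phi x = 0.
Proof.
move=> nx; have oC : open (~` closure [set x | phi x != 0]).
  by apply: closed_openC; exact: closed_closure.
have := open_nbhs_nbhs (conj oC nx).
apply: filterS => y ny; apply/eqP; apply: contrapT => /negP hy.
by apply: ny; exact: subset_closure.
Qed.

Lemma partial_notin_closure phi i x : ~ closure [set x | phi x != 0] x ->
  partial i phi x = 0.
Proof.
move=> nx; rewrite /partial (@near_eq_derive _ _ _ phi (cst 0)); last exact: near_notin_closure.
by rewrite derive_cst.
Qed.

Lemma continuous_compact_bounded phi (K : set 'rV[R]_n) : continuous phi -> compact K ->
  exists C, forall x, K x -> `|phi x| <= C.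
Proof.
move=> cphi cK.
have : bounded_set (phi @` K).
  by apply: compact_bounded; apply: continuous_compact => //; exact: continuous_subspaceT.
by move=> /pinfty_ex_gt0[M _ hM]; exists M => x Kx; exact: hM.
Qed.

Lemma continuous_support_bounded phi (K : set 'rV[R]_n) : continuous phi -> compact K ->
  (forall x, ~ K x -> phi x = 0) -> exists C, forall x, `|phi x| <= C.
Proof.
move=> cphi cK phi0; have [C hC] := continuous_compact_bounded cphi cK.
exists (Num.max C 0) => x; rewrite le_max; have [/hC -> //|/phi0 ->] := pselect (K x).
by rewrite normr0 lexx orbT.
Qed.

Lemma test_continuous D phi : test_function D phi -> continuous phi.
Proof. by case=> /(_ 0%N). Qed.

Lemma test_partial_continuous D phi i : test_function D phi -> continuous (partial i phi).
Proof. by case=> /(_ 1%N)[_ /(_ i)[]]. Qed.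

Lemma test_derivable D phi i x : test_function D phi -> is_derive x (unitv i) phi (partial i phi x).
Proof. by case=> /(_ 1%N)[_ /(_ i)[+ _]] _ _ => /(_ x); exact: derivableP. Qed.

Lemma test_bounded D phi : test_function D phi -> exists C, forall x, `|phi x| <= C.
Proof.
move=> tphi; have [_ cK _] := tphi.
apply: continuous_support_bounded cK _; first exact: test_continuous tphi.
by move=> x /near_notin_closure/nbhs_singleton.
Qed.

Lemma test_partial_bounded D phi i : test_function D phi ->
  exists C, forall x, `|partial i phi x| <= C.
Proof.
move=> tphi; have [_ cK _] := tphi.
apply: continuous_support_bounded cK _; first exact: test_partial_continuous tphi.
by move=> x /partial_notin_closure.
Qed.

Lemma integrable_mul_test D phi u : measurable D -> test_function D phi ->
  mu.-integrable D (EFin \o u) -> mu.-integrable D (EFin \o (u \* phi)).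
Proof.
move=> mD tphi iu; have [C hC] := test_bounded tphi.
apply: (@integrable_mul_bounded _ _ D _ _ C) => //.
by apply: measurable_funTS; apply: measurable_continuous; exact: test_continuous tphi.
Qed.

Lemma integrable_mul_test_partial D phi i u : measurable D -> test_function D phi ->
  mu.-integrable D (EFin \o u) -> mu.-integrable D (EFin \o (u \* partial i phi)).
Proof.
move=> mD tphi iu; have [C hC] := test_partial_bounded i tphi.
apply: (@integrable_mul_bounded _ _ D _ _ C) => //.
by apply: measurable_funTS; apply: measurable_continuous; exact: test_partial_continuous tphi.
Qed.

Lemma is_derive_along (psi q : 'rV[R]_n -> R) i x (t : R) :
  (forall x, is_derive x (unitv i) psi (q x)) ->
  is_derive t (1 : R) (fun s => psi (x + s *: unitv i)) (q (x + t *: unitv i)).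
Proof.
move=> dpsi; have [d1 d2] := dpsi (x + t *: unitv i).
have E : (fun h : R => h^-1 *: (psi (h *: unitv i + (x + t *: unitv i)) - psi (x + t *: unitv i)))
  = (fun h : R => h^-1 *: (psi (x + (h *: (1 : R) + t) *: unitv i) - psi (x + t *: unitv i))).
  apply/funext => h; congr (_ *: (psi _ - _)).
  by rewrite [h *: (1 : R)]mulr1 scalerDl addrCA.
by apply: DeriveDef; [move: d1; rewrite /derivable E|move: d2; rewrite /derive E].
Qed.

Lemma cvg_harmonic_dnbhs : (fun k : nat => k.+1%:R^-1 : R) @ \oo --> (0 : R)^'.
Proof.
move=> A hA; have [N _ HN] := @cvg_harmonic R _ hA.
by exists N => // k Nk; apply: (HN k Nk); rewrite invr_eq0 pnatr_eq0.
Qed.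

(** The difference quotients of psi have integral zero because the integral is
    translation invariant; by the mean value theorem they are bounded by the
    supremum of |q|, so dominated convergence applies. *)
Lemma integral_partial_eq0 (psi q : 'rV[R]_n -> R) i (M : R) :
  continuous psi -> continuous q ->
  (forall x, is_derive x (unitv i) psi (q x)) ->
  (forall x, ~ cbox (const_mx (- M)) (const_mx M) x -> psi x = 0 /\ q x = 0) ->
  (\int[mu]_x (q x)%:E = 0)%E.
Proof.
move=> cpsi cq dpsi supp.
set K := cbox _ _ in supp.
have [C hC] : exists C : R, forall x, `|q x| <= C.
  by apply: continuous_support_bounded (@compact_cbox _ _ _ _) _ => // x /supp[].
have [C' hC'] : exists C : R, forall x, `|psi x| <= C.
  by apply: continuous_support_bounded (@compact_cbox _ _ _ _) _ => // x /supp[].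
pose h (k : nat) : R := k.+1%:R^-1.
have h0 k : 0 < h k by rewrite invr_gt0.
have h1 k : h k <= 1 by rewrite invf_le1// ler1n.
pose f_ k x := (h k)^-1 * (psi (x + h k *: unitv i) - psi x).
(* The steps h k are at most 1, so B contains the supports of all the
   difference quotients. *)
pose B := obox (const_mx (- (M + 2))) (const_mx (M + 2)) : set 'rV[R]_n.
have mB : measurable B by exact: measurable_obox.
have outB x (s : R) : 0 <= s <= 1 -> ~ B x -> ~ K (x + s *: unitv i).
  move=> s01 nBx Kx; apply: nBx => j; have := Kx j; rewrite !mxE eqxx/=.
  by case: (j == i); rewrite ?mulr1 ?mulr0; move: (x ord0 j) => y; lra.
have mpsi : measurable_fun setT psi by exact: measurable_continuous.
have mq : measurable_fun setT q by exact: measurable_continuous.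
have mpsih k : measurable_fun [set: 'rV[R]_n] (fun x => psi (x + h k *: unitv i)).
  exact: (measurableT_comp (f := psi) mpsi (measurable_shift _)).
have mf k : measurable_fun [set: 'rV[R]_n] (f_ k).
  by apply: measurable_funM => //; exact: measurable_funB.
have iC c : mu.-integrable setT (EFin \o (fun x => c * \1_B x)).
  by apply: integrable_scaled_indic => //; exact: lebesgue_rV_obox_fin.
have ipsi : mu.-integrable setT (EFin \o psi).
  apply: (@integrable_dominated _ _ setT psi (fun x => C' * \1_B x)) => // x _.
  rewrite indicE; have [Bx|nBx] := pselect (B x); first by rewrite mem_set// mulr1.
  have := outB x 0 _ nBx; rewrite scale0r addr0 lexx ler01 => /(_ isT)/supp[-> _].
  by rewrite normr0 memNset// mulr0.
have f0 k : (\int[mu]_x (f_ k x)%:E = 0)%E.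
  under eq_integral do rewrite EFinM.
  have ipsih := integrable_shift (h k *: unitv i) ipsi.
  rewrite integralZl//; last exact: (integrableB measurableT ipsih ipsi).
  under eq_integral do rewrite EFinB.
  rewrite (integralB measurableT ipsih ipsi)/=.
  rewrite (@integral_shift R n _ (EFin \o psi)); last exact/measurable_EFinP.
  by rewrite subee ?mule0//; exact: integrable_fin_num.
have fC k x : `|f_ k x| <= C * \1_B x.
  rewrite indicE; have [Bx|nBx] := pselect (B x); last first.
    rewrite memNset// mulr0 /f_.
    have := outB x 0 _ nBx; rewrite scale0r addr0 lexx ler01 => /(_ isT)/supp[-> _].
    have := outB x (h k) _ nBx; rewrite (ltW (h0 k)) h1 => /(_ isT)/supp[-> _].
    by rewrite subr0 mulr0 normr0.
  rewrite mem_set// mulr1 /f_.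
  have [c _] := @MVT1 R _ _ 0 (h k) (ltW (h0 k)) (fun t => is_derive_along x t dpsi).
  rewrite scale0r addr0 subr0 => ->; rewrite mulrCA mulVf ?mulr1//.
  by rewrite gt_eqF.
have fq x : (f_ ^~ x) @ \oo --> q x.
  have [dx dv] := dpsi x; rewrite -dv.
  have cvh : h @ \oo --> (0 : R)^' by exact: cvg_harmonic_dnbhs.
  rewrite (_ : f_ ^~ x = (fun s : R => s^-1 *: (psi (s *: unitv i + x) - psi x)) \o h).
    exact: cvg_comp cvh dx.
  by apply/funext => k; rewrite /f_ /= /GRing.scale /= [_ + x]addrC.
have [] := @dominated_convergence _ _ R mu setT measurableT (fun k x => (f_ k x)%:E)
    (fun x => (q x)%:E) (fun x => (C * \1_B x)%:E).
- by move=> k; exact/measurable_EFinP.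
- exact/measurable_EFinP.
- by apply: aeW => x _; apply: cvg_EFin; [exact: nearW|exact: fq].
- exact: iC.
- by apply: aeW => x k _; rewrite /= lee_fin.
move=> _ _; under eq_fun do rewrite f0.
by move=> /cvg_lim; rewrite lim_cst// => ->.
Qed.

End test_functions.

Section weak_partials.
Context {R : realType} {n : nat}.
Notation mu := (@lebesgue_rV R n).
Variables (Omega : set 'rV[R]_n).
Hypothesis oO : open Omega.
Hypothesis fO : (mu Omega < +oo)%E.
Implicit Types (u w g h phi : 'rV[R]_n -> R).

Let mO : measurable Omega.
Proof. exact: measurable_open. Qed.

(** Integration by parts: the derivative of u * phi has integral zero. *)
Lemma classical_weak_partial u (du : 'rV[R]_n -> R) i : continuous u -> continuous du ->
  (forall x, is_derive x (unitv i) u (du x)) -> is_weak_partial Omega i u du.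
Proof.
move=> cu cdu ud phi tphi; have [_ cK KO] := tphi.
pose q x := u x * partial i phi x + du x * phi x.
have cphi := test_continuous tphi; have cdphi := test_partial_continuous (i := i) tphi.
have cq : continuous q.
  move=> x; apply: (@continuousD _ _ _ (fun x => u x * partial i phi x) (fun x => du x * phi x)).
    by apply: continuousM; [exact: cu|exact: cdphi].
  by apply: continuousM; [exact: cdu|exact: cphi].
have [M [M0 KM]] := bounded_sub_obox (compact_bounded cK).
have outK x : ~ closure [set x | phi x != 0] x -> phi x = 0 /\ partial i phi x = 0.
  move=> nx; split; first by have /nbhs_singleton := near_notin_closure nx.
  exact: partial_notin_closure.
have q0 : (\int[mu]_x (q x)%:E = 0)%E.
  apply: (@integral_partial_eq0 _ _ (fun x => u x * phi x) q i M) => //.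
  - by move=> x; apply: continuousM; [exact: cu|exact: cphi].
  - move=> x; have := is_deriveM (ud x) (test_derivable i x tphi).
    move=> H; apply: is_derive_eq; rewrite /q /GRing.scale /=; ring.
  - move=> x nKx.
    have [p0 dp0] : phi x = 0 /\ partial i phi x = 0.
      by apply: outK => /KM/sub_obox_cbox.
    by rewrite /q p0 dp0 !mulr0 addr0.
have bint (v f : 'rV[R]_n -> R) : continuous v -> continuous f ->
    (forall x, ~ closure [set x | phi x != 0] x -> f x = 0) ->
    mu.-integrable Omega (EFin \o (v \* f)).
  move=> cv cf f0.
  have [C hC] : exists C, forall x, `|(v \* f) x| <= C.
    apply: continuous_support_bounded cK _.
      by move=> x; apply: continuousM; [exact: cv|exact: cf].
    by move=> x /f0 /= ->; rewrite mulr0.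
  apply: L2_integrable => //; apply: (@L2_bounded _ _ _ _ C) => //.
  apply: measurable_funTS; apply: measurable_continuous.
  by move=> x; apply: continuousM; [exact: cv|exact: cf].
have i1 : mu.-integrable Omega (EFin \o (u \* partial i phi)).
  by apply: bint => // x /outK[].
have i2 : mu.-integrable Omega (EFin \o (du \* phi)).
  by apply: bint => // x /outK[].
apply/eqP; rewrite -addr_eq0 -RintegralD//; apply/eqP.
rewrite /Rintegral -[RHS]/(fine 0%E) -q0; congr fine.
rewrite integral_mkcond; apply: eq_integral => x _; rewrite patchE.
case: ifPn => // nx; rewrite /q.
have [|-> ->] := outK x; last by rewrite !mulr0 addr0.
by move=> /KO; rewrite notin_setE in nx.
Qed.

Lemma weak_partial_unique u g h i : L2 Omega g -> L2 Omega h ->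
  is_weak_partial Omega i u g -> is_weak_partial Omega i u h ->
  {ae mu, forall x, Omega x -> g x = h x}.
Proof.
move=> Lg Lh wg wh.
have Lgh := L2B mO Lg Lh.
have : {ae mu, forall x, Omega x -> g x - h x = 0}.
  apply: fundamental_lemma => //; first exact: L2_integrable.
  move=> a l r sa supp lrO _; have tphi := test_prodf sa supp lrO.
  have ig := integrable_mul_test mO tphi (L2_integrable mO fO Lg).
  have ih := integrable_mul_test mO tphi (L2_integrable mO fO Lh).
  have : \int[mu]_(x in Omega) (g x * prodf a x - h x * prodf a x) = 0.
    rewrite (RintegralB mO ig ih); have := wh _ tphi; rewrite (wg _ tphi) => /eqP.
    by rewrite eqr_opp => /eqP ->; rewrite subrr.
  rewrite /Rintegral => H.
  under eq_integral do rewrite mulrBl.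
  rewrite -[LHS]fineK ?H//; apply: integrable_fin_num => //.
  exact: (integrableB mO ig ih).
apply: filterS => x hx /hx/eqP; rewrite subr_eq0 => /eqP//.
Qed.

(** [weak_partial] is defined by choice; this is all that is known about it,
    and [weak_partial_unique] makes it enough. *)
Lemma weak_partialP u i : (exists g, L2 Omega g /\ is_weak_partial Omega i u g) ->
  L2 Omega (weak_partial Omega i u) /\ is_weak_partial Omega i u (weak_partial Omega i u).
Proof. by move=> h; exact: (xgetPex (cst 0) h). Qed.

(** Needed for second derivatives, where the function to be differentiated is
    itself only known almost everywhere. *)
Lemma is_weak_partial_ae u w g i : L2 Omega u -> L2 Omega w ->
  {ae mu, forall x, Omega x -> u x = w x} ->
  is_weak_partial Omega i u g -> is_weak_partial Omega i w g.
Proof.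
move=> Lu Lw uw ug phi tphi; rewrite -ug// /Rintegral; congr fine.
have [mU _] := Lu; have [mw _] := Lw.
have mdphi : measurable_fun Omega (partial i phi).
  apply: measurable_funTS; apply: measurable_continuous.
  exact: test_partial_continuous tphi.
apply: ae_eq_integral => //.
- by apply/measurable_EFinP; exact: measurable_funM.
- by apply/measurable_EFinP; exact: measurable_funM.
- by apply: filterS uw => x h Ox; rewrite h.
Qed.

Lemma is_weak_partial_sum k (w g : 'I_k -> 'rV[R]_n -> R) (c : 'I_k -> R) i :
  (forall l, L2 Omega (w l)) -> (forall l, L2 Omega (g l)) ->
  (forall l, is_weak_partial Omega i (w l) (g l)) ->
  is_weak_partial Omega i (fun x => \sum_l c l * w l x) (fun x => \sum_l c l * g l x).
Proof.
move=> Lw Lg wg phi tphi.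
have H (f : 'I_k -> 'rV[R]_n -> R) (v : 'rV[R]_n -> R) :
    (forall l, mu.-integrable Omega (EFin \o (f l \* v))) ->
    \int[mu]_(x in Omega) ((\sum_l c l * f l x) * v x) =
    \sum_l c l * \int[mu]_(x in Omega) (f l x * v x).
  move=> ifv; rewrite -Rintegral_lincomb//; apply: eq_Rintegral => x _.
  by rewrite mulr_suml; apply: eq_bigr => l _; rewrite mulrA.
rewrite !H.
- rewrite -sumrN; apply: eq_bigr => l _; rewrite wg// mulrN//.
- by move=> l; apply: integrable_mul_test => //; exact: L2_integrable.
- by move=> l; apply: integrable_mul_test_partial => //; exact: L2_integrable.
Qed.

Lemma H1_sum k (w : 'I_k -> 'rV[R]_n -> R) (c : 'I_k -> R) :
  (forall l, H1 Omega (w l)) -> H1 Omega (fun x => \sum_l c l * w l x).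
Proof.
move=> Hw; split; first by apply: L2_sum => // l; case: (Hw l).
move=> i; exists (fun x => \sum_l c l * weak_partial Omega i (w l) x).
have hw l := weak_partialP ((Hw l).2 i).
split; first by apply: L2_sum => // l; exact: (hw l).1.
by apply: is_weak_partial_sum => l; [case: (Hw l)|exact: (hw l).1|exact: (hw l).2].
Qed.

End weak_partials.

(** * The translation estimate *)

(** The average of F over random translations along e, the length [tau s] of the
    translation being distributed according to [m].  Only Fubini and translation
    invariance are used, so [m] and [tau] are left arbitrary; the application
    takes the uniform law on [0, t]. *)
Section moving_average.
Context {R : realType} {n : nat}.
Notation mu := (@lebesgue_rV R n).
Context d (S : measurableType d) (m : probability S R) (tau : S -> R).
Hypothesis mtau : measurable_fun [set: S] tau.
Variable e : 'rV[R]_n.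
Implicit Types (F K : 'rV[R]_n -> R).

Lemma measurable_shear (c : R) : measurable_fun setT
  (fun p : S * 'rV[R]_n => p.2 + (c * tau p.1) *: e).
Proof.
apply/measurable_fun_rVP => i.
rewrite (_ : _ \o _ = (rV_coord i \o snd) \+ (fun p : S * 'rV[R]_n => (c * tau p.1) * e ord0 i)).
  apply: measurable_funD.
    exact: measurableT_comp (measurable_rV_coord i) measurable_snd.
  apply: measurable_funM => //; apply: measurable_funM => //.
  exact: measurableT_comp mtau measurable_fst.
by apply/funext => p; rewrite /rV_coord /= !mxE.
Qed.

(** For each s the translation preserves the integral of |F|, so Fubini's
    hypothesis holds on the product.  The coefficient c selects a translated
    (c = 1) or an untranslated (c = 0) dominating function. *)
Lemma integrable_shear (H : S * 'rV[R]_n -> R) F (C c : R) :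
  mu.-integrable setT (EFin \o F) -> measurable_fun setT H ->
  (forall p, `|H p| <= C * `|F (p.2 + (c * tau p.1) *: e)|) -> 0 <= C ->
  (m \x mu)%E.-integrable setT (EFin \o H).
Proof.
move=> iF mH HC C0; have [mF fF] := integrableP _ _ _ iF.
have mEH : measurable_fun setT (EFin \o H) by exact/measurable_EFinP.
apply: (integrable12ltyP _ _ mEH).2.
have mF' : measurable_fun [set: 'rV[R]_n] (fun x => `|(F x)%:E|)%E by exact: measurableT_comp.
apply: (@le_lt_trans _ _ (\int[m]_s (C%:E * \int[mu]_x `|(F x)%:E|))%E).
  apply: ge0_le_integral => //.
  - by move=> s _; exact: integral_ge0.
  - apply: (measurable_fun_fubini_tonelli_F (abse \o (EFin \o H))) => //.
    + exact: measurableT_comp.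
    + by move=> p; exact: abse_ge0.
  move=> s _; rewrite -(@ge0_integral_shift R n ((c * tau s) *: e))//.
  rewrite -ge0_integralZl//.
  - apply: ge0_le_integral => //.
    + apply: measurableT_comp => //.
      exact: (measurableT_comp (f := EFin \o H) mEH (@pair1_measurable _ _ _ _ s)).
    + apply: emeasurable_funM => //.
      exact: (measurableT_comp (f := fun x => `|(F x)%:E|%E) mF' (measurable_shift _)).
    + by move=> x _; rewrite /= lee_fin; exact: (HC (s, x)).
  - exact: (measurableT_comp (f := fun x => `|(F x)%:E|%E) mF' (measurable_shift _)).
rewrite integral_cst// [X in (_ * X)%E]probability_setT mule1 lte_mul_pinfty//.
Qed.

(** For fixed s, the change of variables x - tau s e in the integral over x moves
    the translation from F to K. *)
Lemma moving_average_swap F K (C : R) :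
  mu.-integrable setT (EFin \o F) -> measurable_fun [set: 'rV[R]_n] K ->
  (forall x, `|K x| <= C) ->
  (\int[mu]_x \int[m]_s (F (x + tau s *: e) * K x)%:E =
   \int[mu]_x \int[m]_s (F x * K (x - tau s *: e))%:E)%E.
Proof.
move=> iF mK KC; have [/measurable_EFinP mF _] := integrableP _ _ _ iF.
have C0 : 0 <= C by apply: le_trans (KC 0).
have msh := measurable_shear 1.
have mshN := measurable_shear (-1).
pose H1 (p : S * 'rV[R]_n) := F (p.2 + (1 * tau p.1) *: e) * K p.2.
pose H2 (p : S * 'rV[R]_n) := F p.2 * K (p.2 + (-1 * tau p.1) *: e).
have i1 : (m \x mu)%E.-integrable setT (EFin \o H1).
  apply: (integrable_shear (C := C) (c := 1) iF) => //.
    apply: measurable_funM; last exact: measurableT_comp mK measurable_snd.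
    exact: measurableT_comp mF msh.
  by move=> p; rewrite normrM mulrC ler_wpM2r.
have i2 : (m \x mu)%E.-integrable setT (EFin \o H2).
  apply: (integrable_shear (C := C) (c := 0) iF) => //.
    apply: measurable_funM; first exact: measurableT_comp mF measurable_snd.
    exact: measurableT_comp mK mshN.
  by move=> p; rewrite normrM mul0r scale0r addr0 mulrC ler_wpM2r.
transitivity (\int[mu]_x \int[m]_s (EFin \o H1) (s, x))%E.
  by apply: eq_integral => x _; apply: eq_integral => s _; rewrite /H1 /= mul1r.
transitivity (\int[mu]_x \int[m]_s (EFin \o H2) (s, x))%E; last first.
  by apply: eq_integral => x _; apply: eq_integral => s _; rewrite /H2 /= mulN1r scaleNr.
rewrite -(Fubini i1) -(Fubini i2); apply: eq_integral => s _.
rewrite -(@integral_shift R n (tau s *: e) (fun x => (EFin \o H2) (s, x))); last first.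
  have [mE _] := integrableP _ _ _ i2.
  exact: (measurableT_comp (f := EFin \o H2) mE (@pair1_measurable _ _ _ _ s)).
apply: eq_integral => x _; rewrite /H1 /H2 /= mul1r.
by rewrite mulN1r scaleNr addrK.
Qed.

Lemma moving_average_ae_integrable F : mu.-integrable setT (EFin \o F) ->
  {ae mu, forall x, m.-integrable setT (fun s => (F (x + tau s *: e))%:E)}.
Proof.
move=> iF; have [/measurable_EFinP mF _] := integrableP _ _ _ iF.
pose H1 (p : S * 'rV[R]_n) := F (p.2 + (1 * tau p.1) *: e).
have i1 : (m \x mu)%E.-integrable setT (EFin \o H1).
  apply: (integrable_shear (C := 1) (c := 1) iF) => //.
    exact: measurableT_comp mF (measurable_shear 1).
  by move=> p; rewrite mul1r.
have := ae_integrable2 i1; apply: filterS => x.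
by congr (_.-integrable _ _); apply/funext => s; rewrite /H1 /= mul1r.
Qed.

Lemma moving_average_integrable F : mu.-integrable setT (EFin \o F) ->
  mu.-integrable setT (EFin \o (fun x => \int[m]_s F (x + tau s *: e))).
Proof.
move=> iF; have [/measurable_EFinP mF _] := integrableP _ _ _ iF.
pose H1 (p : S * 'rV[R]_n) := F (p.2 + (1 * tau p.1) *: e).
have i1 : (m \x mu)%E.-integrable setT (EFin \o H1).
  apply: (integrable_shear (C := 1) (c := 1) iF) => //.
    exact: measurableT_comp mF (measurable_shear 1).
  by move=> p; rewrite mul1r.
have mG := measurable_fubini_G i1.
have E x : \int[m]_s F (x + tau s *: e) = fine (fubini_G m (EFin \o H1) x).
  rewrite /Rintegral; congr fine; apply: eq_integral => s _.
  by rewrite /H1 /= mul1r.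
have mE1 : measurable_fun setT (EFin \o H1) by have [] := integrableP _ _ _ i1.
have mA : measurable_fun setT (fun p : S * 'rV[R]_n => `|(EFin \o H1) p|)%E.
  exact: measurableT_comp.
apply/integrableP; split.
  apply/measurable_EFinP; under eq_fun do rewrite E.
  by apply: measurableT_comp mG => //; exact: measurable_fine.
apply: (@le_lt_trans _ _ (\int[mu]_x \int[m]_s `|(EFin \o H1) (s, x)|))%E; last first.
  exact: (integrable21ltyP _ _ mE1).1.
apply: ge0_le_integral => //.
- apply: measurableT_comp => //; apply/measurable_EFinP; under eq_fun do rewrite E.
  by apply: measurableT_comp mG => //; exact: measurable_fine.
- by apply: (measurable_fun_fubini_tonelli_G (fun p => `|(EFin \o H1) p|)%E).
move=> x _; rewrite /= E.
apply: (@le_trans _ _ `|fubini_G m (EFin \o H1) x|%E).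
  by case: (fubini_G _ _ x) => [r| |] //=; rewrite ?normr0 ?leey.
apply: le_abse_integral => //.
exact: (measurableT_comp (f := EFin \o H1) mE1 (@pair2_measurable _ _ _ _ x)).
Qed.

(** Averaging is self-adjoint up to reversing the translations. *)
Lemma moving_average_swap_R F K (C : R) :
  mu.-integrable setT (EFin \o F) -> measurable_fun [set: 'rV[R]_n] K ->
  (forall x, `|K x| <= C) ->
  \int[mu]_x ((\int[m]_s F (x + tau s *: e)) * K x) =
  \int[mu]_x (F x * \int[m]_s K (x - tau s *: e)).
Proof.
move=> iF mK KC; have [/measurable_EFinP mF _] := integrableP _ _ _ iF.
have C0 : 0 <= C by apply: le_trans (KC 0).
rewrite /Rintegral; congr fine.
transitivity (\int[mu]_x \int[m]_s (F (x + tau s *: e) * K x)%:E)%E.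
  apply: ae_eq_integral => //.
  - apply/measurable_EFinP; apply: measurable_funM => //.
    by have [/measurable_EFinP] := integrableP _ _ _ (moving_average_integrable iF).
  - pose H1 (p : S * 'rV[R]_n) := F (p.2 + (1 * tau p.1) *: e) * K p.2.
    have i1 : (m \x mu)%E.-integrable setT (EFin \o H1).
      apply: (integrable_shear (C := C) (c := 1) iF) => //.
        apply: measurable_funM; last exact: measurableT_comp mK measurable_snd.
        exact: measurableT_comp mF (measurable_shear 1).
      by move=> p; rewrite normrM mulrC ler_wpM2r.
    have := measurable_fubini_G i1; congr measurable_fun.
    by apply/funext => x; apply: eq_integral => s _; rewrite /H1 /= mul1r.
  - have := moving_average_ae_integrable iF; apply: filterS => x ix _.
    under [RHS]eq_integral do rewrite mulrC EFinM.
    rewrite integralZl// mulrC EFinM; congr (_ * _)%E.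
    by rewrite fineK//; exact: integrable_fin_num.
rewrite (moving_average_swap iF mK KC); apply: eq_integral => x _.
have mKx : measurable_fun setT (fun s => K (x - tau s *: e)).
  have h2 := measurableT_comp (measurable_shear (-1)) (@pair2_measurable _ _ S 'rV[R]_n x).
  have := measurableT_comp mK h2; congr measurable_fun.
  by apply/funext => s; rewrite /= mulN1r scaleNr.
have iKx : m.-integrable setT (fun s => (K (x - tau s *: e))%:E).
  apply: (@le_integrable _ _ _ m setT measurableT _ (EFin \o cst C)).
  - exact/measurable_EFinP.
  - by move=> s _; rewrite /= lee_fin (ger0_norm C0).
  - exact: finite_measure_integrable_cst.
under [LHS]eq_integral do rewrite EFinM.
by rewrite integralZl// EFinM fineK//; exact: integrable_fin_num.
Qed.

Lemma moving_average_sqr_measurable F : measurable_fun setT F ->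
  measurable_fun setT (fun x : 'rV[R]_n => \int[m]_s (F (x + tau s *: e) ^+ 2)%:E)%E.
Proof.
move=> mF; pose H1 (p : S * 'rV[R]_n) := (F (p.2 + (1 * tau p.1) *: e) ^+ 2)%:E.
have := @measurable_fun_fubini_tonelli_G _ _ _ _ _ m H1.
rewrite (_ : fubini_G m H1 = (fun x => \int[m]_s (F (x + tau s *: e) ^+ 2)%:E)%E); last first.
  by apply/funext => x; apply: eq_integral => s _; rewrite /H1 /= mul1r.
apply; last by move=> p; rewrite lee_fin sqr_ge0.
apply/measurable_EFinP; apply: measurable_funX.
exact: measurableT_comp mF (measurable_shear 1).
Qed.

(** Each translate has the same L2 norm; with Jensen's inequality, averaging
    does not increase it. *)
Lemma moving_average_sqr F : measurable_fun setT F ->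
  (\int[mu]_x \int[m]_s ((F (x + tau s *: e)) ^+ 2)%:E = \int[mu]_x ((F x) ^+ 2)%:E)%E.
Proof.
move=> mF.
pose H1 (p : S * 'rV[R]_n) := (F (p.2 + (1 * tau p.1) *: e) ^+ 2)%:E.
have mH : measurable_fun setT H1.
  apply/measurable_EFinP; apply: measurable_funX.
  exact: measurableT_comp mF (measurable_shear 1).
transitivity (\int[mu]_x \int[m]_s H1 (s, x))%E.
  by apply: eq_integral => x _; apply: eq_integral => s _; rewrite /H1 /= mul1r.
rewrite -(fubini_tonelli H1)//; last by move=> p; rewrite lee_fin sqr_ge0.
transitivity (\int[m]_s (\int[mu]_x ((F x) ^+ 2)%:E))%E.
  apply: eq_integral => s _.
  rewrite -(@ge0_integral_shift R n ((1 * tau s) *: e) (fun x => (F x ^+ 2)%:E))//.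
    by apply/measurable_EFinP; exact: measurable_funX.
  by move=> x; rewrite lee_fin sqr_ge0.
by rewrite integral_cst// [X in (_ * X)%E]probability_setT mule1.
Qed.

End moving_average.

(** The variance is nonnegative. *)
Lemma jensen_sqr {R : realType} d (S : measurableType d) (m : probability S R) (f : S -> R) :
  m.-integrable setT (EFin \o f) ->
  (((\int[m]_s f s) ^+ 2)%:E <= \int[m]_s ((f s) ^+ 2)%:E)%E.
Proof.
move=> intf; have [/measurable_EFinP mf _] := integrableP _ _ _ intf.
have mf2 : measurable_fun setT (fun s => ((f s) ^+ 2)%:E).
  by apply/measurable_EFinP; exact: measurable_funX.
have [fin|] := boolP (\int[m]_s ((f s) ^+ 2)%:E < +oo)%E; last first.
  by rewrite -leNgt leye_eq => /eqP ->; rewrite leey.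
have if2 : m.-integrable setT (fun s => ((f s) ^+ 2)%:E).
  apply/integrableP; split => //.
  by under eq_integral do rewrite gee0_abs ?lee_fin ?sqr_ge0//.
set c := \int[m]_s f s.
have cE : (\int[m]_s (f s)%:E = c%:E)%E.
  by rewrite /c /Rintegral fineK//; exact: integrable_fin_num.
have ic : m.-integrable setT (fun s : S => (c ^+ 2)%:E).
  exact: finite_measure_integrable_cst.
have i2 := integrableZl measurableT (- (2 * c)) intf.
have : (0 <= \int[m]_s ((f s - c) ^+ 2)%:E)%E.
  by apply: integral_ge0 => s _; rewrite lee_fin sqr_ge0.
under eq_integral => s _.
  rewrite (_ : (f s - c) ^+ 2 = f s ^+ 2 + (- (2 * c) * f s + c ^+ 2)); last by ring.
  rewrite EFinD [X in (_ + X)%E]EFinD [X in (_ + (X + _))%E]EFinM; over.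
rewrite integralD//; last exact: integrableD.
rewrite integralD// integralZl// cE integral_cst// [X in (_ + (_ + _ * X))%E]probability_setT mule1.
move: (integrable_fin_num measurableT if2).
case: (\int[m]_s _)%E => // r _; rewrite -!EFinM -!EFinD !lee_fin; nra.
Qed.

Section translation_estimate.
Context {R : realType} {n : nat}.
Notation mu := (@lebesgue_rV R n).
Variables (Omega : set 'rV[R]_n).
Hypothesis oO : open Omega.
Hypothesis fO : (mu Omega < +oo)%E.
Variables (u g : 'rV[R]_n -> R) (i : 'I_n).
Hypotheses (Lu : L2 Omega u) (Lg : L2 Omega g) (wg : is_weak_partial Omega i u g).

Let mO : measurable Omega.
Proof. exact: measurable_open. Qed.

(* Extended by zero, u and g can be translated freely in R^n. *)
Let U := u \_ Omega.
Let G := g \_ Omega.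

Let iU : mu.-integrable setT (EFin \o U).
Proof.
have := L2_integrable mO fO Lu; by rewrite (integrable_mkcond _ mO) restrict_EFin.
Qed.

Let iG : mu.-integrable setT (EFin \o G).
Proof.
have := L2_integrable mO fO Lg; by rewrite (integrable_mkcond _ mO) restrict_EFin.
Qed.

Let mU : measurable_fun setT U.
Proof. by have [/measurable_EFinP] := integrableP _ _ _ iU. Qed.

Let mG : measurable_fun setT G.
Proof. by have [/measurable_EFinP] := integrableP _ _ _ iG. Qed.

Lemma Rintegral_patch (v : 'rV[R]_n -> R) phi :
  \int[mu]_(x in Omega) (v x * phi x) = \int[mu]_x ((v \_ Omega) x * phi x).
Proof.
rewrite Rintegral_mkcond; apply: eq_Rintegral => x _; rewrite !patchE.
by case: ifP => // _; rewrite mul0r.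
Qed.

Variables (t : R) (t0 : 0 < t) (D : set 'rV[R]_n).
Hypothesis oD : open D.
Hypothesis DO : forall x s, D x -> 0 <= s <= t -> Omega (x + s *: unitv i).

Let m : probability (measurableTypeR R) R := uniform_prob t0.
Let tau (s : measurableTypeR R) : R := s.

Let mtau : measurable_fun [set: measurableTypeR R] tau.
Proof. exact: measurable_id. Qed.

Let e := unitv i : 'rV[R]_n.

Section test.
Variables (a : 'I_n -> R -> R) (l r : 'rV[R]_n).
Hypotheses (sa : forall j, smooth (a j)) (suppa : supported a l r) (lrD : cbox l r `<=` D).
Hypothesis (a01 : forall j s, 0 <= a j s <= 1).
Hypothesis lr : forall j, l ord0 j <= r ord0 j.

(** With B an antiderivative of the i-th factor, replace that factor by
    B(y) - B(y - t).  Its derivative is the difference of the factor and of its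
    translate, and the function itself is t times the average of the translates
    over [0, t].  Its support is the box stretched by t in direction i, which is
    swept out by the segments starting in D and hence is contained in Omega. *)
Lemma translation_test_identity :
  exists Phi : 'rV[R]_n -> R, [/\ test_function Omega Phi,
    forall x, partial i Phi x = prodf a x - prodf a (x - t *: e) &
    forall x, (\int[m]_s (prodf a (x - tau s *: e))%:E = (t^-1 * Phi x)%:E)%E].
Proof.
have [B [sB dB B0 B1]] := antiderivative (sa i) (fun s => @suppa i s).
pose A y := B y - B (1 * y + - t).
have sA : smooth A by apply: smooth_sub => //; exact: smooth_affine.
pose a' j := if j == i then A else a j.
have sa' j : smooth (a' j) by rewrite /a'; case: ifP.
have dA y : derive1 A y = a i y - a i (y - t).
  have h2 := is_derive_affine (dB (1 * y + - t)).
  have h := is_deriveB (dB y) h2.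
  by rewrite derive1E (@derive_val _ _ _ _ _ _ _ h) mul1r mul1r.
have proda' x : prodf a' x = A (x ord0 i) * \prod_(j | j != i) a j (x ord0 j).
  rewrite /prodf (bigD1 i)//= /a' eqxx; congr (_ * _).
  by apply: eq_bigr => j /negbTE ->.
have prod_shift x s : prodf a (x - s *: e) =
    a i (x ord0 i - s) * \prod_(j | j != i) a j (x ord0 j).
  rewrite /prodf (bigD1 i)//= !mxE !eqxx mulr1; congr (_ * _).
  by apply: eq_bigr => j ji; rewrite !mxE eqxx (negbTE ji) /= mulr0 subr0.
exists (prodf a'); split.
- apply: (@test_prodf _ _ _ a' l (r + t *: e)) => //.
  + move=> j s; rewrite /a' !mxE eqxx/=; case: eqP => [->|_].
      rewrite mulr1 negb_and -!leNgt => /orP[h|h].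
        have h' : 1 * s + - t <= l ord0 i by rewrite mul1r lerBlDr (le_trans h)// lerDl ltW.
        by rewrite /A (B0 s h) (B0 _ h') subrr.
      have h1 : r ord0 i <= 1 * s + - t by rewrite mul1r lerBrDr.
      have h2 : r ord0 i <= s by rewrite (le_trans _ h)// lerDl ltW.
      by rewrite /A (B1 _ h2) (B1 _ h1) subrr.
    by rewrite mulr0 addr0; exact: suppa.
  + move=> y hy.
    (* The shortest translation that brings y back into the original box. *)
    pose s := Num.max 0 (y ord0 i - r ord0 i).
    have hyi := hy i; rewrite !mxE !eqxx mulr1 in hyi.
    have hs : 0 <= s <= t by rewrite /s le_max lexx/= ge_max (ltW t0)/=; lra.
    rewrite -(subrK (s *: e) y); apply: DO => //; apply: lrD => j.
    have := hy j; rewrite !mxE eqxx/=; case: eqP => [->|_].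
      by rewrite !mulr1 /s; have := lr i; rewrite /Num.max; case: ltP; lra.
    by rewrite !mulr0 addr0 subr0.
- move=> x; have -> : prodf a x = a i (x ord0 i) * \prod_(j | j != i) a j (x ord0 j).
    by rewrite /prodf (bigD1 i).
  rewrite partial_prodf// prod_shift.
  rewrite /prodf (bigD1 i)//= /dprodf eqxx {1}/a' eqxx dA mulrBl.
  have -> : \prod_(j | j != i) (if j == i then (a' j)^`()%classic else a' j) (x ord0 j)
    = \prod_(j | j != i) a j (x ord0 j).
    by apply: eq_bigr => j /negbTE ji; rewrite /a' ji.
  by [].
- move=> x; set C := \prod_(j | j != i) a j (x ord0 j).
  have C0 : 0 <= C by apply: prodr_ge0 => j _; case/andP: (a01 j (x ord0 j)).
  have ca : continuous (a i) by exact: smooth_cont.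
  have cai : continuous (fun s : R => a i (-1 * s + x ord0 i)).
    by apply: smooth_cont; exact: smooth_affine.
  rewrite integral_uniform; last 2 first.
  + apply/measurable_EFinP; under eq_fun do rewrite prod_shift.
    apply: measurable_funM => //; under eq_fun do rewrite -mulN1r addrC.
    exact: continuous_measurable_fun.
  + move=> s; rewrite lee_fin; apply: prodr_ge0 => j _; by case/andP: (a01 j ((x - tau s *: e) ord0 j)).
  rewrite subr0 EFinM; congr (_ * _)%E.
  rewrite proda' -/C.
  under eq_integral do rewrite /tau prod_shift -/C mulrC EFinM.
  rewrite ge0_integralZl//; last 2 first.
  + apply/measurable_EFinP; apply: measurable_funTS.
    under eq_fun do rewrite -mulN1r addrC; exact: continuous_measurable_fun.
  + by move=> s _; rewrite lee_fin; case/andP: (a01 i (x ord0 i - s)).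
  rewrite [in RHS]mulrC EFinM; congr (_ * _)%E.
  have dF s : is_derive s (1 : R) (fun s => - B (-1 * s + x ord0 i)) (a i (x ord0 i - s)).
    have -> : a i (x ord0 i - s) = - (-1 * a i (-1 * s + x ord0 i)).
      by rewrite !mulN1r opprK addrC.
    exact: (is_deriveN (is_derive_affine (dB (-1 * s + x ord0 i)))).
  rewrite (@continuous_FTC2 R _ (fun s => - B (-1 * s + x ord0 i)) 0 t t0).
  + rewrite -EFinB; congr EFin; rewrite /A mulr0 add0r opprK addrC mulN1r mul1r.
    by rewrite [- t + _]addrC.
  + apply: continuous_subspaceT => s; have := cai s.
    by under eq_fun do rewrite mulN1r addrC.
  + have cF := continuous_of_derive dF; split.
    * by move=> s _; case: (dF s).
    * by apply: cvg_at_right_filter; exact: cF.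
    * by apply: cvg_at_left_filter; exact: cF.
  + by move=> s _; rewrite derive1E derive_val.
Qed.

End test.

(** The fundamental theorem of calculus along almost every segment.  Tested
    against phi, the increment becomes the integral of U against
    phi(x - t e) - phi(x), which is minus a partial derivative of Phi, and the
    average of G becomes the integral of G against Phi / t: they match by
    definition of the weak derivative. *)
Lemma translation_ae : {ae mu, forall x, D x ->
  U (x + t *: e) - U x = t * \int[m]_s G (x + tau s *: e)}.
Proof.
pose I x := \int[m]_s G (x + tau s *: e).
have iI : mu.-integrable setT (EFin \o I) by exact: moving_average_integrable.
pose w x := U (x + t *: e) - U x - t * I x.
have iUt : mu.-integrable setT (EFin \o (fun x => U (x + t *: e))).
  exact: (integrable_shift (t *: e) iU).
have iV : mu.-integrable setT (EFin \o (fun x => U (x + t *: e) - U x)).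
  exact: (integrableB measurableT iUt iU).
have itI : mu.-integrable setT (EFin \o (fun x => t * I x)).
  exact: (integrableZl measurableT t iI).
have iw : mu.-integrable setT (EFin \o w) by exact: (integrableB measurableT iV itI).
have mD := measurable_open oD.
suff : {ae mu, forall x, D x -> w x = 0}.
  by apply: filterS => x h Dx; apply/eqP; rewrite -subr_eq0; apply/eqP; exact: h.
apply: fundamental_lemma => //; first exact: integrableS iw.
move=> a l r sa suppa lrD a01.
have [lr|/existsNP[j /negP lrj]] := pselect (forall j, l ord0 j <= r ord0 j); last first.
  rewrite (eq_integral (cst 0%E)) ?integral0// => x _.
  rewrite /prodf (bigD1 j)//= suppa ?mul0r ?mulr0//.
  by apply/negP => /andP[h1 h2]; move: lrj; rewrite (ltW (lt_trans h1 h2)).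
have [Phi [tPhi dPhi IPhi]] := translation_test_identity sa suppa lrD a01 lr.
set phi := prodf a.
have phi01 x : `|phi x| <= 1.
  rewrite /phi /prodf normr_prod; apply: prodr_ile1 => j _.
  by have /andP[h1 h2] := a01 j (x ord0 j); rewrite normr_ge0 ger0_norm.
have cphi : continuous phi by apply: continuous_prodf => j; exact: smooth_cont.
have mphi : measurable_fun setT phi by exact: measurable_continuous.
have phi0 x : ~ D x -> phi x = 0.
  move=> nD; apply: (prodf_supp suppa) => /sub_obox_cbox/lrD//.
have mul_phi v : mu.-integrable setT (EFin \o v) -> mu.-integrable setT (EFin \o (v \* phi)).
  by move=> iv; exact: (integrable_mul_bounded measurableT iv mphi (fun x _ => phi01 x)).
have -> : (\int[mu]_(x in D) (w x * phi x)%:E = \int[mu]_x (w x * phi x)%:E)%E.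
  rewrite integral_mkcond; apply: eq_integral => x _; rewrite patchE.
  by case: ifPn => //; rewrite notin_setE => /phi0 ->; rewrite mulr0.
suff : \int[mu]_x (w x * phi x) = 0.
  rewrite /Rintegral => H; rewrite -[LHS]fineK ?H//.
  by apply: integrable_fin_num => //; exact: mul_phi.
have mphit : measurable_fun [set: 'rV[R]_n] (fun x => phi (x - t *: e)).
  exact: (measurableT_comp (f := phi) mphi (measurable_shift (- (t *: e)))).
have iUphit : mu.-integrable setT (EFin \o (fun x => U x * phi (x - t *: e))).
  exact: (integrable_mul_bounded measurableT iU mphit (fun x _ => phi01 _)).
have eU : \int[mu]_x (U (x + t *: e) * phi x) - \int[mu]_x (U x * phi x) =
    \int[mu]_x (G x * Phi x).
  have -> : \int[mu]_x (U (x + t *: e) * phi x) = \int[mu]_x (U x * phi (x - t *: e)).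
    rewrite -(@Rintegral_shift R n (t *: e) (fun x => U x * phi (x - t *: e))).
      by apply: eq_Rintegral => x _; rewrite addrK.
    exact: measurable_funM.
  rewrite -[RHS]Rintegral_patch -[RHS]opprK -wg// Rintegral_patch.
  rewrite -RintegralB//; last exact: mul_phi.
  rewrite -[RHS]mulN1r -RintegralZl//; last first.
    have := integrableB measurableT (mul_phi _ iU) iUphit.
    congr (_.-integrable _ _); apply/funext => x.
    by rewrite /= dPhi -EFinB -mulrBr.
  by apply: eq_Rintegral => x _; rewrite dPhi -/phi -/U; ring.
have eI : \int[mu]_x (I x * phi x) = t^-1 * \int[mu]_x (G x * Phi x).
  have [CP hCP] := test_bounded tPhi.
  have iGPhi : mu.-integrable setT (EFin \o (G \* Phi)).
    apply: (integrable_mul_bounded measurableT iG _ (fun x _ => hCP x)).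
    by apply: measurable_continuous; exact: test_continuous tPhi.
  rewrite -RintegralZl// (moving_average_swap_R m mtau e iG mphi phi01).
  apply: eq_Rintegral => x _; rewrite mulrCA; congr (_ * _).
  by rewrite /Rintegral IPhi.
rewrite /w; under eq_Rintegral do rewrite mulrBl mulrBl.
rewrite RintegralB//; last 2 first.
- exact: (integrableB measurableT (mul_phi _ iUt) (mul_phi _ iU)).
- exact: mul_phi.
rewrite RintegralB//; last 2 first.
- exact: mul_phi.
- exact: mul_phi.
rewrite eU; under [X in _ - X]eq_Rintegral do rewrite -mulrA.
rewrite RintegralZl//; last exact: mul_phi.
by rewrite eI mulrA mulfV ?mul1r ?subrr// gt_eqF.
Qed.

(** Jensen's inequality on each segment, then integration over D. *)
Lemma translation_estimate :
  (\int[mu]_(x in D) ((U (x + t *: e) - U x) ^+ 2)%:E <=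
   (t ^+ 2)%:E * \int[mu]_(x in Omega) ((g x) ^+ 2)%:E)%E.
Proof.
have mD := measurable_open oD.
have -> : (\int[mu]_(x in Omega) ((g x) ^+ 2)%:E = \int[mu]_x ((G x) ^+ 2)%:E)%E.
  rewrite integral_mkcond; apply: eq_integral => x _; rewrite /G !patchE.
  by case: ifP => //; rewrite expr0n.
rewrite -(moving_average_sqr m mtau e mG).
have mS : measurable_fun setT (fun x : 'rV[R]_n => \int[m]_s (G (x + tau s *: e) ^+ 2)%:E)%E.
  exact: moving_average_sqr_measurable.
rewrite -ge0_integralZl//; last 2 first.
- by move=> x _; apply: integral_ge0 => s _; rewrite lee_fin sqr_ge0.
- by rewrite lee_fin sqr_ge0.
have mV : measurable_fun [set: 'rV[R]_n] (fun x => U (x + t *: e) - U x).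
  apply: measurable_funB => //.
  exact: (measurableT_comp (f := U) mU (measurable_shift (t *: e))).
apply: (@le_trans _ _ (\int[mu]_(x in D) ((t ^+ 2)%:E * \int[m]_s (G (x + tau s *: e) ^+ 2)%:E)))%E; last first.
  apply: ge0_subset_integral => //.
    by apply: emeasurable_funM.
  move=> x _; rewrite mule_ge0// ?lee_fin ?sqr_ge0//.
  by apply: integral_ge0 => s _; rewrite lee_fin sqr_ge0.
apply: ae_ge0_le_integral => //.
- by move=> x _; rewrite lee_fin sqr_ge0.
- by apply: measurable_funTS; apply/measurable_EFinP; exact: measurable_funX.
- move=> x _; rewrite mule_ge0// ?lee_fin ?sqr_ge0//.
  by apply: integral_ge0 => s _; rewrite lee_fin sqr_ge0.
- by apply: measurable_funTS; exact: emeasurable_funM.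
have := translation_ae; have := moving_average_ae_integrable m mtau e iG.
apply: filterS2 => x ix hx Dx; rewrite hx// exprMn EFinM.
by rewrite lee_wpmul2l ?lee_fin ?sqr_ge0//; exact: jensen_sqr.
Qed.

End translation_estimate.

(** * Poincare inequality on a box *)
Lemma line_between {R : realFieldType} (lo hi x h s : R) : 0 <= s <= 1 ->
  lo < x < hi -> lo < x + h < hi -> lo < x + s * h < hi.
Proof.
move=> /andP[s0 s1] /andP[p1 p2] /andP[p3 p4].
have [hp|hn] := leP 0 h.
  have q1 : 0 <= s * h by exact: mulr_ge0.
  have q2 : s * h <= h by rewrite ler_piMl.
  by apply/andP; split; lra.
have q1 : s * h <= 0 by rewrite mulr_ge0_le0// ltW.
have q2 : h <= s * h by rewrite ler_niMl// ltW.
by apply/andP; split; lra.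
Qed.

Section poincare.
Context {R : realType} {n : nat}.
Notation mu := (@lebesgue_rV R n).

Lemma ge0_integral_shift_set (v : 'rV[R]_n) (A : set 'rV[R]_n) (f : 'rV[R]_n -> \bar R) :
  measurable A -> measurable_fun [set: 'rV[R]_n] f -> (forall x, 0 <= f x)%E ->
  (\int[mu]_(x in [set x | A (x + v)%R]) f (x + v)%R = \int[mu]_(x in A) f x)%E.
Proof.
move=> mA mf f0; rewrite [LHS]integral_mkcond [RHS]integral_mkcond.
rewrite -[RHS](ge0_integral_shift v).
- apply: eq_integral => x _; rewrite !patchE.
  by congr (if _ then _ else _); apply/idP/idP; rewrite !inE.
- by apply: (iffLR (measurable_restrictT f mA)); exact: measurable_funTS.
- by move=> x; rewrite patchE; case: ifP.
Qed.

Lemma open_shift (v : 'rV[R]_n) (A : set 'rV[R]_n) : open A -> open [set x | A (x + v)].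
Proof.
move=> oA; rewrite openE => x Ax.
have /nbhs_ballP[e /= e0 eA] := open_nbhs_nbhs (conj oA Ax).
apply/nbhs_ballP; exists e => //= y xy; apply: eA.
by move: xy; rewrite -!ball_normE /= opprD addrACA subrr addr0.
Qed.

Variables (Omega : set 'rV[R]_n).
Hypothesis oO : open Omega.
Hypothesis fO : (mu Omega < +oo)%E.
Variables (u : 'rV[R]_n -> R) (g : 'I_n -> 'rV[R]_n -> R).
Hypotheses (Lu : L2 Omega u) (Lg : forall i, L2 Omega (g i)).
Hypothesis (wg : forall i, is_weak_partial Omega i u (g i)).

Let mO : measurable Omega.
Proof. exact: measurable_open. Qed.

Let U := u \_ Omega.

Let mU : measurable_fun [set: 'rV[R]_n] U.
Proof. by apply: (iffLR (measurable_restrictT u mO)); case: Lu. Qed.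

Let mUs (v : 'rV[R]_n) : measurable_fun [set: 'rV[R]_n] (fun x => U (x + v)).
Proof. exact: (measurableT_comp (f := U) mU (measurable_shift v)). Qed.

Let mUd (v w : 'rV[R]_n) : measurable_fun [set: 'rV[R]_n]
  (fun x => ((U (x + v) - U (x + w)) ^+ 2)%:E).
Proof.
by apply/measurable_EFinP; apply: measurable_funX; exact: measurable_funB.
Qed.

(** For negative t the estimate is applied from the far end of the segments. *)
Lemma shift_estimate (i : 'I_n) (t : R) (D : set 'rV[R]_n) : open D ->
  (forall x th, D x -> 0 <= th <= 1 -> Omega (x + (th * t) *: unitv i)) ->
  (\int[mu]_(x in D) ((U (x + t *: unitv i) - U x) ^+ 2)%:E <=
   (t ^+ 2)%:E * \int[mu]_(x in Omega) ((g i x) ^+ 2)%:E)%E.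
Proof.
move=> oD DO; have [t0|t0|->] := ltgtP t 0; last first.
- rewrite (eq_integral (cst 0%E)); last first.
    by move=> x _; rewrite scale0r addr0 subrr expr0n.
  by rewrite integral0 expr0n/= mul0e.
- apply: (translation_estimate oO fO Lu (Lg i) (wg i) t0 oD).
  move=> x s Dx /andP[s0 st]; have := DO x (s / t) Dx.
  by rewrite divfK ?gt_eqF//; apply; rewrite divr_ge0 ?(ltW t0)//= ler_pdivrMr// mul1r.
have tN : 0 < - t by rewrite oppr_gt0.
pose v := t *: unitv i : 'rV[R]_n.
pose D' := [set y | D (y + - v)].
have oD' : open D' by exact: open_shift.
have mD : measurable D by exact: measurable_open.
have -> : (t ^+ 2 = (- t) ^+ 2) by rewrite sqrrN.
have H := translation_estimate oO fO Lu (Lg i) (wg i) tN oD'.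
apply: le_trans (H _); last first.
  move=> x s Dx /andP[s0 st]; have := DO _ (1 - s / (- t)) Dx.
  have -> : x - v + ((1 - s / - t) * t) *: unitv i = x + s *: unitv i.
    rewrite -addrA /v -scaleNr -scalerDl; congr (_ + _ *: _).
    by field; rewrite lt_eqF.
  apply; rewrite subr_ge0 ler_pdivrMr// mul1r st/= lerBlDr lerDl.
  by rewrite divr_ge0// ltW.
rewrite -(@ge0_integral_shift_set (- v) D (fun x => ((U (x + v) - U x) ^+ 2)%:E))//.
- rewrite le_eqVlt; apply/orP; left; apply/eqP; apply: eq_integral => x _.
  by rewrite -addrA addNr addr0 scaleNr -/v -/U -sqrrN opprB.
- by have := mUd v 0; congr (measurable_fun _ _); apply/funext => x; rewrite addr0.
- by move=> x; rewrite lee_fin sqr_ge0.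
Qed.

(** Extended-real valued, so that estimates need no integrability side
    condition. *)
Definition energy_sum : \bar R := (\sum_i \int[mu]_(x in Omega) ((g i x) ^+ 2)%:E)%E.

Lemma sqr_sum_le (k : nat) (f : 'I_k -> R) : (\sum_i f i) ^+ 2 <= k%:R * \sum_i f i ^+ 2.
Proof.
elim: k f => [|k IH] f; first by rewrite !big_ord0 expr0n mul0r.
rewrite !big_ord_recr/= -natr1.
set s := \sum_(i < k) _; set b := f ord_max; set q := \sum_(i < k) _ ^+ 2.
have h : s ^+ 2 <= k%:R * q := IH _.
have q0 : 0 <= q by apply: sumr_ge0 => i _; exact: sqr_ge0.
have [k0|k0] := eqVneq k 0%N.
  have -> : s = 0 by rewrite /s; move: (f) => f'; clear -k0; subst k; rewrite big_ord0.
  by rewrite k0 mulr0n !add0r mul1r lerDr.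
have kp : 0 < k%:R :> R by rewrite ltr0n lt0n.
have H2 : 2 * s * b <= q + k%:R * b ^+ 2.
  have e1 : 0 <= (s - k%:R * b) ^+ 2 := sqr_ge0 _.
  rewrite -(ler_pM2l kp); apply: (@le_trans _ _ (s ^+ 2 + (k%:R * b) ^+ 2)).
    by move: e1; rewrite sqrrB; lra.
  have -> : (k%:R * b) ^+ 2 = k%:R * (k%:R * b ^+ 2) by ring.
  by rewrite mulrDr; apply: lerD.
rewrite sqrrD mulrDl mulrDr mul1r; move: h H2; move: (k%:R * q) (k%:R * b ^+ 2) => A B.
rewrite mulr2n -mulr_natl; lra.
Qed.

Lemma sqr_sum_le_card (I : finType) (f : I -> R) :
  (\sum_i f i) ^+ 2 <= #|I|%:R * \sum_i f i ^+ 2.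
Proof.
have E (F : I -> R) : \sum_(k < #|I|) F (enum_val k) = \sum_i F i.
  by rewrite -(big_enum_val F); exact: eq_bigl.
by have := sqr_sum_le (fun k : 'I_#|I| => f (enum_val k)); rewrite !(E f) (E (fun i => f i ^+ 2)).
Qed.

Section box.
Variables (a b : 'rV[R]_n).
Hypothesis QO : obox a b `<=` Omega.
Let Q := obox a b.

(** Move one coordinate at a time: x + hk k has its first k coordinates already
    translated.  A box is a product of intervals, so every intermediate segment
    stays in it. *)
Lemma box_difference (h : 'rV[R]_n) (L : R) : (forall i, `|h ord0 i| <= L) ->
  (\int[mu]_(x in [set x | Q x /\ Q (x + h)%R]) ((U (x + h) - U x) ^+ 2)%:E <=
   (n%:R * L ^+ 2)%:E * energy_sum)%E.
Proof.
move=> hL.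
set D0 := [set x | _].
have oD0 : open D0.
  by apply: openI; [exact: open_obox|exact: open_shift (@open_obox _ _ a b)].
have mD0 : measurable D0 by exact: measurable_open.
pose hk (k : nat) : 'rV[R]_n := \row_j if (j < k)%N then h ord0 j else 0.
have hk0 : hk 0%N = 0 by apply/rowP => j; rewrite !mxE.
have hkn : hk n = h by apply/rowP => j; rewrite !mxE ltn_ord.
have hkS (k : 'I_n) : hk k.+1 = hk k + h ord0 k *: unitv k.
  apply/rowP => j; rewrite !mxE eqxx/= ltnS leq_eqVlt -val_eqE/=.
  by case: eqP => [e|] /=; rewrite ?mulr1 ?mulr0 ?addr0// e ltnn add0r; congr (h _ _); exact/val_inj.
pose d (k : 'I_n) x := U (x + hk k.+1) - U (x + hk k).
apply: (@le_trans _ _ (\int[mu]_(x in D0) (\sum_(k < n) (n%:R%:E * ((d k x) ^+ 2)%:E))))%E.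
  apply: ge0_le_integral => //.
  - by move=> x _; rewrite lee_fin sqr_ge0.
  - by apply: measurable_funTS; have := mUd h 0; congr (measurable_fun _ _); apply/funext => x; rewrite addr0.
  - apply: measurable_funTS; apply: emeasurable_sum => k _.
    by apply: emeasurable_funM => //; exact: mUd.
  move=> x _; under eq_bigr do rewrite -EFinM.
  rewrite sumEFin lee_fin -mulr_sumr.
  have -> : U (x + h) - U x = \sum_(k < n) d k x.
    rewrite /d -(big_mkord xpredT (fun k => U (x + hk k.+1) - U (x + hk k))).
    by rewrite telescope_sumr// hkn hk0 addr0.
  exact: sqr_sum_le.
rewrite ge0_integral_sum//; last 2 first.
- by move=> k; apply: measurable_funTS; apply: emeasurable_funM => //; exact: mUd.
- by move=> k x _; rewrite mule_ge0// lee_fin// sqr_ge0.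
rewrite /energy_sum ge0_sume_distrr; last first.
  by move=> k _; apply: integral_ge0 => x _; rewrite lee_fin sqr_ge0.
apply: lee_sum => k _.
rewrite ge0_integralZl//; last 2 first.
- by apply: measurable_funTS; exact: mUd.
- by move=> x _; rewrite lee_fin sqr_ge0.
rewrite EFinM -muleA lee_wpmul2l// ?lee_fin//.
pose Dk := [set y | D0 (y + - hk k)].
have -> : (\int[mu]_(x in D0) (d k x ^+ 2)%:E =
    \int[mu]_(y in Dk) ((U (y + h ord0 k *: unitv k) - U y) ^+ 2)%:E)%E.
  rewrite -(@ge0_integral_shift_set (hk k) Dk (fun y => ((U (y + h ord0 k *: unitv k) - U y) ^+ 2)%:E)).
  - have -> : [set x | Dk (x + hk k)] = D0.
      by apply/funext => x; rewrite /Dk /= addrK.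
    by apply: eq_integral => x _; rewrite /d hkS addrA.
  - by apply: measurable_open; exact: open_shift.
  - by have := mUd (h ord0 k *: unitv k) 0; congr (measurable_fun _ _); apply/funext => x; rewrite addr0.
  - by move=> x; rewrite lee_fin sqr_ge0.
apply: (@le_trans _ _ ((h ord0 k ^+ 2)%:E * \int[mu]_(x in Omega) (g k x ^+ 2)%:E)%E).
  apply: shift_estimate; first exact: open_shift.
  move=> y th [Qy Qyh] th01; apply: QO => j.
  have := Qy j; have := Qyh j; rewrite !mxE eqxx/=.
  have [->|jk] := eqVneq j k.
    rewrite ltnn subr0 mulr1; move: (y _ _) (h _ _) (a _ _) (b _ _) => y' h' a' b'.
    by move=> p1 p2; exact: line_between.
  rewrite mulr0 addr0; case: ifP => _.
    by rewrite subrK => + _.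
  by rewrite subr0.
apply: lee_wpmul2r; first by apply: integral_ge0 => x _; rewrite lee_fin sqr_ge0.
rewrite lee_fin -(real_normK (num_real (h ord0 k))) lerXn2r ?nnegrE//.
exact: (le_trans (normr_ge0 _) (hL k)).
Qed.

Lemma measurable_add_pair : measurable_fun [set: 'rV[R]_n * 'rV[R]_n]
  (fun p : 'rV[R]_n * 'rV[R]_n => p.1 + p.2).
Proof.
apply/measurable_fun_rVP => i.
rewrite (_ : _ \o _ = (rV_coord i \o fst) \+ (rV_coord i \o snd)).
  apply: measurable_funD.
    exact: measurableT_comp (measurable_rV_coord i) measurable_fst.
  exact: measurableT_comp (measurable_rV_coord i) measurable_snd.
by apply/funext => p; rewrite /rV_coord /= !mxE.
Qed.

Variable L : R.
Hypothesis abL : forall i, b ord0 i - a ord0 i <= L.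

(* The integrand of the double integral of (u(y) - u(x))^2 over the box. *)
Let F (x y : 'rV[R]_n) : \bar R := (\1_Q x * (\1_Q y * (U y - U x) ^+ 2))%:E.

Let F0 x y : (0 <= F x y)%E.
Proof.
rewrite /F lee_fin !indicE; apply: mulr_ge0 => //; apply: mulr_ge0 => //.
exact: sqr_ge0.
Qed.

Let mQ : measurable Q.
Proof. exact: measurable_obox. Qed.

(** Substituting y = x + h, only the h with |h_i| < L contribute, and each of
    them contributes at most the bound of [box_difference]. *)
Lemma box_double_integral :
  (\int[mu]_x \int[mu]_y F x y <=
    (n%:R * L ^+ 2)%:E * energy_sum * mu (obox (const_mx (- L)%R) (const_mx L)))%E.
Proof.
have m1Q : measurable_fun [set: 'rV[R]_n] (\1_Q : 'rV[R]_n -> R) by exact: measurable_indic.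
have mFh : measurable_fun [set: 'rV[R]_n * 'rV[R]_n]
    (fun p : 'rV[R]_n * 'rV[R]_n => F p.1 (p.1 + p.2)).
  apply/measurable_EFinP; apply: measurable_funM.
    exact: measurableT_comp m1Q measurable_fst.
  apply: measurable_funM; first exact: measurableT_comp m1Q measurable_add_pair.
  apply: measurable_funX; apply: measurable_funB.
    exact: measurableT_comp mU measurable_add_pair.
  exact: measurableT_comp mU measurable_fst.
have mFx x : measurable_fun [set: 'rV[R]_n] (F x).
  apply/measurable_EFinP; apply: measurable_funM => //; apply: measurable_funM => //.
  by apply: measurable_funX; exact: measurable_funB.
apply: (@le_trans _ _ (\int[mu]_x \int[mu]_h F x (x + h)%R)%E).
  rewrite le_eqVlt; apply/orP; left; apply/eqP.
  apply: eq_integral => x _; rewrite -(@ge0_integral_shift R n x (F x))//.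
  by apply: eq_integral => h _; rewrite addrC.
rewrite (fubini_tonelli (fun p => F p.1 (p.1 + p.2)) mFh)//=.
set B := obox (const_mx (- L)) (const_mx L).
have mB : measurable B by exact: measurable_obox.
have E0 : (0 <= energy_sum)%E.
  by apply: sume_ge0 => i _; apply: integral_ge0 => x _; rewrite lee_fin sqr_ge0.
apply: (@le_trans _ _ (\int[mu]_h ((n%:R * L ^+ 2)%:E * energy_sum * (\1_B h)%:E)))%E.
  apply: ge0_le_integral => //.
  - by move=> h _; exact: integral_ge0.
  - by apply: (measurable_fun_fubini_tonelli_G (fun p => F p.1 (p.1 + p.2)) mFh) => p; exact: F0.
  - by apply: emeasurable_funM => //; exact/measurable_EFinP/measurable_indic.
  move=> h _.
  have mD : measurable [set x | Q x /\ Q (x + h)].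
    apply: measurable_open; apply: openI; first exact: open_obox.
    exact: open_shift (@open_obox _ _ a b).
  have -> : (\int[mu]_x F x (x + h)%R =
      \int[mu]_(x in [set x | Q x /\ Q (x + h)%R]) ((U (x + h) - U x) ^+ 2)%:E)%E.
    rewrite [RHS]integral_mkcond; apply: eq_integral => x _; rewrite patchE /F !indicE.
    have [q1|q1] := pselect (Q x); last first.
      by rewrite (memNset q1) mul0r; case: ifPn => //; rewrite inE => -[].
    have [q2|q2] := pselect (Q (x + h)); last first.
      by rewrite (memNset q2) mul0r mulr0; case: ifPn => //; rewrite inE => -[].
    by rewrite (mem_set q1) (mem_set q2) !mul1r mem_set.
  have [Bh|nBh] := pselect (B h).
    rewrite indicE mem_set// mule1; apply: box_difference => i.
    by have := Bh i; rewrite !mxE -ltr_norml => /ltW.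
  rewrite (_ : [set x | _] = set0) ?integral_set0.
    by rewrite indicE memNset// mule0.
  apply/seteqP; split => // x [qx qxh]; apply: nBh => i.
  by have := qx i; have := qxh i; have := abL i; rewrite !mxE; lra.
rewrite ge0_integralZl//.
- by rewrite integral_indic// setIT.
- exact/measurable_EFinP/measurable_indic.
- by rewrite mule_ge0// lee_fin mulr_ge0// sqr_ge0.
Qed.

(** For fixed x, the integral over y in Q of (u(y) - u(x))^2 equals the integral
    of u^2 plus mu(Q) u(x)^2, because u has mean zero. *)
Lemma box_poincare : \int[mu]_(x in Q) u x = 0 ->
  (mu Q * \int[mu]_(x in Q) (u x ^+ 2)%:E <=
    (n%:R * L ^+ 2)%:E * energy_sum * mu (obox (const_mx (- L)%R) (const_mx L)))%E.
Proof.
move=> u0; apply: le_trans box_double_integral.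
have LQ : L2 Q u by exact: L2S Lu.
have fQ : (mu Q < +oo)%E by exact: lebesgue_rV_obox_fin.
have iQ := L2_integrable mQ fQ LQ.
have uE : (\int[mu]_(y in Q) (u y)%:E = 0)%E.
  by rewrite -[LHS]fineK ?integrable_fin_num// -/(Rintegral mu Q u) u0.
have mQu : measurable_fun Q u by case: LQ.
have -> : (mu Q * \int[mu]_(x in Q) (u x ^+ 2)%:E = \int[mu]_x (mu Q * (\1_Q x * U x ^+ 2)%:E))%E.
  rewrite [RHS]ge0_integralZl//; last 2 first.
  - apply/measurable_EFinP; apply: measurable_funM; first exact: measurable_indic.
    exact: measurable_funX.
  - by move=> x _; rewrite lee_fin mulr_ge0 ?sqr_ge0// indicE.
  congr (_ * _)%E; rewrite [LHS]integral_mkcond; apply: eq_integral => x _.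
  rewrite patchE indicE; case: ifPn => qx /=; last by rewrite mul0r.
  by rewrite mul1r /U patchE ifT// inE; apply: QO; rewrite inE in qx.
have m1Q : measurable_fun [set: 'rV[R]_n] (\1_Q : 'rV[R]_n -> R) by exact: measurable_indic.
have mF : measurable_fun [set: 'rV[R]_n * 'rV[R]_n]
    (fun p : 'rV[R]_n * 'rV[R]_n => F p.1 p.2).
  apply/measurable_EFinP; apply: measurable_funM.
    exact: measurableT_comp m1Q measurable_fst.
  apply: measurable_funM; first exact: measurableT_comp m1Q measurable_snd.
  apply: measurable_funX; apply: measurable_funB.
    exact: measurableT_comp mU measurable_snd.
  exact: measurableT_comp mU measurable_fst.
apply: ge0_le_integral => //.
- by move=> x _; rewrite mule_ge0// lee_fin mulr_ge0 ?sqr_ge0// indicE.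
- apply: emeasurable_funM => //; apply/measurable_EFinP.
  by apply: measurable_funM => //; exact: measurable_funX.
- by apply: (measurable_fun_fubini_tonelli_F (fun p => F p.1 p.2) mF) => p; exact: F0.
move=> x _; rewrite /F.
have [qx|qx] := pselect (Q x); last first.
  rewrite indicE (memNset qx) mul0r mule0; apply: integral_ge0 => y _.
  by rewrite mul0r.
rewrite indicE (mem_set qx) mul1r; set c := U x.
have -> : (\int[mu]_y (1 * (\1_Q y * (U y - c) ^+ 2))%:E =
    \int[mu]_(y in Q) (u y ^+ 2 + ((- (2 * c)) * u y + c ^+ 2))%:E)%E.
  rewrite [RHS]integral_mkcond; apply: eq_integral => y _.
  rewrite patchE indicE; case: ifPn => qy; last by rewrite mul0r mulr0.
  rewrite !mul1r /U patchE ifT; last by rewrite inE; apply: QO; rewrite inE in qy.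
  by congr EFin; ring.
have i2 := L2_sqr_integrable LQ.
have i1 : mu.-integrable Q (EFin \o (fun y => - (2 * c) * u y)).
  exact: (integrableZl mQ (- (2 * c)) iQ).
have i0 : mu.-integrable Q (EFin \o cst (c ^+ 2)).
  by apply: L2_integrable => //; exact: L2_cst.
have i01 := integrableD mQ i1 i0.
under eq_integral do rewrite EFinD.
rewrite integralD//=.
under [X in (_ + X)%E]eq_integral do rewrite EFinD.
rewrite (integralD mQ i1 i0)/=.
under [X in (_ + (X + _))%E]eq_integral do rewrite EFinM.
rewrite integralZl// uE mule0 add0e integral_cst// muleC leeDr//.
by apply: integral_ge0 => y _; rewrite lee_fin sqr_ge0.
Qed.

End box.
End poincare.

(** * Sublevel sets as Lipschitz epigraphs *)
Section epigraph.
Context {R : realType} {n : nat}.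
Implicit Types (F : 'rV[R]_n -> R) (x y e : 'rV[R]_n).

Lemma line_continuous x e : continuous (fun s : R => x + s *: e).
Proof.
move=> s0; apply/cvgrPdist_lt => r r0; near=> s.
rewrite opprD addrACA subrr add0r -scalerBl normrZ.
apply: (@le_lt_trans _ _ (`|s0 - s| * (`|e| + 1))).
  by rewrite ler_wpM2l// lerDl.
rewrite -ltr_pdivlMr ?ltr_wpDl//.
by near: s; apply: cvgr_dist_lt; [exact: cvg_id|rewrite divr_gt0// ltr_wpDl].
Unshelve. all: by end_near. Qed.

Lemma lipschitz_continuous F (K : R) :
  (forall x y, `|F x - F y| <= K * `|x - y|) -> continuous F.
Proof.
move=> FK x A /nbhs_ballP[r /= r0 hA]; apply/nbhs_ballP.
have K1 : 0 < `|K| + 1 by rewrite ltr_wpDl.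
exists (r / (`|K| + 1)); first by rewrite /= divr_gt0.
move=> y; rewrite -ball_normE /= => xy; apply: hA.
rewrite -ball_normE /=; apply: (le_lt_trans (FK x y)).
apply: (@le_lt_trans _ _ ((`|K| + 1) * `|x - y|)).
  by rewrite ler_wpM2r// (le_trans (ler_norm K))// lerDl.
by rewrite mulrC -ltr_pdivlMr.
Qed.

(** On each line of direction e, F is strictly decreasing and unbounded in both
    directions, so it vanishes at exactly one point x + gamma(x) e.  The rate c of
    the descent turns the Lipschitz constant of F into one for gamma. *)
Lemma epigraph_of_descent F e (K c : R) : 0 < c ->
  (forall x y, `|F x - F y| <= K * `|x - y|) ->
  (forall x s, 0 <= s -> F (x + s *: e) <= F x - c * s) ->
  exists gamma : 'rV[R]_n -> R, lipschitz gamma /\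
    forall x, F x < 0 <-> gamma (x - dotrv x e *: e) < dotrv x e.
Proof.
move=> c0 FK Fe.
have cF := lipschitz_continuous FK.
have cFe x : continuous (fun s : R => F (x + s *: e)).
  move=> s; apply: (@continuous_comp _ _ _ (fun s : R => x + s *: e) F).
    exact: line_continuous.
  exact: cF.
have Fe2 x s t : s <= t -> F (x + t *: e) <= F (x + s *: e) - c * (t - s).
  move=> st; have := Fe (x + s *: e) (t - s); rewrite subr_ge0 => /(_ st).
  by rewrite -addrA -scalerDl (_ : s + (t - s) = t)//; ring.
have zero x : exists s, F (x + s *: e) = 0.
  pose M := `|F x| / c.
  have M0 : 0 <= M by rewrite divr_ge0// ltW.
  have MN : - M <= M by rewrite (@le_trans _ _ 0)// oppr_le0.
  have h1 : F (x + M *: e) <= 0.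
    apply: (le_trans (Fe x M M0)); rewrite /M mulrC divfK ?gt_eqF//.
    by rewrite subr_le0 ler_norm.
  have h2 : 0 <= F (x + (- M) *: e).
    have N0 : - M <= 0 by rewrite oppr_le0.
    have := Fe2 x (- M) 0 N0; rewrite scale0r addr0 sub0r opprK /M.
    rewrite [c * _]mulrC divfK ?gt_eqF// lerBrDr; apply: le_trans.
    by rewrite -lerBlDr sub0r lerNl -normrN ler_norm.
  have [|s _ Hs] := @IVT R (fun s => F (x + s *: e)) _ _ 0 MN (continuous_subspaceT (cFe x)).
    by rewrite ge_min h1 orbT le_max h2.
  by exists s.
have [gamma hg] := choice zero.
have gP x t : F (x + t *: e) < 0 <-> gamma x < t.
  split => h.
    rewrite ltNge; apply/negP => tg; have := Fe2 x t (gamma x) tg.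
    rewrite hg; apply/negP; rewrite -ltNge subr_lt0 (lt_le_trans h)// mulr_ge0 ?(ltW c0)//.
    by rewrite subr_ge0.
  apply: (le_lt_trans (Fe2 x _ _ (ltW h))); rewrite hg sub0r oppr_lt0.
  by rewrite mulr_gt0// subr_gt0.
exists gamma; split; last first.
  move=> x; rewrite -gP subrK//.
(* If gamma x > gamma y, the descent from x + gamma(y) e to x + gamma(x) e is
   paid for by F (x + gamma(y) e) - F (y + gamma(y) e). *)
have half x y : gamma x - gamma y <= `|K| / c * `|x - y|.
  have [xy|yx] := leP (gamma x) (gamma y).
    rewrite (@le_trans _ _ 0)// ?subr_le0// mulr_ge0// divr_ge0// ltW//.
  have := Fe2 x _ _ (ltW yx); rewrite hg subr_ge0 => h.
  have h2 : c * (gamma x - gamma y) <= `|K| * `|x - y|.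
    apply: (@le_trans _ _ (F (x + gamma y *: e))); first exact: h.
    rewrite -[leLHS]subr0 -(hg y).
    apply: (le_trans (ler_norm _)); apply: (le_trans (FK _ _)).
    by rewrite opprD addrACA subrr addr0 ler_wpM2r// ler_norm.
  by rewrite -mulrAC ler_pdivlMr// mulrC.
exists (`|K| / c); split; first exact: num_real.
move=> M KM; move=> [x y] /= _.
apply: (@le_trans _ _ (`|K| / c * `|x - y|)); last by rewrite ler_wpM2r// ltW.
rewrite ler_norml half andbT lerNl opprB.
by have := half y x; rewrite distrC.
Qed.

(** Lipschitz bounds and a common rate of descent pass to the maximum of a
    finite family.  The element a0 witnesses that the family is not empty. *)
Lemma epigraph_of_family (T : finType) (a0 : T) (f : T -> 'rV[R]_n -> R) v (K : R) :
  (forall a x y, `|f a x - f a y| <= K * `|x - y|) ->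
  (forall a x s, 0 <= s -> f a (x + s *: v) <= f a x - s) ->
  v != 0 ->
  exists (e : 'rV[R]_n) (gamma : 'rV[R]_n -> R), [/\ dotrv e e = 1, lipschitz gamma &
    forall x, (forall a, f a x < 0) <-> gamma (x - dotrv x e *: e) < dotrv x e].
Proof.
move=> fK fv v0; pose F x := \big[Num.max/f a0 x]_a f a x.
have fF a x : f a x <= F x by exact: (le_bigmax _ (fun a => f a x) a).
have Fle x M : (forall a, f a x <= M) -> F x <= M.
  by move=> h; apply/bigmax_leP; split.
have FP x : F x < 0 <-> forall a, f a x < 0.
  split=> [h a|h]; first exact: le_lt_trans (fF a x) h.
  by apply/bigmax_ltP; split.
have FK x y : `|F x - F y| <= K * `|x - y|.
  have half x' y' : F x' - F y' <= K * `|x' - y'|.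
    rewrite lerBlDr; apply: Fle => a; rewrite -lerBlDr.
    have := fK a x' y'; have := fF a y'; have := ler_norm (f a x' - f a y').
    by move: (K * _) => z; lra.
  rewrite ler_norml half andbT lerNl opprB.
  by have := half y x; rewrite distrC.
have vv0 : 0 < dotrv v v.
  have [i vi] : exists i, v ord0 i != 0.
    apply: contrapT => /forallNP h; case/negP: v0; apply/eqP/rowP => i.
    by rewrite mxE; apply/eqP; have /negP := h i; rewrite negbK.
  rewrite /dotrv (bigD1 i)//= ltr_pwDl//.
    by rewrite -expr2 lt_neqAle eq_sym sqrf_eq0 vi sqr_ge0.
  by apply: sumr_ge0 => j _; rewrite -expr2 sqr_ge0.
pose c := (Num.sqrt (dotrv v v))^-1.
have c0 : 0 < c by rewrite invr_gt0 sqrtr_gt0.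
have Fe x s : 0 <= s -> F (x + s *: (c *: v)) <= F x - c * s.
  move=> s0; apply: Fle => a; rewrite scalerA.
  apply: (le_trans (fv a x _ _)); first by rewrite mulr_ge0// ltW.
  by rewrite mulrC lerB.
have [gamma [lg gP]] := epigraph_of_descent c0 FK Fe.
exists (c *: v), gamma; split => //; last first.
  by move=> x; rewrite -gP; exact: iff_sym (FP x).
rewrite /dotrv; under eq_bigr do rewrite !mxE mulrACA.
rewrite -mulr_sumr -/(dotrv v v) /c -expr2 exprVn sqr_sqrtr ?mulVf ?gt_eqF// ltW//.
Qed.

End epigraph.

(** * The domain *)
Section domain.
Context {R : realType} {n : nat}.
(* i0 is the direction of the row of boxes, il the direction in which the
   channels are thin. *)
Variables (i0 il : 'I_n) (N : nat).
Hypothesis i0l : i0 != il.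

Definition domain_length : R := 4 * N%:R + 2.
Definition side (i : 'I_n) : R := if i == i0 then domain_length else 1.
Definition channel_center (k : 'I_N) : R := 4 * (k : nat)%:R + 3.
(** The height allowed above the point t of the axis by the k-th channel: eps for
    |t - c| <= 1/2, with c the centre of the channel, then growing with slope 2
    and reaching the height 1 of the boxes at |t - c| = 1. *)
Definition ceiling (eps : R) (k : 'I_N) (t : R) : R :=
  Num.max eps (2 * `|t - channel_center k| - 1).

(** The boxes are the parts 4k < x_i0 < 4k + 2, at distance more than 1 from all
    the channel centres 4k + 3. *)
Definition dumbbell (eps : R) : set 'rV[R]_n :=
  [set x | (forall i, 0 < x ord0 i < side i) /\
           forall k, x ord0 il < ceiling eps k (x ord0 i0)].

Lemma side_ge1 i : 1 <= side i.
Proof.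
rewrite /side; case: ifP => // _; rewrite /domain_length.
have : 0 <= N%:R :> R by []. lra.
Qed.

Lemma side_il : side il = 1.
Proof. by rewrite /side eq_sym (negbTE i0l). Qed.

Lemma ceiling_ge eps k t : eps <= ceiling eps k t.
Proof. by rewrite /ceiling le_max lexx. Qed.

Lemma ceiling_lip eps k s t : ceiling eps k s <= ceiling eps k t + 2 * `|s - t|.
Proof.
rewrite /ceiling ge_max -lerBlDr le_max -[X in _ && X]lerBlDr le_max; apply/andP; split.
  by apply/orP; left; rewrite lerBlDr lerDl mulr_ge0.
apply/orP; right.
have := ler_distD t s (channel_center k).
by move: (`|s - t|) (`|t - _|) (`|s - _|) => p q r; lra.
Qed.

(** Near a point only one of two opposite walls matters.  [sg i] tells that the
    lower wall in direction i is kept rather than the upper one; this is what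
    allows all remaining constraints to decrease in one direction. *)
Definition facet (sg : 'I_n -> bool) (eps : R) (a : 'I_n + 'I_N) (x : 'rV[R]_n) : R :=
  match a with
  | inl i => if sg i then - x ord0 i else x ord0 i - side i
  | inr k => if sg il then - x ord0 il else x ord0 il - ceiling eps k (x ord0 i0)
  end.

(** Moving by one along the axis may lower the ceiling by 2.  Moving down by 3 at
    the same time still gains one unit on it, which is why the speed in direction
    il is 3. *)
Definition inward (sg : 'I_n -> bool) : 'rV[R]_n :=
  \row_i ((if sg i then 1 else -1) * (if i == il then 3 else 1)).

Lemma facet_lip sg eps a x y : `|facet sg eps a x - facet sg eps a y| <= 3 * `|x - y|.
Proof.
have hi i : `|x ord0 i - y ord0 i| <= `|x - y|.
  by have := coord_le_norm (x - y) i; rewrite !mxE.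
have d0 := normr_ge0 (x - y).
case: a => [i|k] /=; case: ifP => _; last first.
- have := hi il; have := hi i0.
  have := ceiling_lip eps k (x ord0 i0) (y ord0 i0).
  have := ceiling_lip eps k (y ord0 i0) (x ord0 i0).
  rewrite [`|y ord0 i0 - _|]distrC [in X in _ -> _ -> _ -> X -> _]ler_norml [in X in _ -> _ -> _ -> _ -> X]ler_norml.
  move: (ceiling _ _ _) (ceiling _ _ _) (`|x ord0 i0 - _|) (`|x - y|) => p q r d.
  lra.
- have := hi il; have -> : - x ord0 il - - y ord0 il = - (x ord0 il - y ord0 il) by ring.
  rewrite normrN; lra.
- have := hi i; have -> : x ord0 i - side i - (y ord0 i - side i) = x ord0 i - y ord0 i by ring.
  lra.
- have := hi i; have -> : - x ord0 i - - y ord0 i = - (x ord0 i - y ord0 i) by ring.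
  rewrite normrN; lra.
Qed.

Lemma facet_descent sg eps a x s : 0 <= s ->
  facet sg eps a (x + s *: inward sg) <= facet sg eps a x - s.
Proof.
move=> s0; case: a => [i|k] /=; rewrite !mxE.
  by case: (sg i); case: (i == il); lra.
rewrite eqxx (negbTE i0l); case: (sg il); first by lra.
have := ceiling_lip eps k (x ord0 i0) (x ord0 i0 + s * ((if sg i0 then 1 else -1) * 1)).
rewrite opprD addrA subrr sub0r normrN normrM ger0_norm//.
have -> : `|(if sg i0 then 1 else -1) * 1| = 1 :> R by case: (sg i0); rewrite mulr1 ?normrN normr1.
move: (ceiling _ _ _) (ceiling _ _ _) => p q; lra.
Qed.

Variable eps : R.
Hypothesis eps01 : 0 < eps < 1.

(** Any two opposite walls are at least eps apart, so the threshold eps / 2 leaves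
    at most one of them active near p.  If the floor in direction il is the active
    one, then y_il < eps, and the ceilings, which are never below eps, are
    automatically above y. *)
Lemma dumbbell_near (p : 'rV[R]_n) :
  let sg i := p ord0 i < eps / 2 in
  \forall y \near p, dumbbell eps y <-> forall a, facet sg eps a y < 0.
Proof.
move=> sg; have /andP[e0 e1] := eps01; near=> y.
have yp i : `|p ord0 i - y ord0 i| < eps / 2.
  apply: (@le_lt_trans _ _ `|p - y|).
    by have := coord_le_norm (p - y) i; rewrite !mxE.
  by near: y; apply: cvgr_dist_lt; [exact: cvg_id|rewrite divr_gt0//; case/andP: eps01].
have sT i : sg i -> y ord0 i < eps.
  by rewrite /sg => h; have := yp i; rewrite ltr_norml; lra.
have sF i : ~~ sg i -> 0 < y ord0 i.
  by rewrite /sg -leNgt => h; have := yp i; rewrite ltr_norml; lra.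
split.
  move=> [hy hc] [i|k] /=; case: ifP => _.
  - by rewrite oppr_lt0; case/andP: (hy i).
  - by rewrite subr_lt0; case/andP: (hy i).
  - by rewrite oppr_lt0; case/andP: (hy il).
  - by rewrite subr_lt0.
move=> h; split => [i|k].
  have := h (inl i); rewrite /=; have s1 := side_ge1 i; case: ifPn => [/sT hi|/sF hi] h1; apply/andP; split; lra.
have := h (inr k); rewrite /=; case: ifPn => [/sT hi _|_].
  exact: lt_le_trans hi (ceiling_ge _ _ _).
by rewrite subr_lt0.
Unshelve. all: by end_near. Qed.

Lemma inward_neq0 sg : inward sg != 0.
Proof.
apply/eqP => /rowP/(_ il); rewrite !mxE eqxx; case: (sg il); lra.
Qed.

Lemma dumbbell_lipschitz_boundary : lipschitz_boundary (dumbbell eps).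
Proof.
move=> p _ _; pose sg i := p ord0 i < eps / 2.
have [e [gamma [ee lg H]]] := epigraph_of_family (inl il)
  (facet_lip sg eps) (facet_descent sg eps) (inward_neq0 sg).
exists e, gamma; split => //.
have := dumbbell_near p; apply: filterS => y ->; exact: H.
Qed.

Lemma dumbbell_open : open (dumbbell eps).
Proof.
rewrite openE => p Op; pose sg i := p ord0 i < eps / 2.
have near_p := dumbbell_near p.
have fp : forall a, facet sg eps a p < 0 by apply/(nbhs_singleton near_p).
have near_f a : \forall y \near p, facet sg eps a y < 0.
  have cf := lipschitz_continuous (facet_lip sg eps a).
  exact: (cvgr_lt _ (cf p) _ (fp a)).
have near_all : \forall y \near p, forall a, a \in enum (('I_n + 'I_N)%type : finType) -> facet sg eps a y < 0.
  elim: (enum _) => [|a s IH]; first by apply: filterE.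
  apply: filterS2 (near_f a) IH => y h1 h2 b; rewrite inE => /orP[/eqP -> //|]; exact: h2.
by apply: filterS2 near_p near_all => y hy fy; apply/hy => a; apply: fy; rewrite mem_enum.
Qed.

Lemma dumbbell_sub_obox : dumbbell eps `<=` obox 0 (\row_i side i).
Proof. by move=> x [h _] i; have := h i; rewrite !mxE. Qed.

Lemma obox_bounded (a b : 'rV[R]_n) : bounded_set (obox a b).
Proof.
have [M [Mr hM]] := compact_bounded (@compact_cbox R n a b).
by exists M; split => // y My x /sub_obox_cbox; exact: hM.
Qed.

Lemma dumbbell_bounded : bounded_set (dumbbell eps).
Proof.
have [M [Mr hM]] := obox_bounded 0 (\row_i side i).
by exists M; split => // y My x /dumbbell_sub_obox; exact: hM.
Qed.

Lemma slab_sub_dumbbell (x : 'rV[R]_n) : (forall i, 0 < x ord0 i < side i) ->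
  x ord0 il < eps -> dumbbell eps x.
Proof. by move=> h xe; split => // k; exact: lt_le_trans xe (ceiling_ge _ _ _). Qed.

Lemma dumbbell_base : dumbbell eps (const_mx (eps / 2)).
Proof.
have /andP[e0 e1] := eps01; apply: slab_sub_dumbbell => [i|]; rewrite !mxE; last lra.
by have h := side_ge1 i; apply/andP; split; lra.
Qed.

Lemma segment_set_connected (x y : 'rV[R]_n) :
  connected [set z | exists2 s : R, 0 <= s <= 1 & z = x + s *: (y - x)].
Proof.
have -> : [set z | exists2 s : R, 0 <= s <= 1 & z = x + s *: (y - x)] =
   [set x + s *: (y - x) | s in `[0, 1]%classic].
  apply/seteqP; split => z /=.
    by case=> s s01 ->; exists s => //; rewrite in_itv.
  by case=> s; rewrite /= in_itv/= => s01 <-; exists s.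
apply: connected_continuous_connected; first exact: segment_connected.
by apply: continuous_subspaceT; exact: line_continuous.
Qed.

(** Lowering the coordinate x_il to at most eps / 2 stays in the domain and leads
    into the slab x_il < eps, which is convex. *)
Lemma dumbbell_connected : connected (dumbbell eps).
Proof.
have /andP[eps0 eps1] := eps01; pose z := const_mx (eps / 2) : 'rV[R]_n.
pose low (x : 'rV[R]_n) : 'rV[R]_n :=
  \row_i if i == il then Num.min (x ord0 il) (eps / 2) else x ord0 i.
pose seg (x y : 'rV[R]_n) := [set w | exists2 s : R, 0 <= s <= 1 & w = x + s *: (y - x)].
have seg0 x y : seg x y x by exists 0; rewrite ?lexx ?ler01// scale0r addr0.
have seg1 x y : seg x y y by exists 1; rewrite ?lexx ?ler01// scale1r addrC subrK.
pose P x := seg x (low x) `|` seg (low x) z.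
have e2 : 0 < eps / 2 < eps by apply/andP; split; lra.
have sub x : dumbbell eps x -> P x `<=` dumbbell eps.
  move=> [hx hc] w.
  have low_il : 0 < Num.min (x ord0 il) (eps / 2) < 1.
    have := hx il; rewrite side_il => /andP[h1 h2].
    by rewrite lt_min h1 gt_min h2/= andbT; case/andP: e2.
  case=> [[s s01 ->]|[s s01 ->]].
    split=> [i|k]; rewrite !mxE.
      case: eqP => [->|_]; last by rewrite subrr mulr0 addr0.
      have h := hx il; rewrite side_il in h *.
      by apply: line_between => //; rewrite [_ + (_ - _)]addrC subrK.
    rewrite eqxx (negbTE i0l) subrr mulr0 addr0.
    apply: le_lt_trans (hc k); rewrite gerDl mulr_ge0_le0//; first by case/andP: s01.
    by rewrite subr_le0 ge_min lexx.
  have zb i : 0 < eps / 2 < side i.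
    by have h := side_ge1 i; apply/andP; split; lra.
  apply: slab_sub_dumbbell => [i|]; rewrite !mxE.
    apply: line_between; rewrite ?[_ + (_ - _)]addrC ?subrK//.
    by case: eqP => // ->; rewrite side_il.
  rewrite eqxx; have lowe : 0 < Num.min (x ord0 il) (eps / 2) < eps.
    by rewrite gt_min; case/andP: e2 => _ ->; rewrite orbT andbT; case/andP: low_il.
  suff /andP[] : 0 < Num.min (x ord0 il) (eps / 2) + s * (eps / 2 - Num.min (x ord0 il) (eps / 2)) < eps by [].
  by apply: line_between => //; rewrite [_ + (_ - _)]addrC subrK.
have -> : dumbbell eps = \bigcup_(x in dumbbell eps) P x.
  apply/seteqP; split => [x Ox|y [x Ox]]; last exact: sub.
  by exists x => //; left.
apply: bigcup_connected => [|x Ox].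
  by exists z => x Ox; right; exact: seg1.
apply: connectedU; [by exists (low x); split| |]; exact: segment_set_connected.
Qed.

Lemma dumbbell_bounded_lipschitz_domain : bounded_lipschitz_domain (dumbbell eps).
Proof.
split; first by exists (const_mx (eps / 2)); exact: dumbbell_base.
- exact: dumbbell_open.
- exact: dumbbell_connected.
- exact: dumbbell_bounded.
- exact: dumbbell_lipschitz_boundary.
Qed.

End domain.

(** * Lower bound for the Laplace eigenvalues *)
Section pieces.
Context {R : realType} {n : nat}.
Notation mu := (@lebesgue_rV R n).

Lemma integral_cover (T : finType) (A : T -> set 'rV[R]_n) (Omega : set 'rV[R]_n)
    (f : 'rV[R]_n -> \bar R) : measurable Omega -> (forall a, measurable (A a)) ->
  (forall a, A a `<=` Omega) ->
  measurable_fun Omega f -> (forall x, 0 <= f x)%E ->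
  (forall x, Omega x -> exists a, A a x) ->
  (\int[mu]_(x in Omega) f x <= \sum_a \int[mu]_(x in A a) f x)%E.
Proof.
move=> mO mA AO mf f0 cover.
pose fA a := f \_ (A a).
have mfA a : measurable_fun [set: 'rV[R]_n] (fA a).
  apply: (iffLR (measurable_restrictT f (mA a))).
  exact: (measurable_funS mO (AO a) mf).
have fA0 a x : (0 <= fA a x)%E by rewrite /fA patchE; case: ifP.
have -> : (\sum_a \int[mu]_(x in A a) f x = \int[mu]_x \sum_a fA a x)%E.
  rewrite ge0_integral_sum//; apply: eq_bigr => a _.
  by rewrite [LHS]integral_mkcond.
rewrite [leLHS]integral_mkcond; apply: ge0_le_integral => //.
- by move=> x _; rewrite patchE; case: ifP.
- exact: (iffLR (measurable_restrictT f mO)).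
- exact: emeasurable_sum.
move=> x _; rewrite patchE; case: ifPn => [|_]; last exact: sume_ge0.
rewrite inE => /cover[a Aax]; rewrite (bigD1 a)//= {1}/fA patchE ifT ?inE//.
by rewrite leeDl// sume_ge0.
Qed.

Variables (Omega : set 'rV[R]_n).
Hypothesis oO : open Omega.
Hypothesis fO : (mu Omega < +oo)%E.
Variables (u : 'rV[R]_n -> R) (g : 'I_n -> 'rV[R]_n -> R).
Hypotheses (Lu : L2 Omega u) (Lg : forall i, L2 Omega (g i)).
Hypothesis (wg : forall i, is_weak_partial Omega i u (g i)).

Lemma energy_sum_ge (i : 'I_n) :
  (\int[mu]_(x in Omega) ((g i x) ^+ 2)%:E <= energy_sum Omega g)%E.
Proof.
rewrite /energy_sum (bigD1 i)//= leeDl// sume_ge0// => k _.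
by apply: integral_ge0 => x _; rewrite lee_fin sqr_ge0.
Qed.

(** u(x)^2 <= 2 (u(x + t e_i) - u(x))^2 + 2 u(x + t e_i)^2. *)
Lemma shifted_piece (i : 'I_n) (t : R) (D Q : set 'rV[R]_n) : open D -> open Q ->
  Q `<=` Omega -> (forall x, D x -> Q (x + t *: unitv i)) ->
  (forall x th, D x -> 0 <= th <= 1 -> Omega (x + (th * t) *: unitv i)) ->
  (\int[mu]_(x in D) (u x ^+ 2)%:E <=
    (2 * t ^+ 2)%:E * energy_sum Omega g + 2%:E * \int[mu]_(x in Q) (u x ^+ 2)%:E)%E.
Proof.
move=> oD oQ QO DQ DO.
have mO : measurable Omega by exact: measurable_open.
have mD : measurable D by exact: measurable_open.
have mQ : measurable Q by exact: measurable_open.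
have DsO : D `<=` Omega.
  by move=> x Dx; have := DO x 0 Dx; rewrite mul0r scale0r addr0; apply; rewrite lexx ler01.
pose U := u \_ Omega; pose v := t *: unitv i : 'rV[R]_n.
have mU : measurable_fun [set: 'rV[R]_n] U.
  by apply: (iffLR (measurable_restrictT u mO)); case: Lu.
have mUv : measurable_fun [set: 'rV[R]_n] (fun x => U (x + v)).
  exact: (measurableT_comp (f := U) mU (measurable_shift v)).
have mU2 : measurable_fun [set: 'rV[R]_n] (fun x => (U x ^+ 2)%:E).
  by apply/measurable_EFinP; exact: measurable_funX.
have mUv2 : measurable_fun [set: 'rV[R]_n] (fun x => (U (x + v) ^+ 2)%:E).
  by apply/measurable_EFinP; exact: measurable_funX.
have mUd : measurable_fun [set: 'rV[R]_n] (fun x => ((U (x + v) - U x) ^+ 2)%:E).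
  by apply/measurable_EFinP; apply: measurable_funX; exact: measurable_funB.
have UE (A : set 'rV[R]_n) : A `<=` Omega ->
    (\int[mu]_(x in A) (u x ^+ 2)%:E = \int[mu]_(x in A) (U x ^+ 2)%:E)%E.
  move=> AO; apply: eq_integral => x xA.
  by rewrite /U patchE ifT// inE; apply: AO; rewrite inE in xA.
rewrite !UE//.
apply: (@le_trans _ _ (\int[mu]_(x in D)
   (2%:E * ((U (x + v) - U x) ^+ 2)%:E + 2%:E * (U (x + v) ^+ 2)%:E))%E).
  apply: ge0_le_integral => //.
  - by move=> x _; rewrite lee_fin sqr_ge0.
  - exact: measurable_funTS.
  - apply: measurable_funTS; apply: emeasurable_funD; apply: measurable_funeM => //.
  move=> x _; rewrite -!EFinM -EFinD lee_fin.
  have := sqr_ge0 (U (x + v) + (U (x + v) - U x)).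
  set a := U (x + v); set b := U x => h.
  by rewrite -subr_ge0; apply: le_trans h _; rewrite le_eqVlt; apply/orP; left; apply/eqP; ring.
rewrite ge0_integralD//; last 4 first.
- by move=> x _; rewrite mule_ge0// lee_fin sqr_ge0.
- by apply: measurable_funTS; exact: measurable_funeM.
- by move=> x _; rewrite mule_ge0// lee_fin sqr_ge0.
- by apply: measurable_funTS; exact: measurable_funeM.
rewrite !ge0_integralZl//; last 4 first.
- exact: measurable_funTS.
- by move=> x _; rewrite lee_fin sqr_ge0.
- exact: measurable_funTS.
- by move=> x _; rewrite lee_fin sqr_ge0.
apply: leeD.
  rewrite EFinM -muleA lee_pmul2l//.
  apply: (le_trans (shift_estimate oO fO Lu Lg wg oD DO)).
  by apply: lee_wpmul2l; [rewrite lee_fin sqr_ge0|exact: energy_sum_ge].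
rewrite lee_pmul2l//.
rewrite -(@ge0_integral_shift_set _ _ v Q (fun x => (U x ^+ 2)%:E))//; last first.
  by move=> x; rewrite lee_fin sqr_ge0.
apply: ge0_subset_integral => //.
- by apply: measurable_preimage => //; exact: measurable_shift.
- exact: measurable_funTS.
- by move=> x _; rewrite lee_fin sqr_ge0.
Qed.

End pieces.

Section dumbbell_pieces.
Context {R : realType} {n : nat}.
Variables (i0 il : 'I_n) (N : nat).
Hypothesis i0l : i0 != il.
Notation mu := (@lebesgue_rV R n).

Definition slab (a b : R) : set 'rV[R]_n :=
  obox (\row_i if i == i0 then a else 0) (\row_i if i == i0 then b else 1).

Lemma slabE a b x : slab a b x <->
  a < x ord0 i0 < b /\ forall i, i != i0 -> 0 < x ord0 i < 1.
Proof.
split=> [h|[h0 h] i]; last first.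
  by rewrite !mxE; case: eqP => [->//|/eqP ne]; exact: h.
split; first by have := h i0; rewrite !mxE eqxx.
by move=> i ne; have := h i; rewrite !mxE (negbTE ne).
Qed.

Lemma measure_slab a b : a <= b -> mu (slab a b) = (b - a)%:E.
Proof.
move=> ab; rewrite /slab lebesgue_rV_obox; last first.
  by move=> i; rewrite !mxE; case: eqP => // _; exact: ler01.
congr EFin; rewrite (bigD1 i0)//= !mxE eqxx big1 ?mulr1// => i ne.
by rewrite !mxE (negbTE ne) subr0.
Qed.

Lemma natr_lt_gap (k l : nat) : (k < l)%N -> k%:R + 1 <= l%:R :> R.
Proof. by move=> kl; rewrite natr1 ler_nat. Qed.

Definition blob (k : nat) := slab (4 * k%:R) (4 * k%:R + 2).

Lemma side_gt0 (x : 'rV[R]_n) : 0 < x ord0 i0 < domain_length N ->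
  (forall i, i != i0 -> 0 < x ord0 i < 1) ->
  forall i, 0 < x ord0 i < side i0 N i.
Proof. by move=> h0 h i; rewrite /side; case: eqP => [->//|/eqP]; exact: h. Qed.

Lemma ceiling_far eps (l : 'I_N) (t : R) : 1 <= `|t - channel_center l| ->
  1 <= ceiling eps l t.
Proof. by move=> h; rewrite /ceiling le_max; apply/orP; right; lra. Qed.

Lemma blob_sub_dumbbell eps k : (k <= N)%N -> blob k `<=` dumbbell i0 il N eps.
Proof.
move=> kN x /slabE[/andP[h1 h2] h].
have k0 : 0 <= k%:R :> R by [].
have kN' : k%:R <= N%:R :> R by rewrite ler_nat.
split; first by apply: side_gt0 => //; rewrite /domain_length; apply/andP; split; lra.
have il0 : il != i0 by rewrite eq_sym.
move=> l; have /andP[_ x1] := h il il0.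
apply: lt_le_trans x1 _; apply: ceiling_far; rewrite /channel_center.
have [lk|kl] := ltnP l k.
  by have := natr_lt_gap lk => lk'; rewrite ger0_norm; lra.
have kl' : k%:R <= l%:R :> R by rewrite ler_nat.
by rewrite ler0_norm; lra.
Qed.

Definition direction (s : bool) : R := if s then 1 else -1.

(** The k-th channel is covered by two overlapping halves.  Measured from the
    centre in the direction of travel, each of them is the interval
    ]-1/2, 3/2[, which a translation by 3/2 carries to ]1, 3[, that is, to the
    next box ([s = true]) or to the previous one ([s = false]). *)
Definition bridge eps (s : bool) (k : 'I_N) : set 'rV[R]_n :=
  dumbbell i0 il N eps `&`
  slab (channel_center k - (if s then 1 / 2 else 3 / 2))
       (channel_center k + (if s then 3 / 2 else 1 / 2)).

Lemma dumbbell_slab eps (x : 'rV[R]_n) a b : dumbbell i0 il N eps x ->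
  a < x ord0 i0 < b -> slab a b x.
Proof.
move=> [h _] ab; apply/slabE; split => // i ne.
by have := h i; rewrite /side (negbTE ne).
Qed.

Lemma shift_coord (x : 'rV[R]_n) t i :
  (x + t *: unitv i0) ord0 i = x ord0 i + (if i == i0 then t else 0).
Proof. by rewrite !mxE eqxx /=; case: eqP => _; rewrite /= ?mulr1 ?mulr0. Qed.

Lemma bridge_to_blob eps s (k : 'I_N) x : bridge eps s k x ->
  blob (k + s) (x + (direction s * (3 / 2)) *: unitv i0).
Proof.
move=> [_ /slabE[/andP[h1 h2] h]]; apply/slabE; split; last first.
  by move=> i ne; rewrite shift_coord (negbTE ne) addr0; exact: h.
rewrite shift_coord eqxx natrD; rewrite /direction /channel_center in h1 h2 *.
by case: s h1 h2 => h1 h2; rewrite /= ?mulr1n ?mulr0n; apply/andP; split; lra.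
Qed.

(** Travelling away from the centre the ceiling can only rise, and on the
    part that is crossed before reaching the centre it has its minimal value
    eps. *)
Lemma bridge_path eps s (k : 'I_N) x th : 0 <= eps -> bridge eps s k x -> 0 <= th <= 1 ->
  dumbbell i0 il N eps (x + (th * (direction s * (3 / 2))) *: unitv i0).
Proof.
move=> eps0 [[hx hc] /slabE[/andP[h1 h2] h]] /andP[th0 th1].
have k0 : 0 <= (k : nat)%:R :> R by [].
have kN : (k : nat)%:R + 1 <= N%:R :> R by exact: natr_lt_gap.
split.
  apply: side_gt0; last first.
    by move=> i ne; rewrite shift_coord (negbTE ne) addr0; exact: h.
  rewrite shift_coord eqxx; rewrite /domain_length /direction /channel_center in h1 h2 *.
  by case: s h1 h2 => h1 h2; apply/andP; split; lra.
move=> l; rewrite !shift_coord eqxx eq_sym (negbTE i0l) addr0.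
have il0 : il != i0 by rewrite eq_sym.
have /andP[_ x1] := h il il0.
have [->|/eqP lk] := eqVneq l k.
  apply: lt_le_trans (hc k) _; rewrite /ceiling /channel_center ge_max le_max lexx/= le_max.
  rewrite /direction /channel_center in h1 h2 *.
  case: s h1 h2 => h1 h2; case: ler0P => d0; apply/orP.
  - by left; lra.
  - by right; rewrite ger0_norm; lra.
  - by right; rewrite ler0_norm; lra.
  - by left; lra.
apply: lt_le_trans x1 _; apply: ceiling_far.
have [lk'|kl] := ltnP l k.
  have := natr_lt_gap lk' => g.
  rewrite /direction /channel_center in h1 h2 *.
  by rewrite ger0_norm; case: s h1 h2 => h1 h2; lra.
have {}kl : (k < l)%N by rewrite ltn_neqAle kl andbT; apply/eqP => e; apply: lk; exact/val_inj.
have := natr_lt_gap kl => g.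
rewrite /direction /channel_center in h1 h2 *.
by rewrite ler0_norm; case: s h1 h2 => h1 h2; lra.
Qed.

Definition piece eps (a : 'I_N.+1 + 'I_N * bool) : set 'rV[R]_n :=
  match a with inl k => blob k | inr (k, s) => bridge eps s k end.

(** With k the integer part of x_i0 / 4.  The interface x_i0 = 4k between a
    channel and the next box belongs to no box; the previous bridge covers it. *)
Lemma dumbbell_cover eps x : dumbbell i0 il N eps x -> exists a, piece eps a x.
Proof.
move=> Ox; have [hx _] := Ox; have := hx i0; rewrite /side eqxx /domain_length => /andP[x0 xN].
set t := x ord0 i0 in x0 xN.
have /Num.Theory.trunc_itv/andP[] : 0 <= t / 4 by rewrite divr_ge0// ltW.
set k := Num.trunc _; rewrite -[k.+1%:R]natr1 => k1 k2.
have {}k1 : 4 * k%:R <= t by lra.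
have {}k2 : t < 4 * k%:R + 4 by lra.
have kN : (k < N.+1)%N.
  by rewrite -(ltr_nat R) -[N.+1%:R]natr1; lra.
have [c1|c1] := ltP t (4 * k%:R + 2).
  have [c2|c2] := ltP (4 * k%:R) t.
    exists (inl (Ordinal kN)); apply: dumbbell_slab Ox _.
    by rewrite /= -/t; apply/andP; split; lra.
  case: k k1 k2 kN c1 c2 => [|k] k1 k2 kN c1 c2; first by lra.
  rewrite -[k.+1%:R]natr1 in c1 c2 k1 k2.
  exists (inr (Ordinal (kN : (k < N)%N), true)); split => //; apply: dumbbell_slab Ox _.
  by rewrite /channel_center /= -/t; apply/andP; split; lra.
have kN' : (k < N)%N by rewrite -(ltr_nat R); lra.
have [c2|c2] := ltP t (4 * k%:R + 7 / 2).
  exists (inr (Ordinal kN', false)); split => //; apply: dumbbell_slab Ox _.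
  by rewrite /channel_center /= -/t; apply/andP; split; lra.
exists (inr (Ordinal kN', true)); split => //; apply: dumbbell_slab Ox _.
by rewrite /channel_center /= -/t; apply/andP; split; lra.
Qed.

End dumbbell_pieces.

Section laplace.
Context {R : realType} {n : nat}.
Variables (i0 il : 'I_n) (N : nat).
Hypothesis i0l : i0 != il.
Notation mu := (@lebesgue_rV R n).
Notation Omega := (@dumbbell R n i0 il N).

Lemma dumbbell_measure_fin eps : 0 < eps < 1 -> (mu (Omega eps) < +oo)%E.
Proof.
move=> eps01; apply: bounded_measure_fin (dumbbell_bounded _ _ _ _).
by apply: measurable_open; exact: dumbbell_open.
Qed.

Lemma energy_sum_fin (D : set 'rV[R]_n) (g : 'I_n -> 'rV[R]_n -> R) :
  (forall i, L2 D (g i)) -> exists2 e : R, 0 <= e & energy_sum D g = e%:E.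
Proof.
move=> Lg; exists (fine (energy_sum D g)).
  by rewrite fine_ge0// sume_ge0// => i _; apply: integral_ge0 => x _; rewrite lee_fin sqr_ge0.
by rewrite fineK//; apply/sum_fin_numP => i _ _; exact: L2_sqr_fin_num.
Qed.

(** Each box is controlled by its own Poincare inequality, each half channel by
    the box into which it can be translated.  All constants come from the boxes
    and from the length 3/2 of the translations, hence do not depend on eps. *)
Lemma dumbbell_poincare : exists2 C : R, 0 < C & forall eps u (g : 'I_n -> 'rV[R]_n -> R),
  0 < eps < 1 -> L2 (Omega eps) u -> (forall i, L2 (Omega eps) (g i)) ->
  (forall i, is_weak_partial (Omega eps) i u (g i)) ->
  (forall k, (k <= N)%N -> \int[mu]_(x in blob i0 k) u x = 0) ->
  (\int[mu]_(x in Omega eps) (u x ^+ 2)%:E <= C%:E * energy_sum (Omega eps) g)%E.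
Proof.
have [v v0 vE] : exists2 v : R, 0 <= v & mu (obox (const_mx (- 2)%R) (const_mx 2)) = v%:E.
  exists (fine (mu (obox (const_mx (- 2)%R) (const_mx 2)))); first exact: fine_ge0.
  by rewrite fineK// ge0_fin_numE// lebesgue_rV_obox_fin.
pose P : R := n%:R * 2 ^+ 2 * v / 2.
have P0 : 0 <= P by rewrite /P !mulr_ge0 ?sqr_ge0 ?invr_ge0.
(* P bounds a box.  A half channel costs 2 P for its box and 2 (3/2)^2 for the
   translation. *)
pose K : R := 3 * P + 9 / 2.
pose T : finType := ('I_N.+1 + 'I_N * bool)%type.
exists (K * #|T|%:R + 1).
  by rewrite ltr_wpDl ?mulr_ge0// /K; lra.
move=> eps u g eps01 Lu Lg wg mean0.
have oO := @dumbbell_open R n i0 il N eps eps01; have fO := dumbbell_measure_fin eps01.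
have [e e0 eE] := energy_sum_fin Lg.
have oB k : open (blob i0 k : set 'rV[R]_n) by exact: open_obox.
have mO : measurable (Omega eps) by exact: measurable_open.
have op (a : T) : open (piece i0 il eps a : set 'rV[R]_n).
  by case: a => [k|[k s]]; [exact: oB|apply: openI => //; exact: open_obox].
have blob_le k : (k <= N)%N -> (\int[mu]_(x in blob i0 k) (u x ^+ 2)%:E <= (P * e)%:E)%E.
  move=> kN.
  have BO := blob_sub_dumbbell i0l eps kN.
  have abL i : (\row_i (if i == i0 then 4 * k%:R + 2 else 1) : 'rV[R]_n) ord0 i -
      (\row_i (if i == i0 then 4 * k%:R else 0) : 'rV[R]_n) ord0 i <= 2.
    by rewrite !mxE; case: eqP => _; lra.
  have := box_poincare oO fO Lu Lg wg BO abL (mean0 k kN).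
  rewrite measure_slab; last by lra.
  rewrite vE eE -!EFinM -lee_pdivlMl; last by lra.
  move=> h; apply: le_trans h _; rewrite -EFinM lee_fin /P.
  rewrite [X in X^-1](_ : _ = 2); last by rewrite addrAC subrr add0r.
  by rewrite le_eqVlt; apply/orP; left; apply/eqP; field.
apply: (le_trans (@integral_cover _ _ T (piece i0 il eps) _ _ mO _ _ _ _ _)).
- by move=> a; exact: measurable_open.
- by case=> [k|[k s] x []//]; apply: blob_sub_dumbbell => //; rewrite -ltnS.
- by apply/measurable_EFinP; apply: measurable_funX; case: Lu.
- by move=> x; rewrite lee_fin sqr_ge0.
- by move=> x; exact: dumbbell_cover.
have pe (a : T) : (\int[mu]_(x in piece i0 il eps a) (u x ^+ 2)%:E <= (K * e)%:E)%E.
  have Pe0 : 0 <= P * e by rewrite mulr_ge0.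
  case: a => [k|[k s]] /=.
    apply: le_trans (blob_le k _) _; first by rewrite -ltnS.
    by rewrite lee_fin /K; nra.
  have ks : (k + s <= N)%N by have := ltn_ord k; case: s => h; rewrite ?addn1 ?addn0// ltnW.
  have := @shifted_piece R n _ oO fO u g Lu Lg wg i0 (direction s * (3 / 2))
     (bridge i0 il eps s k) (blob i0 (k + s)) (op (inr (k, s))) (oB _)
     (blob_sub_dumbbell i0l eps ks) (@bridge_to_blob _ _ _ _ _ _ _ _).
  move=> /(_ (fun x th Dx t01 => bridge_path i0l (ltW (andP eps01).1) Dx t01)) h.
  apply: le_trans h _; rewrite eE.
  apply: (@le_trans _ _ ((2 * (direction s * (3 / 2)) ^+ 2)%:E * e%:E + 2%:E * (P * e)%:E)%E).
    by rewrite leeD2l// lee_pmul2l// blob_le.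
  rewrite -!EFinM -EFinD lee_fin /K /direction.
  by case: s {ks}; rewrite !expr2; nra.
apply: (@le_trans _ _ (\sum_(a : T) (K * e)%:E)%E); first by apply: lee_sum => a _; exact: pe.
rewrite sumEFin eE -EFinM lee_fin sumr_const -[#|_|]/(#|T|) -mulr_natr.
by rewrite -subr_ge0 (_ : _ - _ = e)//; ring.
Qed.

(** Fewer linear conditions than unknowns. *)
Lemma exists_orthogonal (j m : nat) (M : 'M[R]_(j, m)) : (m < j)%N ->
  exists2 c : 'rV[R]_j, c != 0 & c *m M = 0.
Proof.
move=> mj; have /rowV0Pn[c /sub_kermxP cM c0] : kermx M != 0; last by exists c.
rewrite -mxrank_eq0 mxrank_ker -lt0n subn_gt0.
exact: leq_ltn_trans (rank_leq_col M) mj.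
Qed.

Lemma L2_sqnorm_gt0 (D : set 'rV[R]_n) u : measurable D -> L2 D u ->
  ~ {ae mu, forall x, D x -> u x = 0} -> 0 < L2_sqnorm D u.
Proof.
move=> mD Lu nae.
have fin := L2_sqr_fin_num Lu.
rewrite lt_def; apply/andP; split; last first.
  by apply: fine_ge0; apply: integral_ge0 => x _; rewrite lee_fin sqr_ge0.
apply/eqP => z; apply: nae.
have mu2 : measurable_fun D (fun x => (u x ^+ 2)%:E).
  by apply/measurable_EFinP; apply: measurable_funX; case: Lu.
have : (\int[mu]_(x in D) `|(u x ^+ 2)%:E| = 0)%E.
  under eq_integral do rewrite /= ger0_norm ?sqr_ge0//.
  by rewrite -[LHS]fineK// -/(Rintegral mu D (fun x => u x ^+ 2)) -/(L2_sqnorm D u) z.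
move/(ae_eq_integral_abs mu mD mu2); apply: filterS => x h Dx.
by have /eqP := h Dx; rewrite eqe sqrf_eq0 => /eqP.
Qed.

(** Any N + 2 functions have a nontrivial combination with mean zero on the
    N + 1 boxes, to which [dumbbell_poincare] applies. *)
Lemma laplace_lower_bound : exists2 c : R, 0 < c & forall eps j,
  0 < eps < 1 -> (N + 2 <= j)%N ->
  (c%:E <= minmax j (Omega eps) (H1 (Omega eps)) (grad_energy (Omega eps)))%E.
Proof.
have [C C0 HC] := dumbbell_poincare; exists C^-1; first by rewrite invr_gt0.
move=> eps j eps01 Nj; apply: le_ereal_inf_tmp => _ [w [Hw li] <-].
have oO := @dumbbell_open R n i0 il N eps eps01; have fO := dumbbell_measure_fin eps01.
have mO : measurable (Omega eps) by exact: measurable_open.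
have mB k : measurable (blob i0 k : set 'rV[R]_n) by exact: measurable_obox.
have [c c0 cM] := @exists_orthogonal j N.+1
  (\matrix_(l, k) \int[mu]_(x in blob i0 k) w l x) ltac:(by rewrite addn2 in Nj).
apply: (@le_trans _ _ ((grad_energy (Omega eps) (lincomb w c) /
    L2_sqnorm (Omega eps) (lincomb w c))%:E)); last first.
  by apply: ereal_sup_ubound; exists c.
set u := lincomb w c.
have Hu : H1 (Omega eps) u := H1_sum oO fO (fun l => c ord0 l) Hw.
have [Lu _] := Hu.
have hu i := weak_partialP (Hu.2 i).
have u0 : 0 < L2_sqnorm (Omega eps) u.
  by apply: L2_sqnorm_gt0 => // h; move/eqP: c0; apply; exact: li.
rewrite lee_fin ler_pdivlMr// -ler_pdivlMl ?invr_gt0// invrK.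
have := HC eps u (fun i => weak_partial (Omega eps) i u) eps01 Lu
  (fun i => (hu i).1) (fun i => (hu i).2).
have h k : (k <= N)%N -> \int[mu]_(x in blob i0 k) u x = 0.
  move=> kN; rewrite /u Rintegral_lincomb//; last first.
    move=> l; apply: integrableS (L2_integrable mO fO (Hw l).1) => //.
    exact: blob_sub_dumbbell.
  have /rowP/(_ (inord k)) := cM; rewrite !mxE => e.
  rewrite -[RHS]e; apply: eq_bigr => l _; rewrite mxE inordK//.
move=> /(_ h).
have -> : energy_sum (Omega eps) (fun i => weak_partial (Omega eps) i u) =
    (grad_energy (Omega eps) u)%:E.
  rewrite /energy_sum -ge0_integral_sum//; last 2 first.
  - by move=> i; apply/measurable_EFinP; apply: measurable_funX; case: (hu i).1.
  - by move=> i x _; rewrite lee_fin sqr_ge0.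
  rewrite /grad_energy /Rintegral.
  under eq_integral do rewrite sumEFin.
  rewrite fineK// ge0_fin_numE; last first.
    by apply: integral_ge0 => x _; rewrite lee_fin sumr_ge0// => i _; exact: sqr_ge0.
  have [e _ eE] := energy_sum_fin (fun i => (hu i).1).
  rewrite (_ : integral _ _ _ = e%:E) ?ltry// -eE /energy_sum -ge0_integral_sum//.
  - by apply: eq_integral => x _; rewrite sumEFin.
  - by move=> i; apply/measurable_EFinP; apply: measurable_funX; case: (hu i).1.
  - by move=> i x _; rewrite lee_fin sqr_ge0.
by rewrite -EFinM -[X in (X <= _)%E]fineK ?lee_fin//; exact: L2_sqr_fin_num.
Qed.

End laplace.

(** * Upper bound for the biharmonic eigenvalues *)
Section classical_hessian.
Context {R : realType} {n : nat}.
Notation mu := (@lebesgue_rV R n).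
Implicit Types (u : 'rV[R]_n -> R).

Lemma is_derive_lincomb (T : finType) (C : T -> R) (f df : T -> 'rV[R]_n -> R) x v :
  (forall t, is_derive x v (f t) (df t x)) ->
  is_derive x v (fun y => \sum_t C t * f t y) (\sum_t C t * df t x).
Proof.
move=> fdf; elim: (index_enum T) => [|t s IH].
  rewrite big_nil (_ : (fun _ => _) = cst 0); first exact: is_derive_cst.
  by apply/funext => y; rewrite big_nil.
rewrite big_cons (_ : (fun _ => _) = (C t \*: f t) \+ (fun y => \sum_(t <- s) C t * f t y)).
  by apply: is_deriveD; exact: is_deriveZ.
by apply/funext => y; rewrite big_cons.
Qed.

Lemma continuous_lincomb (T : finType) (C : T -> R) (f : T -> 'rV[R]_n -> R) :
  (forall t, continuous (f t)) -> continuous (fun y => \sum_t C t * f t y).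
Proof.
move=> cf; elim: (index_enum T) => [|t s IH].
  rewrite (_ : (fun _ => _) = cst 0); first exact: cst_continuous.
  by apply/funext => y; rewrite big_nil.
rewrite (_ : (fun _ => _) = (C t \*: f t) \+ (fun y => \sum_(t <- s) C t * f t y)).
  by move=> x; apply: continuousD; [apply: continuousZr; exact: cf|exact: IH].
by apply/funext => y; rewrite big_cons.
Qed.

Lemma partial_lincomb (T : finType) (C : T -> R) (f : T -> 'rV[R]_n -> R) i :
  (forall t x, derivable (f t) x (unitv i)) ->
  partial i (fun y => \sum_t C t * f t y) = (fun y => \sum_t C t * partial i (f t) y).
Proof.
move=> df; apply/funext => x.
have h := is_derive_lincomb (df := fun t => partial i (f t)) C (fun t => derivableP (df t x)).
by rewrite /partial; exact: (@derive_val _ _ _ _ _ _ _ h).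
Qed.

Lemma Ck_lincomb (T : finType) k (C : T -> R) (f : T -> 'rV[R]_n -> R) :
  (forall t, Ck k (f t)) -> Ck k (fun y => \sum_t C t * f t y).
Proof.
elim: k f => [|k IH] f Cf /=; first exact: continuous_lincomb.
split; first by apply: continuous_lincomb => t; case: (Cf t).
move=> i; have df t x : derivable (f t) x (unitv i) by have [_ /(_ i)[]] := Cf t.
split; first by move=> x; have [] := is_derive_lincomb (df := fun t => partial i (f t)) C (fun t => derivableP (df t x)).
by rewrite partial_lincomb//; apply: IH => t; have [_ /(_ i)[]] := Cf t.
Qed.

Lemma Ck_partial k u i : Ck k.+1 u -> Ck k (partial i u).
Proof. by move=> [_ /(_ i)[]]. Qed.

Lemma Ck_continuous k u : Ck k u -> continuous u.
Proof. by case: k => [//|k []]. Qed.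

Variables (Omega : set 'rV[R]_n).
Hypothesis oO : open Omega.
Variables (l r : 'rV[R]_n).
Hypothesis Olr : Omega `<=` cbox l r.

Let mO : measurable Omega.
Proof. exact: measurable_open. Qed.

Hypothesis fO : (mu Omega < +oo)%E.

Lemma L2_continuous u : continuous u -> L2 Omega u.
Proof.
move=> cu; have [C hC] := continuous_compact_bounded cu (@compact_cbox R n l r).
apply: (@L2_bounded _ _ _ _ C) => //.
  by apply: measurable_funTS; exact: measurable_continuous.
by move=> x /Olr; exact: hC.
Qed.

Lemma Ck_weak_partial k u i : Ck k.+1 u -> is_weak_partial Omega i u (partial i u).
Proof.
move=> [cu /(_ i)[du Cu]]; apply: classical_weak_partial => //.
  by case: k Cu => [//|k []].

Qed.

Lemma Ck_L2 k u : Ck k u -> L2 Omega u.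
Proof. by move/Ck_continuous; exact: L2_continuous. Qed.

Lemma Ck_weak_partialP k u i : Ck k.+1 u ->
  [/\ L2 Omega (weak_partial Omega i u), is_weak_partial Omega i u (weak_partial Omega i u) &
  {ae mu, forall x, Omega x -> weak_partial Omega i u x = partial i u x}].
Proof.
move=> Cu; have wi := Ck_weak_partial i Cu; have Li := Ck_L2 (Ck_partial i Cu).
have [h1 h2] := weak_partialP (ex_intro _ _ (conj Li wi)); split => //.
exact: weak_partial_unique h2 wi.
Qed.

Lemma Ck2_weak_second_partial u i j : Ck 2 u ->
  is_weak_partial Omega j (weak_partial Omega i u) (partial j (partial i u)).
Proof.
move=> Cu; have [h1 h2 h3] := Ck_weak_partialP i Cu; have Ci := Ck_partial i Cu.
apply: (is_weak_partial_ae oO (u := partial i u)) => //.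
- exact: Ck_L2 Ci.
- by apply: filterS h3 => x h Ox; rewrite h.
- exact: Ck_weak_partial Ci.
Qed.

Lemma Ck2_H2 u : Ck 2 u -> H2 Omega u.
Proof.
move=> Cu; split.
  split; first exact: Ck_L2 Cu.
  move=> i; exists (partial i u); split; last exact: Ck_weak_partial Cu.
  exact: Ck_L2 (Ck_partial i Cu).
move=> i; have [h1 h2 _] := Ck_weak_partialP i Cu.
split => // j; exists (partial j (partial i u)); split; last exact: Ck2_weak_second_partial.
exact: Ck_L2 (Ck_partial j (Ck_partial i Cu)).
Qed.

Lemma Ck2_weak_hessian u i j : Ck 2 u -> {ae mu, forall x, Omega x ->
  weak_partial Omega j (weak_partial Omega i u) x = partial j (partial i u) x}.
Proof.
move=> Cu; have w := Ck2_weak_second_partial i j Cu.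
have Lij := Ck_L2 (Ck_partial j (Ck_partial i Cu)).
have [h1 h2] := weak_partialP (ex_intro _ _ (conj Lij w)).
exact: weak_partial_unique h2 w.
Qed.

(** The weak second derivative is taken of a representative of the first one, so
    the almost everywhere uniqueness has to be used twice. *)
Lemma hessian_energy_classical u : Ck 2 u ->
  hessian_energy Omega u =
  \int[mu]_(x in Omega) \sum_i \sum_j partial j (partial i u) x ^+ 2.
Proof.
move=> Cu; rewrite /hessian_energy /Rintegral; congr fine.
have [_ Hw] := Ck2_H2 Cu.
apply: ae_eq_integral => //.
- apply/measurable_EFinP; apply: measurable_sum => i; apply: measurable_sum => j.
  by apply: measurable_funX; have [[]] := weak_partialP ((Hw i).2 j).
- apply/measurable_EFinP; apply: measurable_sum => i; apply: measurable_sum => j.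
  by apply: measurable_funX; have [] := Ck_L2 (Ck_partial j (Ck_partial i Cu)).
have : {ae mu, forall x, forall i j, Omega x ->
    weak_partial Omega j (weak_partial Omega i u) x = partial j (partial i u) x}.
  apply: filter_forall => i; apply: filter_forall => j; exact: Ck2_weak_hessian.
apply: filterS => x h Ox; congr EFin; apply: eq_bigr => i _; apply: eq_bigr => j _.
by rewrite h.
Qed.

End classical_hessian.

Section affine.
Context {R : realType} {n : nat}.
Notation mu := (@lebesgue_rV R n).
Implicit Types (p x : 'rV[R]_n).

Definition cube p (r : R) : set 'rV[R]_n := obox p (p + const_mx r).

Definition affine p (a0 : R) (a : 'I_n -> R) x : R :=
  a0 + \sum_i a i * (x ord0 i - p ord0 i).

Lemma affine_shift p a0 a x i t :
  affine p a0 a (x + t *: unitv i) = affine p a0 a x + t * a i.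
Proof.
rewrite /affine -addrA; congr (_ + _).
rewrite (bigD1 i)//= [in RHS](bigD1 i)//= !mxE !eqxx mulr1.
rewrite (eq_bigr (fun k => a k * (x ord0 k - p ord0 k))); first by ring.
by move=> k /negbTE ki; rewrite !mxE ki andbF mulr0 addr0.
Qed.

Lemma affine_continuous p a0 a : continuous (affine p a0 a).
Proof.
have h := @continuous_lincomb R n _ a (fun i (x : 'rV[R]_n) => x ord0 i - p ord0 i).
move=> x; apply: (@continuousD _ _ _ (cst a0) _ x); first exact: cst_continuous.
apply: h => i y; apply: (@continuousB _ _ _ (fun z : 'rV[R]_n => z ord0 i) (cst (p ord0 i)) y).
  exact: coord_continuous.
exact: cst_continuous.
Qed.

(** The L2 norm on a unit cube controls the coefficients of an affine function f:
    a_i is twice the difference f(x + e_i / 2) - f(x), which can be formed for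
    every x in the half-size cube, and a_0 is then recovered from f and the a_i. *)
Lemma affine_lower_bound : exists2 kappa : R, 0 < kappa & forall p a0 (a : 'I_n -> R),
  ((kappa * (a0 ^+ 2 + \sum_i a i ^+ 2))%:E <=
    \int[mu]_(x in cube p 1) (affine p a0 a x ^+ 2)%:E)%E.
Proof.
pose V : R := (1 / 2) ^+ n.
have V0 : 0 < V by rewrite exprn_gt0//; lra.
have muB p : mu (cube p (1 / 2)) = V%:E.
  rewrite /cube lebesgue_rV_obox; last by move=> i; rewrite !mxE; lra.
  congr EFin; rewrite (eq_bigr (fun=> 1 / 2)); first by rewrite prodr_const card_ord.
  by move=> i _; rewrite !mxE; lra.
pose D : R := 16 * n%:R + (n.+1)%:R * (1 + 16 * n%:R).
have D0 : 0 < D by rewrite /D -natr1; have : 0 <= n%:R :> R by []; nra.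
exists (V / D) => [|p a0 a]; first exact: divr_gt0.
set f := affine p a0 a; set Q := cube p 1; set B := cube p (1 / 2).
have mQ : measurable Q by exact: measurable_obox.
have mB : measurable B by exact: measurable_obox.
have BQ : B `<=` Q.
  by move=> x h i; have := h i; rewrite !mxE => /andP[h1 h2]; apply/andP; split; lra.
have cf : continuous f by exact: affine_continuous.
have mf : measurable_fun [set: 'rV[R]_n] f by exact: measurable_continuous.
have LQ : L2 Q f.
  have h := @L2_continuous R n Q (@open_obox R n _ _) p (p + const_mx 1) (@sub_obox_cbox R n p (p + const_mx 1)) (lebesgue_rV_obox_fin _ _) f cf.
  exact: h.
have [I I0 IE] : exists2 I : R, 0 <= I & (\int[mu]_(x in Q) (f x ^+ 2)%:E = I%:E)%E.
  exists (fine (\int[mu]_(x in Q) (f x ^+ 2)%:E)%E).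
    by rewrite fine_ge0// integral_ge0// => x _; rewrite lee_fin sqr_ge0.
  by rewrite fineK//; exact: L2_sqr_fin_num.
have mf2 (v : 'rV[R]_n) : measurable_fun [set: 'rV[R]_n] (fun x => (f (x + v) ^+ 2)%:E).
  apply/measurable_EFinP; apply: measurable_funX.
  exact: (measurableT_comp mf (measurable_shift v)).
have sub (v : 'rV[R]_n) : (forall x, B x -> Q (x + v)) ->
    (\int[mu]_(x in B) (f (x + v) ^+ 2)%:E <= I%:E)%E.
  move=> BvQ; rewrite -IE.
  rewrite -(@ge0_integral_shift_set _ _ v Q (fun x => (f x ^+ 2)%:E))//; last 2 first.
  - by have := mf2 0; congr (measurable_fun _ _); apply/funext => x; rewrite addr0.
  - by move=> x; rewrite lee_fin sqr_ge0.
  apply: ge0_subset_integral => //.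
  - by apply: measurable_preimage => //; exact: measurable_shift.
  - exact: measurable_funTS.
  - by move=> x _; rewrite lee_fin sqr_ge0.
have cst_int (c : R) : (\int[mu]_(x in B) c%:E = (c * V)%:E)%E.
  by rewrite -[LHS]/(\int[mu]_(x in B) cst c%:E x)%E integral_cst// EFinM; congr (_ * _)%E; exact: muB.
have ai i : V * a i ^+ 2 <= 16 * I.
  rewrite -lee_fin mulrC -cst_int.
  pose v := (1 / 2) *: unitv i : 'rV[R]_n.
  apply: (@le_trans _ _ (\int[mu]_(x in B) (8%:E * (f (x + v) ^+ 2)%:E +
      8%:E * (f (x + 0) ^+ 2)%:E))%E).
    apply: ge0_le_integral => //.
    - by move=> x _; rewrite lee_fin sqr_ge0.
    - by apply: measurable_funTS; apply: emeasurable_funD; apply: measurable_funeM.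
    move=> x _; rewrite -!EFinM -EFinD lee_fin addr0 /f affine_shift -/f.
    have := sqr_ge0 (f x + (f x + 1 / 2 * a i)).
    set b := f x => h.
    rewrite -subr_ge0; suff -> : 8 * (b + 1 / 2 * a i) ^+ 2 + 8 * b ^+ 2 - a i ^+ 2 =
      4 * (b + (b + 1 / 2 * a i)) ^+ 2 by rewrite mulr_ge0.
    by field.
  rewrite ge0_integralD//; last 4 first.
  - by move=> x _; rewrite mule_ge0// lee_fin sqr_ge0.
  - by apply: measurable_funTS; exact: measurable_funeM.
  - by move=> x _; rewrite mule_ge0// lee_fin sqr_ge0.
  - by apply: measurable_funTS; exact: measurable_funeM.
  rewrite !ge0_integralZl//; last 4 first.
  - exact: measurable_funTS.
  - by move=> x _; rewrite lee_fin sqr_ge0.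
  - exact: measurable_funTS.
  - by move=> x _; rewrite lee_fin sqr_ge0.
  have -> : (16 * I = 8 * I + 8 * I) by ring.
  rewrite (EFinD (8 * I) (8 * I)) (EFinM 8 I); apply: leeD; rewrite lee_pmul2l//; apply: sub => x h k.
    have := h k; rewrite !mxE eqxx /=; case: eqP => _ /andP[h1 h2]; apply/andP; split;
    rewrite ?mulr1 ?mulr0; lra.
  by rewrite addr0; exact: BQ.
have a0i : V * a0 ^+ 2 <= n.+1%:R * (I + V * \sum_i a i ^+ 2).
  rewrite -lee_fin mulrC -cst_int.
  apply: (@le_trans _ _ (\int[mu]_(x in B) (n.+1%:R%:E *
     ((f (x + 0) ^+ 2)%:E + (\sum_i a i ^+ 2)%:E)))%E).
    apply: ge0_le_integral => //.
    - by move=> x _; rewrite lee_fin sqr_ge0.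
    - by apply: measurable_funTS; apply: measurable_funeM; apply: emeasurable_funD.
    move=> x Bx; rewrite -EFinD -EFinM lee_fin addr0.
    (* a_0 written as a sum of n + 1 terms, for the Cauchy-Schwarz inequality. *)
    pose b (k : 'I_n.+1) : R := if unlift ord0 k is Some i then - (a i * (x ord0 i - p ord0 i)) else f x.
    have -> : a0 = \sum_k b k.
      rewrite big_ord_recl /b unlift_none (eq_bigr (fun i => - (a i * (x ord0 i - p ord0 i)))).
        by rewrite sumrN /f /affine; ring.
      by move=> i _; rewrite liftK.
    apply: le_trans (sqr_sum_le b) _; rewrite ler_pM2l ?ltr0n//.
    rewrite big_ord_recl {1}/b unlift_none lerD2l; apply: ler_sum => i _.
    rewrite /b liftK sqrrN exprMn ler_piMr ?sqr_ge0//.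
    by have := Bx i; rewrite !mxE => /andP[h1 h2]; nra.
  rewrite ge0_integralZl//; last 2 first.
  - by apply: measurable_funTS; exact: emeasurable_funD.
  - by move=> x _; rewrite -EFinD lee_fin addr_ge0 ?sqr_ge0// sumr_ge0// => i _; exact: sqr_ge0.
  rewrite EFinM lee_pmul2l ?lte_fin ?ltr0n//.
  rewrite ge0_integralD//; last 3 first.
  - by move=> x _; rewrite lee_fin sqr_ge0.
  - exact: measurable_funTS.
  - by move=> x _; rewrite lee_fin sumr_ge0// => i _; exact: sqr_ge0.
  rewrite EFinD; apply: leeD; first by apply: sub => x /BQ; rewrite addr0.
  by rewrite cst_int mulrC.
rewrite IE lee_fin mulrAC ler_pdivrMr// mulrDr.
have S : V * \sum_i a i ^+ 2 <= n%:R * (16 * I).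
  rewrite mulr_sumr; apply: le_trans (ler_sum _ (fun i _ => ai i)) _.
  by rewrite sumr_const card_ord -[_ *+ n]mulr_natl.
move: a0i S; set s := V * _; set t := V * _; rewrite /D -natr1.
have : 0 <= n%:R :> R by [].
by move: (n%:R : R) => m m0 h1 h2; nra.
Qed.

End affine.

Section trial_space.
Context {R : realType} {n : nat}.
Variables (i0 il : 'I_n) (N : nat).
Hypothesis i0l : i0 != il.
Notation mu := (@lebesgue_rV R n).
Notation Omega := (@dumbbell R n i0 il N).

(** Shifted by 4k, the cutoff is 1 on the k-th box, and it leaves the value 1, then
    reaches 0, within the parts |t - c| <= 1/2 of the two neighbouring
    channels. *)
Lemma smooth_cutoff : exists chi : R -> R, [/\ smooth chi,
  forall t, -1 / 2 <= t <= 5 / 2 -> chi t = 1 & forall t, ~~ (-1 < t < 3) -> chi t = 0].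
Proof.
have [S [sS S0 S1]] := @smooth_step R.
exists (fun t => S (2 * t + 2) * S (-2 * t + 6)); split.
- by apply: (smooth_mul (f := fun t => S (2 * t + 2)) (g := fun t => S (-2 * t + 6)));
    exact: smooth_affine.
- by move=> t /andP[h1 h2]; rewrite !S1 ?mulr1//; lra.
move=> t; rewrite negb_and -!leNgt => /orP[h|h]; first by rewrite S0 ?mul0r//; lra.
by rewrite mulrC S0 ?mul0r//; lra.
Qed.

Definition corner (k : nat) : 'rV[R]_n := (4 * k%:R) *: unitv i0.

Lemma cornerE k i : corner k ord0 i = if i == i0 then 4 * k%:R else 0.
Proof. by rewrite !mxE eqxx /=; case: eqP; rewrite /= ?mulr1 ?mulr0. Qed.

Lemma cubeE (p x : 'rV[R]_n) r i : cube p r x -> p ord0 i < x ord0 i < p ord0 i + r.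
Proof. by move=> /(_ i); rewrite [(p + _) _ _]mxE [const_mx _ _ _]mxE. Qed.

Lemma cube_sub_blob k : cube (corner k) 1 `<=` blob i0 k.
Proof.
move=> x h; apply/slabE; split.
  by have := cubeE i0 h; rewrite cornerE eqxx => /andP[h1 h2]; apply/andP; split; lra.
by move=> i /negbTE ne; have := cubeE i h; rewrite cornerE ne add0r.
Qed.

Variable chi : R -> R.
Hypothesis smooth_chi : smooth chi.
Hypothesis chi1 : forall t, -1 / 2 <= t <= 5 / 2 -> chi t = 1.
Hypothesis chi0 : forall t, ~~ (-1 < t < 3) -> chi t = 0.

(** [None] stands for the constant 1.  Coordinates are taken relative to the
    corner of the k-th box, so that the same estimate holds for all k. *)
Definition monomial (k : nat) (p : option 'I_n) (x : 'rV[R]_n) : R :=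
  if p is Some i then x ord0 i - corner k ord0 i else 1.

(** The product form gives smoothness for free. *)
Definition factor (k : nat) (p : option 'I_n) (i : 'I_n) (t : R) : R :=
  (if i == i0 then chi (t - 4 * k%:R) else 1) *
  (if p == Some i then t - corner k ord0 i else 1).

Definition localized k p := prodf (factor k p).

Lemma localizedE k p x : localized k p x = chi (x ord0 i0 - 4 * k%:R) * monomial k p x.
Proof.
rewrite /localized /prodf big_split /=; congr (_ * _).
  by rewrite (bigD1 i0)//= eqxx big1 ?mulr1// => i /negbTE ->.
case: p => [j|]; last by rewrite big1.
rewrite (bigD1 j)//= eqxx big1 ?mulr1// => i ij.
by rewrite ifF//; apply/negbTE; apply: contraNneq ij => -[->].
Qed.

Lemma smooth_factor k p i : smooth (factor k p i).
Proof.
apply: (smooth_mul (f := fun t => if i == i0 then chi (t - 4 * k%:R) else 1)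
  (g := fun t => if p == Some i then t - corner k ord0 i else 1)).
  case: eqP => _; last exact: smooth_cst.
  have := smooth_affine 1 (- (4 * k%:R)) smooth_chi; congr smooth.
  by apply/funext => t; rewrite mul1r.
case: eqP => _; last exact: smooth_cst.
by apply: smooth_sub; [exact: smooth_id|exact: smooth_cst].
Qed.

Lemma Ck_localized m k p : Ck m (localized k p).
Proof. by apply: Ck_prodf => j; exact: smooth_factor. Qed.

Lemma is_derive_linear_on_line (f : 'rV[R]_n -> R) x v (a b : R) :
  (forall h, f (h *: v + x) = a * h + b) -> is_derive x v f a.
Proof.
move=> fh; apply: (@is_derive_line _ _ _ (fun s => a * s + b) _ _ 0).
  by move=> h; rewrite addr0.
rewrite -[a in is_derive _ _ _ a]mulr1.
by apply: (@is_derive_affine R id 1 a b 0); exact: is_derive_id.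
Qed.

Lemma is_derive_monomial k p (c : R) x j :
  is_derive x (unitv j) (fun y => c * monomial k p y) (if p == Some j then c else 0).
Proof.
apply: (@is_derive_linear_on_line _ _ _ _ (c * monomial k p x)) => h.
case: p => [i|] /=; last by rewrite mul0r add0r.
rewrite !mxE eqxx /= -[Some i == Some j]/(i == j).
by case: (i == j); case: (i == i0); rewrite /= ?mulr1n ?mulr0n; ring.
Qed.

Lemma second_partial_locally_affine (f g : 'rV[R]_n -> R) (d : 'I_n -> R) x i j :
  (forall y i, is_derive y (unitv i) g (d i)) -> (\forall y \near x, f y = g y) ->
  partial j (partial i f) x = 0.
Proof.
move=> dg fg; rewrite /partial (@near_eq_derive _ _ _ _ (cst (d i))); last first.
  have := nbhs_interior fg; apply: filterS => y hy.
  rewrite (@near_eq_derive _ _ _ f g)//.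
  exact: (@derive_val _ _ _ _ _ _ _ (dg y i)).
by rewrite derive_cst.
Qed.

Lemma near_coord (x : 'rV[R]_n) i (a b : R) : a < x ord0 i < b ->
  \forall y \near x, a < (y : 'rV[R]_n) ord0 i < b.
Proof.
move=> /andP[ax xb]; have cx := @coord_continuous R 1 n ord0 i x.
apply: filterS2 (cvgr_gt _ cx _ ax) (cvgr_lt _ cx _ xb) => y -> -> //.
Qed.

(** Away from the narrow parts of the channels the cutoff is locally constant,
    equal to 0 or to 1. *)
Lemma localized_near_affine k p (x : 'rV[R]_n) : (k <= N)%N -> 0 < x ord0 i0 < domain_length N ->
  (forall l : 'I_N, 1 / 2 < `|x ord0 i0 - channel_center l|) ->
  exists c : R, \forall y \near x, localized k p y = c * monomial k p y.
Proof.
move=> kN /andP[x0 xL] far; rewrite /domain_length in xL.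
have finish (a b c : R) : a < x ord0 i0 < b ->
    (forall t, a < t < b -> chi (t - 4 * k%:R) = c) ->
    exists c : R, \forall y \near x, localized k p y = c * monomial k p y.
  move=> xab hc; exists c; apply: filterS (near_coord xab) => y yab.
  by rewrite localizedE hc.
set t := x ord0 i0 in x0 xL far finish *.
have [h1|h1] := ltP t (4 * k%:R - 1).
  apply: (finish (t - 1) (4 * k%:R - 1) 0) => [|s /andP[_ s1]].
    by apply/andP; split; lra.
  by apply: chi0; rewrite negb_and -!leNgt; apply/orP; left; lra.
have [h2|h2] := ltP (4 * k%:R + 3) t.
  apply: (finish (4 * k%:R + 3) (t + 1) 0) => [|s /andP[s1 _]].
    by apply/andP; split; lra.
  by apply: chi0; rewrite negb_and -!leNgt; apply/orP; right; lra.
have h3 : 4 * k%:R - 1 / 2 < t.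
  rewrite ltNge; apply/negP => h.
  case: k kN h h1 h2 {finish} => [|k] kN h h1 h2; first by lra.
  rewrite -[k.+1%:R]natr1 in h h1 h2.
  by have := far (Ordinal kN); rewrite /channel_center /= ltNge ler_norml => /negP; apply;
    apply/andP; split; lra.
have h4 : t < 4 * k%:R + 5 / 2.
  rewrite ltNge; apply/negP => h.
  have kN' : (k < N)%N by rewrite -(ltr_nat R); lra.
  by have := far (Ordinal kN'); rewrite /channel_center /= ltNge ler_norml => /negP; apply;
    apply/andP; split; lra.
apply: (finish (4 * k%:R - 1 / 2) (4 * k%:R + 5 / 2) 1) => [|s /andP[s1 s2]].
  by rewrite h3.
by apply: chi1; apply/andP; split; lra.
Qed.

(** A point of height at least eps cannot lie in the narrow part of a
    channel. *)
Lemma second_partial_localized eps k p x i j : (k <= N)%N -> 0 < eps -> Omega eps x ->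
  eps <= x ord0 il -> partial j (partial i (localized k p)) x = 0.
Proof.
move=> kN eps0 [hx hc] xe.
have hx0 := hx i0; rewrite /side eqxx in hx0.
have [|c hc'] := @localized_near_affine k p x kN hx0.
  move=> l; rewrite ltNge; apply/negP => h; have := hc l.
  by rewrite ltNge => /negP; apply; rewrite /ceiling ge_max xe/=; lra.
by apply: second_partial_locally_affine hc'; move=> y m; exact: is_derive_monomial.
Qed.

Lemma localized_cube k k' p x : cube (corner k) 1 x ->
  localized k' p x = if k' == k then monomial k p x else 0.
Proof.
move=> /cube_sub_blob/slabE[/andP[h1 h2] _]; rewrite localizedE.
case: eqP => [->|/eqP kk'].
  by rewrite chi1 ?mul1r//; apply/andP; split; lra.
rewrite chi0 ?mul0r// negb_and -!leNgt; apply/orP.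
move: kk'; rewrite neq_ltn => /orP[/(natr_lt_gap (R := R)) g|/(natr_lt_gap (R := R)) g].
  by right; lra.
by left; lra.
Qed.

Notation T := ('I_N.+1 * 'I_n.+1)%type.

(** The index [ord0] stands for the constant 1, [lift ord0 i] for the i-th
    coordinate. *)
Definition trial_function (t : T) : 'rV[R]_n -> R := localized t.1 (unlift ord0 t.2).

Definition trial_comb (C : T -> R) (x : 'rV[R]_n) : R := \sum_t C t * trial_function t x.

Lemma Ck_trial_comb m C : Ck m (trial_comb C).
Proof. by apply: Ck_lincomb => t; exact: Ck_localized. Qed.

(** On the k-th cube the cutoffs of the other boxes vanish. *)
Lemma trial_comb_cube C (k : 'I_N.+1) x : cube (corner k) 1 x ->
  trial_comb C x = affine (corner k) (C (k, ord0)) (fun i => C (k, lift ord0 i)) x.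
Proof.
move=> xk; rewrite /trial_comb.
rewrite (eq_bigr (fun t : T => C (t.1, t.2) * trial_function (t.1, t.2) x)); last by case.
rewrite -(pair_bigA _ (fun k' p => C (k', p) * trial_function (k', p) x))/=.
rewrite (bigD1 k)//= [X in _ + X]big1 ?addr0; last first.
  move=> k' kk'; rewrite big1// => p _; rewrite /trial_function (localized_cube _ _ xk)/=.
  by rewrite ifF ?mulr0//; exact: negbTE.
rewrite big_ord_recl /trial_function/= !(localized_cube _ _ xk) eqxx unlift_none/= mulr1.
congr (_ + _); apply: eq_bigr => i _.
by rewrite (localized_cube _ _ xk) eqxx liftK.
Qed.

(** Each of the N + 1 cubes bounds the coefficients of its own box; summing these
    bounds costs the factor N + 1. *)
Lemma trial_comb_lower_bound : exists2 kappa : R, 0 < kappa & forall eps C, 0 < eps < 1 ->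
  kappa * (\sum_t C t ^+ 2) <= L2_sqnorm (Omega eps) (trial_comb C).
Proof.
have [kappa k0 hk] := @affine_lower_bound R n.
exists (kappa / N.+1%:R) => [|eps C eps01]; first by rewrite divr_gt0.
have oO := @dumbbell_open R n i0 il N eps eps01; have fO := @dumbbell_measure_fin R n i0 il N eps eps01.
have mO : measurable (Omega eps) by exact: measurable_open.
have subO : Omega eps `<=` cbox 0 (\row_i side i0 N i).
  by move=> x /dumbbell_sub_obox; exact: sub_obox_cbox.
have Lu : L2 (Omega eps) (trial_comb C).
  exact: (L2_continuous oO subO fO (Ck_continuous (Ck_trial_comb 0 C))).
have fin := L2_sqr_fin_num Lu.
have one (k : 'I_N.+1) : kappa * (\sum_p C (k, p) ^+ 2) <= L2_sqnorm (Omega eps) (trial_comb C).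
  rewrite -lee_fin /L2_sqnorm /Rintegral fineK// big_ord_recl.
  apply: (le_trans (hk (corner k) _ _)).
  rewrite [leLHS](eq_integral (fun x => (trial_comb C x ^+ 2)%:E)); last first.
    by move=> x; rewrite inE => xk; rewrite (trial_comb_cube _ xk).
  apply: ge0_subset_integral => //.
  - exact: measurable_obox.
  - by apply/measurable_EFinP; apply: measurable_funX; case: Lu.
  - by move=> x _; rewrite lee_fin sqr_ge0.
  - apply: subset_trans (@cube_sub_blob k) _; apply: blob_sub_dumbbell => //.
    by rewrite -ltnS.
rewrite (eq_bigr (fun t : T => C (t.1, t.2) ^+ 2)); last by case.
rewrite -(pair_bigA _ (fun k p => C (k, p) ^+ 2))/= mulrAC ler_pdivrMr// mulr_sumr.
apply: le_trans (ler_sum _ (fun k _ => one k)) _.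
by rewrite sumr_const card_ord -[_ *+ N.+1]mulr_natr.
Qed.

(** The second derivatives are bounded independently of eps and vanish outside
    the slab x_il < eps, whose volume is eps times a constant. *)
Lemma hessian_upper_bound : exists2 K : R, 0 <= K & forall eps C, 0 < eps < 1 ->
  hessian_energy (Omega eps) (trial_comb C) <= K * eps * (\sum_t C t ^+ 2).
Proof.
pose top : 'rV[R]_n := \row_i side i0 N i.
have [B hB] : exists B : R, forall (t : T) i j x, cbox 0 top x ->
    `|partial j (partial i (trial_function t)) x| <= B.
  have bd (q : T * 'I_n * 'I_n) : exists B : R, forall x, cbox 0 top x ->
      `|partial q.2 (partial q.1.2 (trial_function q.1.1)) x| <= B.
    apply: continuous_compact_bounded; last exact: compact_cbox.
    have := Ck_localized 2 q.1.1.1 (unlift ord0 q.1.1.2).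
    by move/(Ck_partial q.1.2)/(Ck_partial q.2).
  have [b hb] := choice bd; exists (\sum_q `|b q|) => t i j x xb.
  apply: le_trans (hb (t, i, j) x xb) _; apply: le_trans (ler_norm _) _.
  by rewrite (bigD1 (t, i, j))//= lerDl sumr_ge0.
pose D : R := \prod_(i | i != il) side i0 N i.
have D0 : 0 <= D by apply: prodr_ge0 => i _; apply: le_trans (side_ge1 _ _ _).
have [c c0 cE] : exists2 c : R, 0 <= c & c = n%:R * (n%:R * (#|{: T}|%:R * B ^+ 2)).
  exists (n%:R * (n%:R * (#|{: T}|%:R * B ^+ 2))) => //.
  by do 3!(apply: mulr_ge0; first exact: ler0n); exact: sqr_ge0.
exists (c * D) => [|eps C eps01]; first exact: mulr_ge0.
have oO := @dumbbell_open R n i0 il N eps eps01; have fO := @dumbbell_measure_fin R n i0 il N eps eps01.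
have mO : measurable (Omega eps) by exact: measurable_open.
have /andP[eps0 eps1] := eps01.
have subO : Omega eps `<=` cbox 0 top by move=> x /dumbbell_sub_obox; exact: sub_obox_cbox.
rewrite (hessian_energy_classical oO subO fO (Ck_trial_comb 2 C)).
set S := \sum_t C t ^+ 2.
have S0 : 0 <= S by apply: sumr_ge0 => t _; exact: sqr_ge0.
have partialE i j : partial j (partial i (trial_comb C)) =
    (fun x => \sum_t C t * partial j (partial i (trial_function t)) x).
  have C2 (t : T) := Ck_localized 2 t.1 (unlift ord0 t.2).
  rewrite /trial_comb partial_lincomb; last by move=> t; case: (C2 t) => _ /(_ i)[].
  by rewrite partial_lincomb// => t; case: (Ck_partial i (C2 t)) => _ /(_ j)[].
pose thin : set 'rV[R]_n := obox 0 (\row_i if i == il then eps else side i0 N i).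
have mthin : measurable thin by exact: measurable_obox.
have muthin : mu thin = (eps * D)%:E.
  rewrite /thin lebesgue_rV_obox; last first.
    move=> i; rewrite !mxE; case: ifP => _; first exact: ltW.
    by apply: le_trans (side_ge1 _ _ _).
  congr EFin; rewrite (bigD1 il)//= !mxE eqxx subr0; congr (_ * _).
  by apply: eq_bigr => i /negbTE ne; rewrite !mxE ne subr0.
have pt x : Omega eps x -> \sum_i \sum_j partial j (partial i (trial_comb C)) x ^+ 2 <=
    (c * S) * \1_thin x.
  move=> Ox; have [xe|xe] := ltP (x ord0 il) eps; last first.
    rewrite big1 ?mulr_ge0// => i _.
    rewrite big1// => j _; rewrite partialE big1 ?expr0n// => t _.
    rewrite /trial_function (second_partial_localized _ _ _ _ eps0 Ox xe) ?mulr0//.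
    by rewrite -ltnS.
  rewrite indicE mem_set; last first.
    move=> i; have [hx _] := Ox; have := hx i; rewrite !mxE; case: eqP => [->|_ //].
    by case/andP => ->.
  have pij i j : partial j (partial i (trial_comb C)) x ^+ 2 <= #|{: T}|%:R * (B ^+ 2 * S).
    rewrite partialE; apply: le_trans (sqr_sum_le_card _) _.
    rewrite ler_wpM2l// mulr_sumr; apply: ler_sum => t _; rewrite exprMn mulrC.
    rewrite ler_wpM2r ?sqr_ge0// -[leLHS]real_normK ?num_real//.
    have := hB t i j x (subO x Ox); set z := `|_| => hz.
    have z0 : 0 <= z by exact: normr_ge0.
    by rewrite !expr2 ler_pM.
  rewrite mulr1 cE.
  apply: (@le_trans _ _ (\sum_(i < n) \sum_(j < n) #|{: T}|%:R * (B ^+ 2 * S))).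
    by apply: ler_sum => i _; apply: ler_sum => j _; exact: pij.
  rewrite sumr_const sumr_const card_ord -mulrnA -[_ *+ (n * n)]mulr_natl natrM.
  by move: (#|_|%:R : R) (n%:R : R) => q m; rewrite -!mulrA.
have mP : measurable_fun (Omega eps) (fun x => (\sum_i \sum_j partial j (partial i (trial_comb C)) x ^+ 2)).
  apply: measurable_sum => i; apply: measurable_sum => j; apply: measurable_funX.
  have := Ck_partial j (Ck_partial i (Ck_trial_comb 2 C)) => /Ck_continuous cp.
  by apply: measurable_funTS; exact: measurable_continuous.
have bound : (\int[mu]_(x in Omega eps) (\sum_i \sum_j partial j (partial i (trial_comb C)) x ^+ 2)%:E
    <= (c * S * (eps * D))%:E)%E.
  apply: (@le_trans _ _ (\int[mu]_(x in Omega eps) ((c * S)%:E * (\1_thin x)%:E))%E).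
    apply: ge0_le_integral => //.
    - by move=> x _; rewrite lee_fin sumr_ge0// => i _; apply: sumr_ge0 => j _; exact: sqr_ge0.
    - exact/measurable_EFinP.
    - apply: measurable_funeM; apply/measurable_EFinP; apply: measurable_funTS.
      exact: measurable_indic.
  rewrite ge0_integralZl//; last 2 first.
  - by apply/measurable_EFinP; apply: measurable_funTS; exact: measurable_indic.
  - by rewrite lee_fin mulr_ge0.
  rewrite integral_indic// [leRHS]EFinM lee_wpmul2l ?lee_fin ?mulr_ge0//.
  by rewrite -muthin; apply: le_measure => //; rewrite inE//; exact: measurableI.
rewrite (_ : c * D * eps * S = c * S * (eps * D)); last by ring.
rewrite -lee_fin /Rintegral fineK//.
rewrite ge0_fin_numE; first exact: le_lt_trans bound (ltry _).
by apply: integral_ge0 => x _; rewrite lee_fin sumr_ge0// => i _; apply: sumr_ge0 => j _; exact: sqr_ge0.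
Qed.

End trial_space.

Section biharmonic.
Context {R : realType} {n : nat}.
Variables (i0 il : 'I_n) (N : nat).
Hypothesis i0l : i0 != il.
Notation mu := (@lebesgue_rV R n).
Notation Omega := (@dumbbell R n i0 il N).

(** The first j trial functions; coefficients are extended by zero to all of
    them. *)
Lemma biharmonic_upper_bound : exists2 K : R, 0 <= K & forall eps j,
  0 < eps < 1 -> (j <= (N + 1) * (n + 1))%N ->
  (minmax j (Omega eps) (H2 (Omega eps)) (hessian_energy (Omega eps)) <= (K * eps)%:E)%E.
Proof.
have [chi [schi chi1 chi0]] := @smooth_cutoff R.
have [kappa k0 lower] := trial_comb_lower_bound N i0l schi chi1 chi0.
have [K K0 upper] := @hessian_upper_bound R n i0 il N chi schi chi1 chi0.
exists (K / kappa) => [|eps j eps01 jN]; first by rewrite divr_ge0// ltW.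
pose T : finType := ('I_N.+1 * 'I_n.+1)%type.
have jT : (j <= #|T|)%N by rewrite card_prod !card_ord; rewrite !addn1 in jN.
pose e (l : 'I_j) : T := enum_val (widen_ord jT l).
have e_inj : injective e by move=> l l' /enum_val_inj/(congr1 val)/= h; exact/val_inj.
pose w (l : 'I_j) := trial_function i0 chi (e l).
pose C (c : 'rV[R]_j) (t : T) := \sum_(l | e l == t) c ord0 l.
have Cel c l : C c (e l) = c ord0 l.
  rewrite /C (bigD1 l)//= big1 ?addr0// => l' /andP[/eqP/e_inj -> ].
  by rewrite eqxx.
have wC c : lincomb w c = trial_comb i0 chi (C c).
  apply/funext => x; rewrite /lincomb /trial_comb (partition_big e xpredT)//=.
  apply: eq_bigr => t _; rewrite /C mulr_suml; apply: eq_bigr => l /eqP <-.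
  by [].
have S0 c : c != 0 -> 0 < \sum_t C c t ^+ 2.
  move=> c0; have [l cl] : exists l, c ord0 l != 0.
    apply/existsP; apply: contraR c0 => /existsPn h.
    by apply/eqP/rowP => l; rewrite mxE; apply/eqP; rewrite -[_ == _]negbK h.
  rewrite (bigD1 (e l))//= ltr_pwDl//; last by apply: sumr_ge0 => t _; exact: sqr_ge0.
  by rewrite Cel lt_def sqr_ge0 sqrf_eq0 cl.
have oO := @dumbbell_open R n i0 il N eps eps01.
have fO := @dumbbell_measure_fin R n i0 il N eps eps01.
have mO : measurable (Omega eps) by exact: measurable_open.
have subO : Omega eps `<=` cbox 0 (\row_i side i0 N i).
  by move=> x /dumbbell_sub_obox; exact: sub_obox_cbox.
apply: ge_ereal_inf; eexists.
  exists w; last reflexivity; split.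
    by move=> l; apply: (Ck2_H2 oO subO fO); exact: Ck_localized.
  move=> c ae0; apply/eqP; apply/negP => /negP/S0 S.
  have := lower eps (C c) eps01; rewrite -wC.
  have -> : L2_sqnorm (Omega eps) (lincomb w c) = 0.
    rewrite /L2_sqnorm /Rintegral (ae_eq_integral (cst 0%E)) ?integral0//.
    - apply/measurable_EFinP; apply: measurable_funX; apply: measurable_funTS.
      apply: measurable_continuous; rewrite wC.
      by have /= := @Ck_trial_comb R n i0 N chi schi 0 (C c).
    - by apply: filterS ae0 => x h Ox; rewrite h// expr0n.
  by rewrite leNgt mulr_gt0.
apply: ge_ereal_sup => _ [c c0 <-]; rewrite lee_fin wC.
have L := lower eps (C c) eps01; have H := upper eps (C c) eps01.
have Sc := S0 c c0.
have L0 : 0 < L2_sqnorm (Omega eps) (trial_comb i0 chi (C c)).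
  by apply: lt_le_trans L; exact: mulr_gt0.
rewrite ler_pdivrMr//; apply: le_trans H _.
have /andP[eps0 _] := eps01.
have -> : K * eps * (\sum_t C c t ^+ 2) = K / kappa * eps * (kappa * \sum_t C c t ^+ 2).
  by field; rewrite gt_eqF.
by apply: ler_wpM2l L; rewrite mulr_ge0 ?divr_ge0 ?(ltW eps0)// ltW.
Qed.

Lemma biharmonic_minmax_ge0 (Om : set 'rV[R]_n) j : (0 < j)%N ->
  (0 <= minmax j Om (H2 Om) (hessian_energy Om))%E.
Proof.
move=> j0; apply: le_ereal_inf_tmp => _ [w _ <-].
pose c : 'rV[R]_j := const_mx 1.
have c0 : c != 0.
  by apply/eqP => /rowP/(_ (Ordinal j0)); rewrite !mxE => /eqP; rewrite oner_eq0.
apply: le_trans; last by apply: ereal_sup_ubound; exists c.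
rewrite lee_fin divr_ge0//.
  rewrite /hessian_energy; apply: fine_ge0; apply: integral_ge0 => x _.
  by rewrite lee_fin sumr_ge0// => i _; apply: sumr_ge0 => k _; exact: sqr_ge0.
by rewrite /L2_sqnorm; apply: fine_ge0; apply: integral_ge0 => x _; rewrite lee_fin sqr_ge0.
Qed.

(** The bounds are known for the extended-real min-max values.  If the one of the
    Laplacian is infinite, its real part is 0 and so is the quotient. *)
Lemma eigenvalue_ratio_bound : exists2 M : R, 0 <= M & forall eps j, 0 < eps < 1 ->
  (N + 2 <= j <= (N + 1) * (n + 1))%N ->
  0 <= biharmonic_neumann_eigenvalue (Omega eps) j
    / laplace_neumann_eigenvalue (Omega eps) j ^+ 2 <= M * eps.
Proof.
have [K K0 upper] := biharmonic_upper_bound.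
have [c c0 lower] := @laplace_lower_bound R n i0 il N i0l.
exists (K / c ^+ 2) => [|eps j eps01 /andP[j1 j2]]; first by rewrite divr_ge0// sqr_ge0.
have /andP[eps0 _] := eps01.
have j0 : (0 < j)%N by apply: leq_trans j1; rewrite addn2.
have := upper eps j eps01 j2; have := biharmonic_minmax_ge0 (Omega eps) j0.
rewrite /biharmonic_neumann_eigenvalue.
case: (minmax j (Omega eps) (H2 _) _) => [m| |]//=; rewrite !lee_fin => m0 mK.
have := lower eps j eps01 j1; rewrite /laplace_neumann_eigenvalue.
case: (minmax j (Omega eps) (H1 _) _) => [l| |]//=.
  rewrite lee_fin => cl; rewrite divr_ge0 ?sqr_ge0//=.
  have l0 : 0 < l by exact: lt_le_trans cl.
  rewrite mulrAC; apply: ler_pM => //; first by rewrite invr_ge0 sqr_ge0.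
  by rewrite lef_pV2 ?posrE ?exprn_gt0// lerXn2r// ?nnegrE ltW.
by move=> _; rewrite expr0n/= invr0 mulr0 lexx/=; rewrite !mulr_ge0 ?invr_ge0 ?sqr_ge0// ltW.
Qed.

End biharmonic.

Theorem theorem4p1 (R : realType) (n : nat) (hn : (2 <= n)%N) (N : nat) (hN : (0 < N)%N) :
  exists (eps0 : R) (Omega : R -> set 'rV[R]_n),
    [/\ 0 < eps0,
        forall eps : R, 0 < eps < eps0 -> bounded_lipschitz_domain (Omega eps) &
        forall j : nat, (N + 2 <= j <= (N + 1) * (n + 1))%N ->
          biharmonic_neumann_eigenvalue (Omega eps) j
            / laplace_neumann_eigenvalue (Omega eps) j ^+ 2 @[eps --> 0^'+] --> (0 : R)].
Proof.
pose i0 : 'I_n := Ordinal (ltnW hn); pose il : 'I_n := Ordinal hn.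
have i0l : i0 != il by [].
exists 1, (fun eps => dumbbell i0 il N eps); split => // [eps eps01|j jN].
  exact: dumbbell_bounded_lipschitz_domain.
have [M M0 hM] := @eigenvalue_ratio_bound R n i0 il N i0l.
apply: (@squeeze_cvgr _ _ _ _ (cst 0) (fun eps => M * eps)).
- near=> eps; apply: hM => //; apply/andP; split.
    by near: eps; exact: nbhs_right_gt.
  by near: eps; apply: nbhs_right_lt.
- exact: cvg_cst.
- rewrite -[X in _ --> X](mulr0 M); apply: cvgMr.
  exact: cvg_at_right_filter.
Unshelve. all: by end_near.
Qed.
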